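(* Let $0<\alpha<1$ and $\beta\ge0$. Then: (i) $\psi_{\alpha,\beta}(t,s)\ge0$ for $t,s>0$. (ii) $\displaystyle\int_0^\infty e^{-\lambda t}\psi_{\alpha,\beta}(t,s)\,dt=\lambda^{-\beta}e^{-\lambda^\alpha s}$ for $s,\lambda>0$. (iii) $\displaystyle\int_0^\infty e^{\lambda s}\psi_{\alpha,\beta}(t,s)\,ds=t^{\alpha+\beta-1}E_{\alpha,\alpha+\beta}(\lambda t^\alpha)$ for $t>0$, $\lambda\in\mathbb{C}$. (iv) $\displaystyle\int_0^\infty\int_0^\infty e^{-\lambda s}e^{-\mu t}\psi_{\alpha,\beta}(t,s)\,ds\,dt=\frac{1}{\mu^\beta(\mu^\alpha+\lambda)}$ for $\lambda,\mu>0$. (v) $\psi_{\alpha,\beta+\gamma}(t,s)=(g_\gamma*\psi_{\alpha,\beta}(\cdot,s))(t)$ for $t,s,\gamma>0$. (vi) $\displaystyle\int_0^\infty g_\eta(s)\psi_{\alpha,\beta}(t,s)\,ds=g_{\alpha\eta+\beta}(t)$ for $t,\eta>0$.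
   Context: For $\gamma>0$, $g_\gamma(t):=t^{\gamma-1}/\Gamma(\gamma)$, $t>0$. Convolution is $(f*h)(t)=\int_0^t f(t-s)h(s)\,ds$. Mittag-Leffler function: $E_{\alpha,\beta}(z):=\sum_{n=0}^\infty \frac{z^n}{\Gamma(\alpha n+\beta)}$, $\alpha,\beta>0$, $z\in\mathbb{C}$. Wright function: for $\lambda>-1$, $\mu\in\mathbb{C}$, $W_{\lambda,\mu}(z):=\sum_{n=0}^\infty \frac{z^n}{n!\,\Gamma(\lambda n+\mu)}$, $z\in\mathbb{C}$ (with $1/\Gamma=0$ at the poles of $\Gamma$). Scaled Wright function: for $0<\alpha<1$, $\beta\ge0$, $\psi_{\alpha,\beta}(t,s):=t^{\beta-1}W_{-\alpha,\beta}(-st^{-\alpha})$, $t>0$, $s\in\mathbb{C}$. *)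

(* Defs.v *)
From HB Require Import structures.
From mathcomp Require Import all_boot all_order all_algebra.
From mathcomp Require Import all_classical all_reals all_analysis.
From mathcomp Require Export complex.
Set Implicit Arguments.
Unset Strict Implicit.
Unset Printing Implicit Defensive.
Import Order.TTheory GRing.Theory Num.Theory.
Import numFieldNormedType.Exports.
Local Open Scope classical_set_scope.
Local Open Scope ring_scope.
Local Open Scope complex_scope.

Definition cexp (R : realType) (z : R[i]) : R[i] :=
  (expR (complex.Re z))%:C * (cos (complex.Im z) +i* sin (complex.Im z)).

(* Absolute (Lebesgue) integrability of a complex-valued function. *)
Definition cintegrable (R : realType) (D : set R) (f : R -> R[i]) : Prop :=
  (@lebesgue_measure R).-integrable D (fun x => (complex.Re (f x))%:E) /\
  (@lebesgue_measure R).-integrable D (fun x => (complex.Im (f x))%:E).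

(* Meaningful under [cintegrable D f]. *)
Definition cintegral (R : realType) (D : set R) (f : R -> R[i]) : R[i] :=
  (\int[@lebesgue_measure R]_(x in D) complex.Re (f x)) +i*
  (\int[@lebesgue_measure R]_(x in D) complex.Im (f x)).

(* Euler's integral, for 0 < Re z, where t^(z-1) = exp ((z-1) ln t). *)
Definition Gamma_integral (R : realType) (z : R[i]) : R[i] :=
  cintegral `]0, +oo[ (fun t => cexp ((z - 1) * (ln t)%:C) * (expR (- t))%:C).

(* Continuation of Euler's integral by the functional equation
     Gamma z = Gamma (z + n) / (z (z + 1) ... (z + n - 1)),
   n being the least natural number such that 0 < Re (z + n).
   At the poles 0, -1, -2, ... the denominator vanishes, so the value given
   here is x / 0 = 0, whose inverse is 0^-1 = 0: hence (Gamma z)^-1 is the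
   entire function 1/Gamma, which is 0 at the poles of Gamma. *)
Definition Gamma (R : realType) (z : R[i]) : R[i] :=
  let n := Num.truncn (1 - complex.Re z) in
  Gamma_integral (z + n%:R) / \prod_(k < n) (z + k%:R).

Definition g_ (R : realType) (gamma t : R) : R[i] :=
  (t `^ (gamma - 1))%:C / Gamma gamma%:C.

Definition conv_integrand (R : realType) (f h : R -> R[i]) (t s : R) : R[i] :=
  f (t - s) * h s.

Definition convolution (R : realType) (f h : R -> R[i]) (t : R) : R[i] :=
  cintegral `]0, t[ (conv_integrand f h t).

(* Sum of a complex series, for the topology of the modulus: R[i] itself carries
   no topology in the library, its copy R[i]^o does. *)
Definition csum (R : realType) (u : nat -> R[i]) : R[i] :=
  limn (series (u : nat -> (R[i])^o)).

Definition mittag_leffler (R : realType) (alpha beta : R) (z : R[i]) : R[i] :=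
  csum (fun n => z ^+ n / Gamma (alpha * n%:R + beta)%:C).

Definition wright (R : realType) (lambda : R) (mu z : R[i]) : R[i] :=
  csum (fun n => z ^+ n / (n`!%:R * Gamma ((lambda * n%:R)%:C + mu))).

Definition psi (R : realType) (alpha beta t : R) (s : R[i]) : R[i] :=
  (t `^ (beta - 1))%:C *
  wright (- alpha) beta%:C (- s * (t `^ (- alpha))%:C).

(* Main.v *)
Require Import Defs.
From HB Require Import structures.
From mathcomp Require Import all_boot all_order all_algebra.
From mathcomp Require Import all_classical all_reals all_analysis.
From mathcomp Require Import complex.
From mathcomp Require Import measurable_realfun ring lra.
Set Implicit Arguments.
Unset Strict Implicit.
Unset Printing Implicit Defensive.
Import Order.TTheory GRing.Theory Num.Theory.
Import numFieldNormedType.Exports.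
Local Open Scope classical_set_scope.
Local Open Scope ring_scope.

(** Write w_b(x) for W_{-alpha,b}(-x), so that psi_{alpha,b}(t,s) is
    t^(b-1) w_b(s t^(-alpha)); for real s and t this is a real number, and only
    the exponential in (iii) is truly complex.

    Positivity.  The series (1 - z)^(-b) and 1 - (1 - z)^alpha have nonnegative
    coefficients, hence so does (1 - z)^(-b) (1 - (1 - z)^alpha)^k, whose n-th
    coefficient is the alternating sum over j of binomial(k, j) times the n-th
    coefficient of (1 - z)^(alpha j - b) (cmcoef_ge0).  By the limit formula of
    Gauss the latter is equivalent to n^(b - alpha j - 1) / Gamma(b - alpha j)
    (cvg_gauss).  With k the integral part of x n^alpha, the n-th coefficient
    times n^(1-b) therefore tends to the sum of
    (-x)^j / (j! Gamma(b - alpha j)), which is w_b(x) (wfun_ge0).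

    Laplace transform in t.  Termwise differentiation and the functional
    equation of Gamma give d/dt psi_{b+1} = psi_b and
    d/ds psi_b = - psi_{b-alpha}.  As w_b decays faster than every power,
    integrating these relations shows that the transform L_b(s) at m satisfies
    L_b = m L_{b+1} and L_b(s) + int_0^s L_{b-alpha} = m^(-b).  Hence the
    functions u_n = m^(b_n) L_{b_n} with b_n = b + n (1 - alpha) satisfy
    u_n(s) + m^alpha int_0^s u_{n+1} = 1.  Positivity bounds them all by 1, and
    iteration of the equation leaves u_n(s) = exp(- m^alpha s)
    (picard_exp, laplace_psiE).  This is (ii), and (iv) follows by Tonelli.

    Moments in s.  By scaling, the integral in (vi) is a constant times
    t^(alpha eta + b - 1); integrating against exp(-t) and using (ii) at 1 gives
    the constant (mellin_psi).  For integer eta these are the moments of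
    psi(t, .), and (iii) follows from the expansion of the exponential: the
    domination needed for complex lambda is the case of a positive lambda, where
    monotone convergence and the growth of Gamma suffice
    (integral_series_psi).

    Convolution.  Both sides of (v) are continuous in t and have the same
    Laplace transform, so that they agree by Lerch's theorem
    (laplace_unique, rconv_psi). *)

(** * Derivatives *)

Section derivatives.
Context {R : realType}.
Implicit Types (f g : R -> R) (x df dg c : R).

Lemma is_derive1D f g x df dg : is_derive x 1 f df -> is_derive x 1 g dg ->
  is_derive x 1 (fun y => f y + g y) (df + dg).
Proof. exact: is_deriveD. Qed.

Lemma is_derive1B f g x df dg : is_derive x 1 f df -> is_derive x 1 g dg ->
  is_derive x 1 (fun y => f y - g y) (df - dg).
Proof. exact: is_deriveB. Qed.

Lemma is_derive1N f x df : is_derive x 1 f df -> is_derive x 1 (fun y => - f y) (- df).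
Proof. exact: is_deriveN. Qed.

Lemma is_derive1M f g x df dg : is_derive x 1 f df -> is_derive x 1 g dg ->
  is_derive x 1 (fun y => f y * g y) (df * g x + f x * dg).
Proof.
move=> Df Dg; apply: (@is_derive_eq _ _ _ _ _ _ _ _ (is_deriveM Df Dg)).
by rewrite /GRing.scale/= addrC mulrC.
Qed.

Lemma is_derive1Z f x df c : is_derive x 1 f df ->
  is_derive x 1 (fun y => c * f y) (c * df).
Proof. exact: is_deriveZ. Qed.

Lemma is_derive1X n x : is_derive x 1 (fun y : R => y ^+ n) (n%:R * x ^+ n.-1).
Proof.
have := is_deriveX n (is_derive_id x (1 : R)).
rewrite /GRing.scale/= mulr1 /=.
by rewrite (_ : (id : R -> R) ^+ n = fun y => y ^+ n)//; apply/funext => y; rewrite fctE.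
Qed.

Lemma is_derive1_expZ c x : is_derive x 1 (fun y => expR (c * y)) (c * expR (c * x)).
Proof.
have D : is_derive x 1 (fun y => c * y) c.
  by have := is_derive1Z c (is_derive_id x (1 : R)); rewrite mulr1.
have := @is_derive1_comp _ expR (fun y => c * y) x _ _ (is_derive_expR _) D.
by rewrite mulrC.
Qed.

Lemma is_derive1_continuous f x df : is_derive x 1 f df -> {for x, continuous f}.
Proof.
by case=> Df _; apply: differentiable_continuous; exact/derivable1_diffP.
Qed.

End derivatives.

(** * Integrals over the half-line *)

Section affine_change.
Context {R : realType}.
Local Notation mu := (@lebesgue_measure R).
Local Notation halfline := (`]0%R, +oo[%classic : set R).
Local Open Scope ereal_scope.

Lemma ge0_integral_shift (f : R -> \bar R) (a : R) :
  measurable_fun [set: R] f -> (forall x, 0 <= f x) ->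
  \int[mu]_x f (x - a)%R = \int[mu]_x f x.
Proof.
move=> mf f0.
pose phi := (fun x => x - a)%R : R -> measurableTypeR R.
have mphi : measurable_fun [set: R] phi by apply: measurable_funB.
have -> : \int[mu]_x f (x - a)%R = \int[mu]_(x in phi @^-1` setT) (f \o phi) x.
  by [].
rewrite -ge0_integral_pushforward//.
apply: eq_measure_integral => A mA _.
apply/esym/lebesgue_measure_unique => //= _ [[u v]] _ <-.
rewrite /pushforward /phi/=.
rewrite (_ : _ @^-1` _ = `](u + a)%R, (v + a)%R]%classic); last first.
  by apply/seteqP; split => x /=; rewrite !in_itv/= ltrBrDr lerBlDr.
rewrite !lebesgue_measure_itv/= !lte_fin ltrD2r; case: ifPn => // _.
by rewrite -!EFinD; congr EFin; rewrite opprD addrACA subrr addr0.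
Qed.

(** The pushforward of the Lebesgue measure by x |-> c x is a multiple of it,
    as one sees on intervals. *)
Lemma ge0_integral_scale (f : R -> \bar R) (c : R) : (0 < c)%R ->
  measurable_fun halfline f -> (forall x : R, (0 < x)%R -> 0 <= f x) ->
  \int[mu]_(x in halfline) f (c * x)%R = c^-1%:E * \int[mu]_(x in halfline) f x.
Proof.
move=> c0 mf f0.
pose phi := (fun x => c * x)%R : R -> measurableTypeR R.
have mphi : measurable_fun [set: R] phi by apply: measurable_funM.
have -> : \int[mu]_(x in halfline) f (c * x)%R
    = \int[mu]_(x in phi @^-1` halfline) (f \o phi) x.
  congr integral; apply/seteqP; split => x /=;
  by rewrite !in_itv/= !andbT /phi pmulr_rgt0.
rewrite -ge0_integral_pushforward//; last first.
  by move=> x; rewrite inE/= in_itv/= andbT => /f0.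
have c0' : (0 <= c^-1)%R by rewrite invr_ge0 ltW.
pose k := NngNum c0'.
have -> : c^-1%:E = k%:num%:E by [].
rewrite -ge0_integral_mscale//; last first.
  by move=> x /=; rewrite in_itv/= andbT => /f0.
apply: eq_measure_integral => A mA _.
have c0c : (0 <= c)%R by rewrite ltW.
pose kc := NngNum c0c.
pose nu : {measure set (measurableTypeR R) -> \bar R} := mscale kc (pushforward mu phi).
have H : forall X, ocitv X -> lebesgue_measure X = nu mphi X.
  move=> _ [[u v]] _ <-.
  rewrite /nu/= /mscale/= /pushforward /phi/=.
  rewrite (_ : _ @^-1` _ = `](u / c)%R, (v / c)%R]%classic); last first.
    apply/seteqP; split => x /=; rewrite !in_itv/=;
    by rewrite ltr_pdivrMr// ler_pdivlMr// mulrC.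
  rewrite !lebesgue_measure_itv/= !lte_fin ltr_pM2r ?invr_gt0//.
  case: ifPn => // _; last by rewrite mule0.
  by rewrite -!EFinD -EFinM -mulrBl mulrC divfK// gt_eqF.
have E := lebesgue_measure_unique H mA.
rewrite /= /mscale/=.
have -> : mu A = nu mphi A by exact: E.
rewrite /nu/= /mscale/= muleA -EFinM mulVf ?mul1e// gt_eqF//.
Qed.

Lemma ge0_tonelli_on (A B : set R) (h : R * R -> \bar R) :
  measurable A -> measurable B -> measurable_fun (A `*` B) h ->
  (forall x y, A x -> B y -> 0 <= h (x, y)) ->
  \int[mu]_(x in A) \int[mu]_(y in B) h (x, y)
  = \int[mu]_(y in B) \int[mu]_(x in A) h (x, y).
Proof.
move=> mA mB mh h0.
pose g := h \_ (A `*` B).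
have mg : measurable_fun [set: R * R] g.
  by apply/(measurable_restrictT h) => //; exact: measurableX.
have g0 z : 0 <= g z.
  rewrite /g patchE; case: ifPn => // /[!inE]; case: z => x y [] /=; exact: h0.
transitivity (\int[mu]_x \int[mu]_y g (x, y)).
  rewrite [LHS]integral_mkcond; apply: eq_integral => x _.
  rewrite patchE; case: ifPn => xA; rewrite ?inE ?notin_setE in xA.
    rewrite [LHS]integral_mkcond; apply: eq_integral => y _.
    rewrite /g !patchE in_setX/= (mem_set xA)/=.
    by case: ifPn.
  rewrite integral0_eq// => y _; rewrite /g patchE in_setX/= memNset//.
rewrite (@fubini_tonelli _ _ _ _ _ mu mu)//.
rewrite [RHS]integral_mkcond; apply: eq_integral => y _.
rewrite patchE; case: ifPn => yB; rewrite ?inE ?notin_setE in yB.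
  rewrite [RHS]integral_mkcond; apply: eq_integral => x _.
  by rewrite /g !patchE in_setX/= (mem_set yB)/= andbT.
by rewrite integral0_eq// => x _; rewrite /g patchE in_setX/= andbC memNset.
Qed.

Lemma measurable_integral_on (A B : set R) (h : R * R -> \bar R) :
  measurable A -> measurable B -> measurable_fun (A `*` B) h ->
  (forall x y, A x -> B y -> 0 <= h (x, y)) ->
  measurable_fun A (fun x => \int[mu]_(y in B) h (x, y)).
Proof.
move=> mA mB mh h0.
pose g := h \_ (A `*` B).
have mg : measurable_fun [set: R * R] g.
  by apply/(measurable_restrictT h) => //; exact: measurableX.
have g0 z : 0 <= g z.
  rewrite /g patchE; case: ifPn => // /[!inE]; case: z => x y [] /=; exact: h0.
have mF := @measurable_fun_fubini_tonelli_F _ _ _ _ _ mu g mg g0.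
apply: (eq_measurable_fun (fubini_F mu g)); last exact: measurable_funS mF.
move=> x; rewrite inE => xA; rewrite /fubini_F [RHS]integral_mkcond.
by apply: eq_integral => y _; rewrite /g !patchE in_setX/= (mem_set xA).
Qed.

End affine_change.

Section integrable_real.
Context {R : realType}.
Local Notation mu := (@lebesgue_measure R).
Variables (D : set R) (mD : measurable D).
Implicit Types (f g : R -> R).

Lemma integrable_EFinZ f c : mu.-integrable D (fun x => (f x)%:E) ->
  mu.-integrable D (fun x => (c * f x)%:E).
Proof.
move=> If.
have : mu.-integrable D (fun x => c%:E * (f x)%:E)%E by exact: integrableZl.
by apply: eq_integrable => // x _; rewrite EFinM.
Qed.

Lemma integrable_EFinN f : mu.-integrable D (fun x => (f x)%:E) ->
  mu.-integrable D (fun x => (- f x)%:E).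
Proof.
by move=> /(integrable_EFinZ (-1)); apply: eq_integrable => // x _; rewrite mulN1r.
Qed.

Lemma integrable_EFinD f g : mu.-integrable D (fun x => (f x)%:E) ->
  mu.-integrable D (fun x => (g x)%:E) ->
  mu.-integrable D (fun x => (f x + g x)%:E).
Proof.
move=> If Ig.
have : mu.-integrable D (fun x => (f x)%:E + (g x)%:E)%E by exact: integrableD.
by apply: eq_integrable => // x _; rewrite EFinD.
Qed.

Lemma integrable_EFinB f g : mu.-integrable D (fun x => (f x)%:E) ->
  mu.-integrable D (fun x => (g x)%:E) ->
  mu.-integrable D (fun x => (f x - g x)%:E).
Proof.
by move=> If Ig; apply: integrable_EFinD => //; exact: integrable_EFinN.
Qed.

Lemma ge0_integrable_value (f : R -> R) (z : R) : measurable_fun D (fun x => (f x)%:E) ->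
  (forall x, D x -> 0 <= f x) -> (\int[mu]_(x in D) (f x)%:E = z%:E)%E ->
  mu.-integrable D (fun x => (f x)%:E) /\ \int[mu]_(x in D) f x = z.
Proof.
move=> mf f0 E; split; last by rewrite /Rintegral E.
apply/integrableP; split => //.
apply: (@le_lt_trans _ _ (\int[mu]_(x in D) (f x)%:E)%E); last by rewrite E ltry.
rewrite le_eqVlt; apply/orP; left; apply/eqP; apply: eq_integral => x.
by rewrite inE => Dx; rewrite abse_EFin ger0_norm ?f0.
Qed.

End integrable_real.

Section reflect.
Context {R : realType}.
Local Notation mu := (@lebesgue_measure R).
Local Open Scope ereal_scope.

Lemma ge0_integral_reflect (f : R -> \bar R) (a : R) :
  measurable_fun [set: R] f -> (forall x, 0 <= f x) ->
  \int[mu]_x f (a - x)%R = \int[mu]_x f x.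
Proof.
move=> mf f0.
pose phi := (fun x => a - x)%R : R -> measurableTypeR R.
have mphi : measurable_fun [set: R] phi by apply: measurable_funB.
have -> : \int[mu]_x f (a - x)%R = \int[mu]_(x in phi @^-1` setT) (f \o phi) x.
  by [].
rewrite -ge0_integral_pushforward//.
apply: eq_measure_integral => A mA _.
apply/esym/lebesgue_measure_unique => //= _ [[u v]] _ <-.
rewrite /pushforward /phi/=.
rewrite (_ : _ @^-1` _ = `[(a - v)%R, (a - u)%R[%classic); last first.
  by apply/seteqP; split => x /=; rewrite !in_itv/= => /andP[h1 h2]; apply/andP; split; lra.
rewrite !lebesgue_measure_itv/= !lte_fin ltrD2l ltrN2; case: ifPn => // _.
by rewrite -!EFinD; congr EFin; ring.
Qed.
End reflect.

Section improper.
Context {R : realType}.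
Local Notation mu := (@lebesgue_measure R).
Local Notation halfline := (`]0%R, +oo[%classic : set R).
Local Open Scope ereal_scope.

(** The integral over ]0, t[ is the limit of the integrals over [t/n, t], by
    positivity; f may be unbounded at 0, which is the case of most densities
    below. *)
Lemma ge0_improper_FTC2 (f F : R -> R) (F0 t : R) : (0 < t)%R ->
  (forall x : R, (0 < x)%R -> is_derive x 1%R F (f x)) ->
  (forall x : R, (0 < x)%R -> {for x, continuous f}) ->
  (forall x : R, (0 < x)%R -> (0 <= f x)%R) ->
  F x @[x --> 0^'+] --> F0 ->
  \int[mu]_(x in `]0%R, t[) (f x)%:E = (F t - F0)%:E.
Proof.
move=> t0 dF cf f0 cF.
pose I n := `[(t / n.+1%:R)%R, t]%classic : set R.
have tn0 n : (0 < t / n.+1%:R)%R by rewrite divr_gt0.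
have ndI : nondecreasing_seq I.
  move=> m n mn; rewrite subsetEset => x; rewrite /I/= !in_itv/= => /andP[a ->].
  rewrite andbT (le_trans _ a)// ler_pM2l// lef_pV2 ?posrE ?ltr0n//.
  by rewrite ler_nat.
have mI n : measurable (I n) by exact: measurable_itv.
have IE : \bigcup_n I n = `]0%R, t]%classic.
  apply/seteqP; split => x.
    move=> [n _]; rewrite /I/= !in_itv/= => /andP[a ->].
    by rewrite andbT (lt_le_trans _ a).
  rewrite /= in_itv/= => /andP[x0 xt]; exists (Num.truncn (t / x)) => //.
  rewrite /I/= in_itv/= xt andbT ler_pdivrMr// mulrC -ler_pdivrMr//.
  exact/ltW/truncnS_gt.
have cfI n : {within I n, continuous f}.
  apply: continuous_in_subspaceT => x; rewrite inE /I/= in_itv/= => /andP[a _].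
  by apply: cf; rewrite (lt_le_trans _ a).
have mfI n : measurable_fun (I n) f.
  exact: subspace_continuous_measurable_fun.
have mfc : measurable_fun `]0%R, t] f.
  by rewrite -IE; apply/measurable_fun_bigcup.
rewrite integral_itv_bndoo//; last first.
  by apply/measurable_EFinP; apply: measurable_funS mfc => //; exact: subset_itv_oo_oc.
rewrite -(@integral_itv_bndoo _ 0%R t _ false false); last first.
  by apply/measurable_EFinP; apply: measurable_funS mfc => //; exact: subset_itv_oo_oc.
rewrite -IE.
have cv : \int[mu]_(x in I i) (EFin \o f) x @[i --> \oo] -->
   \int[mu]_(x in \bigcup_i I i) (EFin \o f) x.
  apply: ge0_nondecreasing_set_cvg_integral => // [i|i x].
    by apply: measurableT_comp => //; exact: mfI.
  rewrite /I/= in_itv/= => /andP[a _].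
  by rewrite lee_fin f0// (lt_le_trans _ a).
apply/esym; move: cv => /cvg_lim <- //.
apply/esym/cvg_lim => //.
rewrite -cvg_shiftS/=.
have FE n : \int[mu]_(x in I n.+1) (f x)%:E = (F t - F (t / n.+2%:R)%R)%:E.
  have lt : (t / n.+2%:R < t)%R by rewrite ltr_pdivrMr// ltr_pMr// ltr1n.
  have dx x : (t / n.+2%:R <= x)%R -> derivable F x 1%R.
    by move=> a; have [] := dF x (lt_le_trans (tn0 _) a).
  have cFx x : (t / n.+2%:R <= x)%R -> {for x, continuous F}.
    by move=> a; apply: differentiable_continuous; exact/derivable1_diffP/dx.
  rewrite (@continuous_FTC2 _ _ F)//; [exact: cfI| |].
    split.
    - by move=> x; rewrite in_itv/= => /andP[a _]; apply/dx/ltW.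
    - by apply: cvg_at_right_filter; apply: cFx.
    - by apply: cvg_at_left_filter; apply: cFx; apply: ltW.
  move=> x; rewrite in_itv/= => /andP[a _].
  by rewrite derive1E; have [] := dF x (lt_trans (tn0 _) a).
under eq_fun do rewrite FE.
apply: cvg_EFin; first by apply: nearW.
apply: cvgB; first exact: cvg_cst.
have cv0 : (t / n.+2%:R)%R @[n --> \oo] --> (0 : R)%R.
  rewrite -(mulr0 t); apply: cvgM; first exact: cvg_cst.
  rewrite (cvg_shiftS (fun n => n.+1%:R^-1 : R)%R).
  exact: cvg_harmonic.
move/cvg_at_rightP : cF; apply; split => // n.
Qed.
End improper.

(** * Laplace transform of a convolution *)

Section laplace.
Context {R : realType}.
Local Notation mu := (@lebesgue_measure R).
Local Notation halfline := (`]0%R, +oo[%classic : set R).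
Local Open Scope ereal_scope.

(** After extension by 0 to the negative half-line both factors are damped by an
    exponential that is multiplicative, so that the left-hand side is the integral
    of a convolution over the whole line; Tonelli and invariance by translation
    conclude. *)
Lemma ge0_laplace_convolution (f h : R -> R) (m : R) :
  measurable_fun [set: R] f -> measurable_fun [set: R] h ->
  (forall x : R, (0 < x)%R -> (0 <= f x)%R) ->
  (forall x : R, (0 < x)%R -> (0 <= h x)%R) ->
  \int[mu]_(t in halfline) ((expR (- (m * t)))%:E *
      \int[mu]_(r in `]0%R, t[) (f (t - r) * h r)%:E)
  = (\int[mu]_(t in halfline) (expR (- (m * t)) * f t)%:E) *
    (\int[mu]_(t in halfline) (expR (- (m * t)) * h t)%:E).
Proof.
move=> mf mh f0 h0.
have mexp : measurable_fun [set: R] (fun x => expR (- (m * x))).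
  apply: measurableT_comp => //; apply: measurableT_comp => //.
pose damp (k : R -> R) := (fun x => (expR (- (m * x)) * k x)%:E) \_ halfline.
have mdamp (k : R -> R) : measurable_fun [set: R] k -> measurable_fun [set: R] (damp k).
  move=> mk; apply/(measurable_restrictT (fun x => (expR (- (m * x)) * k x)%:E)) => //.
  apply/measurable_EFinP; apply: measurable_funS (@measurable_funM _ _ _ setT _ _ mexp mk) => //.
have damp0 (k : R -> R) : (forall x : R, (0 < x)%R -> (0 <= k x)%R) -> forall x, 0 <= damp k x.
  move=> k0 x; rewrite /damp patchE; case: ifPn => //.
  rewrite inE/= in_itv/= andbT => x0.
  by rewrite lee_fin mulr_ge0 ?expR_ge0// k0.
have dampE (k : R -> R) (x : R) : (0 < x)%R -> damp k x = (expR (- (m * x)) * k x)%:E.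
  by move=> x0; rewrite /damp patchE mem_set//= in_itv/= x0.
have dampN (k : R -> R) (x : R) : (x <= 0)%R -> damp k x = 0.
  by move=> x0; rewrite /damp patchE memNset//= in_itv/= andbT; apply/negP; rewrite -leNgt.
have F0 := damp0 f f0. have H0 := damp0 h h0.
have mF := mdamp f mf. have mH := mdamp h mh.
transitivity (\int[mu]_t \int[mu]_r (damp f (t - r)%R * damp h r)).
  rewrite [LHS]integral_mkcond; apply: eq_integral => t _; rewrite patchE.
  case: ifPn; rewrite ?inE ?notin_setE/= in_itv/= andbT => t0.
    rewrite -ge0_integralZl_EFin//; last 2 first.
    - by move=> r/=; rewrite in_itv/= => /andP[r0 rt];
         rewrite lee_fin mulr_ge0 ?h0 ?f0 ?subr_gt0.
    - apply/measurable_EFinP; apply: measurable_funM.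
        apply: measurable_funS (_ : measurable_fun [set: R] (fun r => f (t - r)%R)) => //.
        apply: measurableT_comp => //; exact: measurable_funB.
      exact: measurable_funS mh.
    rewrite [LHS]integral_mkcond; apply: eq_integral => r _; rewrite patchE.
    case: ifPn; rewrite ?inE ?notin_setE/= in_itv/=.
      move=> /andP[r0 rt]; rewrite !dampE ?subr_gt0//.
      by rewrite -!EFinM; congr EFin; rewrite mulrACA -expRD; congr (expR _ * _)%R; ring.
    move=> /negP; rewrite negb_and -!leNgt => /orP[r0|tr].
      by rewrite (dampN h)// mule0.
    by rewrite (dampN f) ?mul0e// subr_le0.
  move/negP : t0; rewrite -leNgt => t0; rewrite integral0_eq// => r _.
  have [r0|r0] := leP r 0%R; first by rewrite (dampN h)// mule0.
  by rewrite (dampN f) ?mul0e// subr_le0 (le_trans t0)// ltW.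
rewrite (@fubini_tonelli _ _ _ _ _ mu mu (fun z => damp f (z.1 - z.2)%R * damp h z.2))//=; last 2 first.
- apply: emeasurable_funM.
    by apply: measurableT_comp => //; exact: measurable_funB.
  exact: measurableT_comp.
- by move=> z; rewrite mule_ge0.
transitivity (\int[mu]_r ((\int[mu]_t damp f t) * damp h r)).
  apply: eq_integral => r _; rewrite ge0_integralZr//; last first.
    by apply: measurableT_comp => //; exact: measurable_funB.
  by rewrite ge0_integral_shift.
rewrite ge0_integralZl//; last by apply: integral_ge0.
by rewrite /damp -!integral_mkcond.
Qed.

End laplace.

(** * The Gamma function on the positive reals *)

Section real_gamma.
Context {R : realType}.
Local Notation mu := (@lebesgue_measure R).
Local Notation halfline := (`]0%R, +oo[%classic : set R).
Implicit Types (b c p m t u x : R).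

Definition rGamma b : R := \int[mu]_(t in halfline) (t `^ (b - 1) * expR (- t)).

Lemma measurable_powR_exp b m :
  measurable_fun [set: R] (fun t => expR (- (m * t)) * t `^ b).
Proof.
apply: measurable_funM; last exact: measurable_powR.
by apply: measurableT_comp => //; apply: measurableT_comp.
Qed.

Lemma integral_powR_itv b t : 0 < b -> 0 < t ->
  (\int[mu]_(u in `]0%R, t[) (u `^ (b - 1))%:E = (t `^ b / b)%:E)%E.
Proof.
move=> b0 t0.
have dF x : 0 < x -> is_derive x 1 (fun u => b^-1 * u `^ b) (x `^ (b - 1)).
  move=> x0; have := is_derive1Z b^-1 (is_derive1_powR b x0).
  by rewrite mulrA mulVf ?gt_eqF// mul1r.
rewrite (@ge0_improper_FTC2 _ _ (fun u => b^-1 * u `^ b) 0)//.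
- by rewrite subr0 mulrC.
- move=> x x0; exact: is_derive1_continuous (is_derive1_powR (b - 1) x0).
- by move=> x _; exact: powR_ge0.
- rewrite -[X in _ --> X](mulr0 b^-1); apply: cvgM; first exact: cvg_cst.
  exact: powR_cvg0.
Qed.

Lemma integral_exp_halfline : (\int[mu]_(t in halfline) (expR (- t))%:E = 1)%E.
Proof.
rewrite integral_itv_obnd_cbnd; last first.
  apply/measurable_EFinP; apply: measurable_funS (_ : measurable_fun [set: R] _) => //.
  exact: measurableT_comp.
have dF x : is_derive x 1 (fun t => - expR (- t)) (expR (- x)).
  have := is_derive1N (is_derive1_expZ (-1) x); rewrite !mulN1r opprK.
  rewrite (_ : (fun y => - expR (-1 * y)) = (fun y => - expR (- y)))//.
  by apply/funext => y; rewrite mulN1r.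
have cexp : continuous (fun t : R => expR (- t)).
  move=> x; apply: continuous_comp; last exact: continuous_expR.
  exact: continuousN.
rewrite (@ge0_continuous_FTC2y _ _ (fun t => - expR (- t)) 0 0)//.
- by rewrite oppr0 expR0 -EFinB opprK add0r.
- exact: continuous_subspaceT.
- by rewrite -[X in _ --> X]oppr0; apply: cvgN; exact: cvgr_expR.
- apply: cvg_at_right_filter; exact: is_derive1_continuous (dF 0).
- by move=> x _; rewrite derive1E; have [] := dF x.
Qed.

Let igamma b := (\int[mu]_(t in halfline) (t `^ (b - 1) * expR (- t))%:E)%E.

Let mgamma b : measurable_fun halfline (fun t => t `^ (b - 1) * expR (- t)).
Proof.
apply: measurable_funS (_ : measurable_fun [set: R] _) => //.
apply: measurable_funM; first exact: measurable_powR.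
exact: measurableT_comp.
Qed.

Let emgamma b : measurable_fun halfline (fun t => (t `^ (b - 1) * expR (- t))%:E).
Proof. by apply/measurable_EFinP. Qed.

Let gamma_ge0 b t : 0 <= t `^ (b - 1) * expR (- t).
Proof. by rewrite mulr_ge0 ?powR_ge0 ?expR_ge0. Qed.

Let igamma_ge0 b : (0 <= igamma b)%E.
Proof. by apply: integral_ge0 => t _; rewrite lee_fin. Qed.

(** Integration by parts in disguise: exp(-t) t^b / b is the damped convolution of
    1 with u^(b-1), whose integral is a product of two Laplace transforms. *)
Let igammaS b : 0 < b -> igamma (b + 1) = (b%:E * igamma b)%E.
Proof.
move=> b0.
have := @ge0_laplace_convolution R (fun=> 1) (fun u => u `^ (b - 1)) 1
  (measurable_cst _) (measurable_powR _).
move=> /(_ (fun _ _ => ler01) (fun _ _ => powR_ge0 _ _)).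
have -> : (\int[mu]_(t in halfline) (expR (- (1 * t)) * 1)%:E = 1)%E.
  rewrite -integral_exp_halfline; apply: eq_integral => t _.
  by rewrite mulr1 mul1r.
rewrite mul1e.
have -> : (\int[mu]_(t in halfline) (expR (- (1 * t)) * t `^ (b - 1))%:E = igamma b)%E.
  by apply: eq_integral => t _; rewrite mul1r mulrC.
move=> <-.
rewrite -ge0_integralZl//; last 3 first.
- apply: (@eq_measurable_fun _ _ _ _ _ (fun t => (b^-1 * (t `^ b * expR (- t)))%:E)).
    move=> t; rewrite inE/= in_itv/= andbT => t0.
    under eq_integral do rewrite mul1r.
    by rewrite integral_powR_itv// mul1r -EFinM; congr EFin; ring.
  apply/measurable_EFinP; apply: measurable_funM => //.
  by have := mgamma (b + 1); rewrite addrK.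
- move=> t _; rewrite mule_ge0 ?lee_fin ?expR_ge0// integral_ge0// => x _.
  by rewrite mul1r lee_fin powR_ge0.
- by rewrite lee_fin ltW.
apply: eq_integral => t; rewrite inE/= in_itv/= andbT => t0.
under eq_integral do rewrite mul1r.
rewrite integral_powR_itv// addrK mul1r -!EFinM; congr EFin.
by rewrite mulrCA [t `^ b / b]mulrC mulVKf ?gt_eqF// mulrC.
Qed.

Let igamma1 : igamma 1 = 1%E.
Proof.
rewrite -integral_exp_halfline; apply: eq_integral => t _.
by rewrite subrr powRr0 mul1r.
Qed.

Let igamma_nat n : igamma n.+1%:R = (n`!%:R)%:E.
Proof.
elim: n => [|n IH]; first by rewrite igamma1 fact0.
by rewrite -natr1 igammaS// IH -EFinM factS natrM.
Qed.

Let igamma_lty b : 0 < b -> (igamma b < +oo)%E.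
Proof.
move=> b0.
have bE : igamma b = ((b^-1)%:E * igamma (b + 1))%E.
  by rewrite igammaS// muleA -EFinM mulVf ?gt_eqF// mul1e.
rewrite bE lte_mul_pinfty ?lee_fin ?invr_ge0 ?(ltW b0)//.
pose N := (Num.truncn b).+1.
have bN : b <= N%:R by exact/ltW/truncnS_gt.
apply: (@le_lt_trans _ _ (igamma 1 + igamma N.+1%:R)%E); last first.
  by rewrite igamma1 igamma_nat -EFinD ltry.
rewrite -ge0_integralD//; last 4 first.
- by move=> t _; rewrite lee_fin.
- exact: emgamma.
- by move=> t _; rewrite lee_fin.
- exact: emgamma.
apply: ge0_le_integral => //.
- by move=> t _; rewrite lee_fin.
- exact: emgamma.
- by apply: emeasurable_funD; exact: emgamma.
move=> t /=; rewrite in_itv/= andbT => t0.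
rewrite -EFinD lee_fin -mulrDl ler_wpM2r ?expR_ge0//.
rewrite addrK subrr powRr0 -natr1 addrK.
have [t1|t1] := leP t 1.
  apply: ler_wpDr; first exact: powR_ge0.
  rewrite -[leRHS](powRr0 t); apply: ger_powR; first by rewrite t0.
  exact: ltW.
apply: ler_wpDl => //; apply: ler_powR => //; exact: ltW.
Qed.

Lemma integrable_gamma b : 0 < b ->
  mu.-integrable halfline (fun t => (t `^ (b - 1) * expR (- t))%:E).
Proof.
move=> b0; apply/integrableP; split; first exact: emgamma.
apply: le_lt_trans (igamma_lty b0); rewrite le_eqVlt; apply/orP; left; apply/eqP.
by apply: eq_integral => t _; rewrite gee0_abs ?lee_fin.
Qed.

Lemma rGammaE b : 0 < b ->
  (\int[mu]_(t in halfline) (t `^ (b - 1) * expR (- t))%:E = (rGamma b)%:E)%E.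
Proof.
move=> b0; rewrite /rGamma /Rintegral fineK//.
by rewrite ge0_fin_numE; [exact: igamma_lty|exact: igamma_ge0].
Qed.

Lemma rGammaD1 b : 0 < b -> rGamma (b + 1) = b * rGamma b.
Proof.
move=> b0; apply: EFin_inj; rewrite EFinM -rGammaE ?addr_gt0// -rGammaE//.
exact: igammaS.
Qed.

Lemma rGamma_nat n : rGamma n.+1%:R = n`!%:R.
Proof. by apply: EFin_inj; rewrite -rGammaE// [LHS]igamma_nat. Qed.

Lemma laplace_powR b m : 0 < b -> 0 < m ->
  (\int[mu]_(t in halfline) (expR (- (m * t)) * t `^ (b - 1))%:E
   = (m `^ (- b) * rGamma b)%:E)%E.
Proof.
move=> b0 m0.
have E t : 0 < t -> (expR (- (m * t)) * t `^ (b - 1))%:E =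
   ((m `^ (1 - b))%:E * ((m * t) `^ (b - 1) * expR (- (m * t)))%:E)%E.
  move=> t0; rewrite -EFinM; congr EFin.
  have M : m `^ (1 - b) * m `^ (b - 1) = 1.
    rewrite -powRD; last by rewrite (gt_eqF m0) implybT.
    by rewrite addrA subrK subrr powRr0.
  by rewrite powRM ?ltW// !mulrA M mul1r mulrC.
transitivity (\int[mu]_(t in halfline) ((m `^ (1 - b))%:E *
    ((m * t) `^ (b - 1) * expR (- (m * t)))%:E))%E.
  by apply: eq_integral => t; rewrite inE/= in_itv/= andbT; exact: E.
rewrite ge0_integralZl_EFin ?powR_ge0//; last 2 first.
- by move=> t _; rewrite lee_fin.
- apply/measurable_EFinP.
  apply: measurable_funS (_ : measurable_fun [set: R] _) => //.
  apply: measurable_funM; last first.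
    by apply: measurableT_comp => //; apply: measurableT_comp.
  apply: (measurableT_comp (measurable_powR (b - 1))); exact: measurable_funM.
rewrite (@ge0_integral_scale _ (fun t => (t `^ (b - 1) * expR (- t))%:E) m)//; last first.
  by move=> t _; rewrite lee_fin.
rewrite rGammaE// -!EFinM mulrA; congr (_ * _)%:E.
rewrite -[m^-1]powR_inv1 ?ltW// -powRD; last by rewrite (gt_eqF m0) implybT.
by rewrite addrAC subrr add0r.
Qed.

Lemma powR_mulB1 x c : 0 < x -> x `^ c = x `^ (c - 1) * x.
Proof.
move=> x0; have {3}-> : x = x `^ 1 by rewrite powRr1// ltW.
by rewrite -powRD ?subrK// (gt_eqF x0) implybT.
Qed.

(** For these exponents t^c is convex, and its graph lies above its tangent at p.
    With u = t / p this is Bernoulli's inequality, which comes from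
    1 + y <= exp y. *)
Lemma powR_tangent t p c : 0 < t -> 0 < p -> (1 <= c \/ c <= 0) ->
  p `^ c + c * p `^ (c - 1) * (t - p) <= t `^ c.
Proof.
move=> t0 p0 hc.
pose u := t / p; have u0 : 0 < u by rewrite divr_gt0.
have pE := powR_mulB1 c p0.
have tE : t = u * p by rewrite /u divfK// gt_eqF.
have lnu x : 0 < x -> ln x <= x - 1.
  by move=> x0; have := @le_ln1Dx R (x - 1); rewrite [1 + _]addrC subrK; apply; lra.
have B : 1 + c * (u - 1) <= u `^ c.
  case: hc => hc.
    rewrite (powR_mulB1 c u0) [_ * u]mulrC.
    have : 1 + (c - 1) * (1 - u^-1) <= u `^ (c - 1).
      rewrite /powR gt_eqF//; apply: le_trans (expR_ge1Dx _).
      rewrite lerD2l ler_wpM2l ?subr_ge0//.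
      by have := lnu u^-1; rewrite invr_gt0 lnV ?posrE// => /(_ u0); lra.
    move=> /(ler_wpM2l (ltW u0)) h; apply: le_trans h.
    rewrite le_eqVlt; apply/orP; left; apply/eqP; field; exact: lt0r_neq0.
  rewrite /powR gt_eqF//; apply: le_trans (expR_ge1Dx _).
  by rewrite lerD2l ler_wnM2l// lnu.
rewrite {2}tE powRM ?(ltW u0) ?(ltW p0)// pE.
have pp : 0 < p `^ (c - 1) * p by rewrite mulr_gt0 ?powR_gt0.
have -> : p `^ (c - 1) * p + c * p `^ (c - 1) * (t - p) =
   (1 + c * (u - 1)) * (p `^ (c - 1) * p).
  by rewrite tE; ring.
by rewrite ler_wpM2r// ltW.
Qed.

Lemma rGamma_ge0 b : 0 <= rGamma b.
Proof. by apply: Rintegral_ge0 => t _. Qed.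

(** Jensen's inequality: p is the mean of the density proportional to
    t^(p-1) exp(-t), and Gamma(p + c) / Gamma(p) is the mean of the convex function
    t^c. *)
Lemma rGamma_shift p c : 0 < p -> 0 < p + c -> (1 <= c \/ c <= 0) ->
  p `^ c * rGamma p <= rGamma (p + c).
Proof.
move=> p0 pc0 hc.
pose A := p `^ c - c * p `^ (c - 1) * p.
pose B := c * p `^ (c - 1).
have <- : A * rGamma p + B * rGamma (p + 1) = p `^ c * rGamma p.
  by rewrite rGammaD1// /A /B; ring.
have I1 := integrable_gamma p0.
have I2 : mu.-integrable halfline (fun t => (t `^ (p + 1 - 1) * expR (- t))%:E).
  by apply: integrable_gamma; rewrite addr_gt0.
rewrite /rGamma -RintegralZl// -RintegralZl// -RintegralD//; last 2 first.
- exact: integrable_EFinZ.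
- exact: integrable_EFinZ.
apply: le_Rintegral => //.
- by apply: integrable_EFinD => //; exact: integrable_EFinZ.
- exact: integrable_gamma.
move=> t /=; rewrite in_itv/= andbT => t0.
have E1 : t `^ (p + c - 1) = t `^ (p - 1) * t `^ c.
  rewrite -powRD; last by rewrite (gt_eqF t0) implybT.
  by congr powR; ring.
rewrite addrK (powR_mulB1 p t0) E1.
have q0 : 0 < t `^ (p - 1) * expR (- t).
  by rewrite mulr_gt0 ?powR_gt0 ?expR_gt0.
have := ler_wpM2l (ltW q0) (powR_tangent t0 p0 hc).
move=> h; rewrite [leRHS]mulrAC; apply: le_trans h.
by rewrite le_eqVlt; apply/orP; left; apply/eqP; rewrite /A /B; ring.
Qed.

Lemma rGamma_gt0 b : 0 < b -> 0 < rGamma b.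
Proof.
move=> b0; pose n := (Num.truncn b).+1.
have bn : b <= n%:R by exact/ltW/truncnS_gt.
have := @rGamma_shift n%:R (b - n%:R) _ _ (or_intror _).
rewrite addrC subrK => /(_ (ltr0Sn _ _) b0); rewrite subr_le0 => /(_ bn).
apply: lt_le_trans; rewrite mulr_gt0 ?powR_gt0//.
by rewrite rGamma_nat ltr0n fact_gt0.
Qed.

End real_gamma.

(** * The reciprocal Gamma function on the real line *)

(** The entire function 1/Gamma at a real argument, 0 at the poles of Gamma.  The
    number of steps is the one in the definition of Gamma. *)
HB.lock Definition recipGamma (R : realType) (b : R) : R :=
  let n := Num.truncn (1 - b) in (\prod_(k < n) (b + k%:R)) / rGamma (b + n%:R).

Section recip_gamma.
Context {R : realType}.
Implicit Types (b c : R).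

Lemma recipGamma_gt0E b : 0 < b -> recipGamma b = (rGamma b)^-1.
Proof.
move=> b0; rewrite recipGamma.unlock; cbv zeta; have -> : Num.truncn (1 - b) = 0%N.
  by apply/truncn0Pn; rewrite -ltNge; lra.
by rewrite big_ord0 addr0 mul1r.
Qed.

Lemma recipGamma_rec b : recipGamma b = b * recipGamma (b + 1).
Proof.
have [b0|b0] := ltP 0 b.
  rewrite !recipGamma_gt0E ?addr_gt0// rGammaD1// invfM mulrA mulfV ?gt_eqF//.
  by rewrite mul1r.
rewrite recipGamma.unlock; cbv zeta.
have -> : Num.truncn (1 - b) = (Num.truncn (1 - (b + 1))).+1.
  have h : 0 <= 1 - (b + 1) by lra.
  have := truncn_itv h; set n := Num.truncn _ => /andP[h1 h2].
  by apply: truncn_def; move: h2; rewrite -!natr1 => h2; apply/andP; split; lra.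
rewrite big_ord_recl addr0 -mulrA; congr (b * (_ / rGamma _)).
  by apply: eq_bigr => i _; rewrite lift0 -natr1; ring.
by rewrite -natr1; ring.
Qed.

Lemma recipGamma_prod b n :
  recipGamma b = (\prod_(k < n) (b + k%:R)) * recipGamma (b + n%:R).
Proof.
elim: n => [|n IH]; first by rewrite big_ord0 mul1r addr0.
rewrite IH big_ord_recr/= -mulrA; congr (_ * _).
by rewrite recipGamma_rec -natr1 addrA.
Qed.

(** On [1, +oo[ convexity compares Gamma with its value 1 at the points 1 and 2;
    on ]0, 1] one step of the functional equation only improves the bound. *)
Lemma recipGamma_bound_gt0 b : 0 < b -> 0 <= recipGamma b <= 2.
Proof.
move=> b0.
have G1 : rGamma 1 = 1 :> R by exact: rGamma_nat 0.
have G2 : rGamma 2 = 1 :> R by exact: rGamma_nat 1.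
have half c : 1 <= c -> 2^-1 <= rGamma c.
  move=> c1; have [c2|c2] := leP 2 c.
    have : 1 `^ (c - 1) * rGamma 1 <= rGamma (1 + (c - 1)).
      by apply: rGamma_shift; [lra|lra|left; lra].
    by rewrite [1 + _]addrC subrK powR1 mul1r G1; lra.
  have : 2 `^ (c - 2) * rGamma 2 <= rGamma (2 + (c - 2)).
    by apply: rGamma_shift; [lra|lra|right; lra].
  rewrite [2 + _]addrC subrK G2 mulr1; apply: le_trans.
  by rewrite -[leLHS]powR_inv1//; apply: ler_powR; lra.
have inv2 c : 1 <= c -> (rGamma c)^-1 <= 2.
  by move=> c1; rewrite -[leRHS]invrK lef_pV2 ?posrE ?half// ?rGamma_gt0//; lra.
have [b1|b1] := leP 1 b.
  by rewrite recipGamma_gt0E// invr_ge0 rGamma_ge0 inv2.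
rewrite recipGamma_rec recipGamma_gt0E ?addr_gt0//.
have i0 : 0 <= (rGamma (b + 1))^-1 by rewrite invr_ge0 rGamma_ge0.
apply/andP; split; first by rewrite mulr_ge0// ltW.
have i2 : (rGamma (b + 1))^-1 <= 2 by apply: inv2; lra.
by nra.
Qed.

(** After m steps the argument is in ]0, 1], and the k-th factor counted from the
    last one has absolute value at most k. *)
Lemma recipGamma_bound b : `|recipGamma b| <= 2 * (Num.truncn (1 - b))`!%:R.
Proof.
have [b0|b0] := ltP 0 b.
  have /andP[h1 h2] := recipGamma_bound_gt0 b0.
  have -> : Num.truncn (1 - b) = 0%N by apply/truncn0Pn; rewrite -ltNge; lra.
  by rewrite fact0 mulr1 ger0_norm.
set m := Num.truncn (1 - b).
have h : 0 <= 1 - b by lra.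
have /andP[m1 m2] := truncn_itv h; rewrite -/m -natr1 in m1 m2.
have bm0 : 0 < b + m%:R by lra.
rewrite (recipGamma_prod b m) normrM mulrC; apply: ler_pM => //.
  by have /andP[h1 h2] := recipGamma_bound_gt0 bm0; rewrite ger0_norm.
rewrite normr_prod fact_prod big_add1/= natr_prod -(big_mkord xpredT (fun k => `|b + k%:R|)).
rewrite big_nat_rev/= [leRHS]big_nat [leLHS]big_nat; apply: ler_prod => i /andP[_ im].
rewrite normr_ge0/= add0n.
have -> : (m - i.+1)%:R = m%:R - i%:R - 1 :> R by rewrite natrB// -natr1; ring.
rewrite ler_norml -natr1; have : (0 : R) <= i%:R by [].
by move=> i0; apply/andP; split; lra.
Qed.
End recip_gamma.

(** * Coefficients of (1 - z)^(-b) (1 - (1 - z)^a)^k *)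

Section gbinomial.
Context {R : realType}.
Implicit Types (a b c x y : R).

(** The coefficient of z^n in (1 - z)^(-b). *)
Definition gbin b n : R := \prod_(i < n) ((b + i%:R) / i.+1%:R).

Lemma gbin0 b : gbin b 0 = 1.
Proof. by rewrite /gbin big_ord0. Qed.

Lemma gbinS b n : n.+1%:R * gbin b n.+1 = (b + n%:R) * gbin b n.
Proof.
by rewrite /gbin big_ord_recr/= mulrC -mulrA divfK// mulrC.
Qed.

Lemma gbin_ge0 b n : 0 <= b -> 0 <= gbin b n.
Proof. by move=> b0; apply: prodr_ge0 => i _; rewrite divr_ge0// addr_ge0. Qed.

(** Hence 1 - (1 - z)^a has nonnegative coefficients. *)
Lemma gbinN_le0 a n : 0 <= a -> a <= 1 -> gbin (- a) n.+1 <= 0.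
Proof.
move=> a0 a1; rewrite /gbin big_ord_recl/= addr0 divr1 mulNr oppr_le0 mulr_ge0//.
apply: prodr_ge0 => i _; rewrite /bump/= add1n divr_ge0// -natr1.
by have : (0 : R) <= i%:R by []; lra.
Qed.

(** The product of the series for b and c is the one for b + c.  Both sides obey
    the recursion (n + 1) g_(n+1) = (b + c + n) g_n, because in degree n + 1 the
    weight n + 1 - m can be charged to the first factor and m to the second. *)
Lemma gbin_vandermonde b c n :
  gbin (b + c) n = \sum_(m < n.+1) gbin b (n - m) * gbin c m.
Proof.
elim: n => [|n IH]; first by rewrite big_ord1 subnn !gbin0 mulr1.
have n10 : n.+1%:R != 0 :> R by rewrite pnatr_eq0.
apply: (mulfI n10); rewrite gbinS IH !mulr_sumr.
transitivity (\sum_(m < n.+2) (n.+1 - m)%:R * (gbin b (n.+1 - m) * gbin c m)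
  + \sum_(m < n.+2) m%:R * (gbin b (n.+1 - m) * gbin c m)); last first.
  rewrite -big_split/=; apply: eq_bigr => m _.
  by rewrite -mulrDl -natrD subnK// -ltnS.
rewrite [X in _ = X + _]big_ord_recr/= subnn mul0r addr0.
rewrite [X in _ = _ + X]big_ord_recl/= mul0r add0r -big_split/=.
apply: eq_bigr => m _.
have mn : (m <= n)%N by rewrite -ltnS.
rewrite /bump/= add1n subSS subSn// [X in _ = X + _]mulrA gbinS [X in _ = _ + X]mulrCA gbinS natrB//.
by ring.
Qed.

(** The coefficient of z^n in (1 - z)^(-b) (1 - (1 - z)^a)^k, after binomial
    expansion of the last factor. *)
Definition cmcoef a b k n : R :=
  \sum_(j < k.+1) (-1) ^+ j * 'C(k, j)%:R * gbin (b - a * j%:R) n.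

Lemma cmcoefS a b k n : cmcoef a b k.+1 n = cmcoef a b k n - cmcoef a (b - a) k n.
Proof.
rewrite /cmcoef big_ord_recl/= bin0.
under eq_bigr do rewrite /bump/= add1n binS natrD mulrDr mulrDl.
rewrite big_split/= addrA; congr (_ + _).
  rewrite [RHS]big_ord_recl/= bin0; congr (_ + _).
  rewrite big_ord_recr/= bin_small// mulr0 mul0r addr0.
  by apply: eq_bigr => i _; rewrite /bump.
rewrite -sumrN; apply: eq_bigr => i _.
rewrite exprS -!mulrA mulN1r; congr (- (_ * (_ * gbin _ _))).
by rewrite -natr1; ring.
Qed.

(** Multiplication of the power series by (1 - z)^a. *)
Lemma cmcoef_shift a b k n :
  cmcoef a (b - a) k n = \sum_(m < n.+1) gbin (- a) (n - m) * cmcoef a b k m.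
Proof.
rewrite /cmcoef; under [RHS]eq_bigr do rewrite mulr_sumr.
rewrite exchange_big/=; apply: eq_bigr => j _.
rewrite (_ : b - a - a * j%:R = - a + (b - a * j%:R)); last by ring.
rewrite gbin_vandermonde mulr_sumr; apply: eq_bigr => m _.
by ring.
Qed.

(** One more factor 1 - (1 - z)^a subtracts the product by (1 - z)^a; its constant
    term 1 cancels, and the other coefficients are nonpositive. *)
Lemma cmcoef_ge0 a b k n : 0 <= a -> a <= 1 -> 0 <= b -> 0 <= cmcoef a b k n.
Proof.
move=> a0 a1 b0; elim: k n => [|k IH] n.
  by rewrite /cmcoef big_ord1 bin0 expr0 !mul1r mulr0 subr0 gbin_ge0.
rewrite cmcoefS cmcoef_shift big_ord_recr/= subnn gbin0 mul1r opprD addrCA subrr addr0.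
rewrite oppr_ge0; apply: sumr_le0 => i _; apply: mulr_le0_ge0; last exact: IH.
have -> : (n - i)%N = (n - i.+1).+1 by rewrite subnSK.
exact: gbinN_le0.
Qed.

End gbinomial.

(** * The limit formula of Gauss for 1/Gamma *)

Section gauss.
Context {R : realType}.
Implicit Types (b c d x : R).

Lemma gbin_gammaE b n : 0 < b + n%:R ->
  gbin b n = recipGamma b * (rGamma (b + n%:R) / n`!%:R).
Proof.
move=> bn0; rewrite (recipGamma_prod b n) (recipGamma_gt0E bn0).
rewrite mulrA divfK ?gt_eqF ?rGamma_gt0// /gbin big_split/=; congr (_ * _).
rewrite fact_prod big_add1/= big_mkord natr_prod prodfV//.
Qed.

(** The quotient of gbin b n by its equivalent n^(b-1) / Gamma(b), written so that
    it makes sense at the poles of Gamma. *)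
Definition gauss_ratio b n : R := n%:R `^ (1 - b) * (rGamma (b + n%:R) / n`!%:R).

(** Gamma(n + 2) is compared with Gamma(b + n + 1) by a shift by 1 - b, which is
    at least 1. *)
Lemma gauss_ratio_ub b n : b <= 0 -> 0 < b + n.+1%:R ->
  gauss_ratio b n.+1 <= (n.+1%:R / (b + n.+1%:R)) `^ (1 - b).
Proof.
move=> b0 bn0.
have : (b + n.+1%:R) `^ (1 - b) * rGamma (b + n.+1%:R) <= rGamma (b + n.+1%:R + (1 - b)).
  apply: rGamma_shift => //; last by left; lra.
  have n0 : (0 : R) < n.+1%:R by [].
  lra.
rewrite (_ : b + n.+1%:R + (1 - b) = n.+2%:R); last by rewrite -[n.+2%:R]natr1; ring.
rewrite rGamma_nat => h.
rewrite powRM// ?invr_ge0 ?(ltW bn0)// /gauss_ratio.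
rewrite ler_wpM2l ?powR_ge0// ler_pdivrMr ?ltr0n ?fact_gt0//.
rewrite -powR_inv1 ?(ltW bn0)// -powRrM mulN1r powRN mulrC ler_pdivlMr ?powR_gt0//.
by rewrite mulrC.
Qed.

(** The comparison of gauss_ratio_ub read backwards, by a shift by
    b - 1 from n + 2. *)
Lemma gauss_ratio_lb b n : b <= 0 -> 0 < b + n.+1%:R ->
  (n.+1%:R / n.+2%:R) `^ (1 - b) <= gauss_ratio b n.+1.
Proof.
move=> b0 bn0.
have : n.+2%:R `^ (b - 1) * rGamma n.+2%:R <= rGamma (n.+2%:R + (b - 1)).
  apply: rGamma_shift => //; last by right; lra.
  by rewrite -[n.+2%:R]natr1; lra.
rewrite (_ : n.+2%:R + (b - 1) = b + n.+1%:R); last by rewrite -[n.+2%:R]natr1; ring.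
rewrite rGamma_nat => h.
rewrite powRM// ?invr_ge0// /gauss_ratio.
rewrite ler_wpM2l ?powR_ge0// ler_pdivlMr ?ltr0n ?fact_gt0//.
by rewrite -powR_inv1// -powRrM mulN1r opprB.
Qed.

Lemma cvg_powR_to1 (u : nat -> R) c : u n @[n --> \oo] --> (1 : R) -> (u n) `^ c @[n --> \oo] --> (1 : R).
Proof.
move=> u1.
have := is_derive1_continuous (is_derive1_powR c ltr01).
by rewrite /prop_for/continuous_at powR1 => h; apply: (@cvg_comp _ _ _ u (fun y => y `^ c)) h.
Qed.

Lemma cvg_shift_ratio c d : (n%:R + c) / (n%:R + d) @[n --> \oo] --> (1 : R).
Proof.
apply/cvgrPdist_le => e e0; near=> n.
have h : `|d - c| / e + 1 - d <= n%:R by near: n; exact: nbhs_infty_ger.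
have de0 : 0 <= `|d - c| / e by rewrite divr_ge0// ltW.
have nd : 0 < n%:R + d by lra.
have -> : 1 - (n%:R + c) / (n%:R + d) = (d - c) / (n%:R + d).
  by field; exact: lt0r_neq0.
rewrite normrM normfV (gtr0_norm nd) ler_pdivrMr// mulrC -ler_pdivrMr//; lra.
Unshelve. all: by end_near. Qed.

(** For b <= 0 the ratio is squeezed between two quantities that tend to 1; from
    b - 1 to b it is multiplied by (n + b - 1) / n. *)
Lemma cvg_gauss_ratio b : gauss_ratio b n @[n --> \oo] --> (1 : R).
Proof.
have [k bk] : exists k : nat, b <= k%:R.
  by exists (Num.truncn b).+1; exact/ltW/truncnS_gt.
elim: k b bk => [|k IH] b bk.
  rewrite -(cvg_shiftS (gauss_ratio b)).
  have c1 := @cvg_shift_ratio 0 b.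
  have c2 := @cvg_shift_ratio 0 1.
  move: c1 c2; rewrite -(cvg_shiftS (fun n : nat => (n%:R + 0) / (n%:R + b) : R)).
  rewrite -(cvg_shiftS (fun n : nat => (n%:R + 0) / (n%:R + 1) : R)) => c1 c2.
  apply: (squeeze_cvgr _ (cvg_powR_to1 (1 - b) c2) (cvg_powR_to1 (1 - b) c1)).
  near=> n.
  have bn0 : 0 < b + n.+1%:R.
    have h : 1 - b <= n%:R by near: n; exact: nbhs_infty_ger.
    by rewrite -natr1; lra.
  rewrite !addr0 [_ + 1]natr1 [_ + b]addrC.
  by rewrite gauss_ratio_lb// gauss_ratio_ub.
have [b0|b0] := leP b 0; first by apply: IH; exact: (le_trans b0 (ler0n _ _)).
have IHb : gauss_ratio (b - 1) n @[n --> \oo] --> (1 : R).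
  by apply: IH; rewrite lerBlDr natr1.
have cr := @cvg_shift_ratio (b - 1) 0.
have h0 : gauss_ratio (b - 1) n * ((n%:R + (b - 1)) / (n%:R + 0)) @[n --> \oo] --> (1 : R).
  by rewrite -[X in _ --> X]mulr1; exact: cvgM.
apply: (cvg_trans _ h0); apply: near_eq_cvg; near=> n.
have n0 : (0 : R) < n%:R by near: n; exact: nbhs_infty_gtr.
have h : 1 - b < n%:R by near: n; exact: nbhs_infty_gtr.
rewrite /gauss_ratio addr0.
have -> : b + n%:R = (b - 1 + n%:R) + 1 by ring.
rewrite rGammaD1; last by lra.
have -> : 1 - (b - 1) = 1 - b + 1 by ring.
rewrite (powR_mulB1 _ n0) addrK [b - 1 + _]addrC.
by field; rewrite pnatr_eq0 -lt0n fact_gt0/= lt0r_neq0.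
Unshelve. all: by end_near. Qed.

Lemma cvg_gauss b : n%:R `^ (1 - b) * gbin b n @[n --> \oo] --> recipGamma b.
Proof.
have h0 : recipGamma b * gauss_ratio b n @[n --> \oo] --> recipGamma b.
  rewrite -[X in _ --> X]mulr1; apply: cvgM; first exact: cvg_cst.
  exact: cvg_gauss_ratio.
apply: (cvg_trans _ h0); apply: near_eq_cvg; near=> n.
have h : 1 - b <= n%:R by near: n; exact: nbhs_infty_ger.
rewrite gbin_gammaE; last by lra.
by rewrite /gauss_ratio mulrCA.
Unshelve. all: by end_near. Qed.

(** An estimate uniform in b, as long as n is at least twice the distance from b
    to 0: in the proof of positivity b tends to -oo together with n. *)
Lemma gauss_bound b n : b <= 0 -> (0 < n)%N -> - b * 2 <= n%:R ->
  `|n%:R `^ (1 - b) * gbin b n| <= `|recipGamma b| * 2 `^ (1 - b).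
Proof.
move=> b0; case: n => // n _ bn.
have n0 : (0 : R) < n.+1%:R by [].
have bn0 : 0 < b + n.+1%:R by lra.
rewrite gbin_gammaE// mulrCA normrM ler_wpM2l// -/(gauss_ratio b n.+1).
rewrite ger0_norm; last by rewrite mulr_ge0 ?powR_ge0 ?divr_ge0 ?rGamma_ge0.
apply: le_trans (gauss_ratio_ub b0 bn0) _.
apply: ge0_ler_powR; rewrite ?nnegrE ?divr_ge0//; try lra.
by rewrite ler_pdivrMr//; lra.
Qed.

End gauss.

(** * The Wright series *)

Lemma cvgn_shiftS {R : realType} (u : nat -> R) (l : R) :
  u n @[n --> \oo] --> l -> u n.+1 @[n --> \oo] --> l.
Proof. by move=> ul; rewrite (cvg_shiftS u). Qed.

(** The sign of the argument is included in the coefficients: these are the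
    coefficients of W_{-alpha,b}(-x). *)
Definition wcoef (R : realType) (alpha b : R) n : R :=
  (-1) ^+ n / n`!%:R * recipGamma (b - alpha * n%:R).

HB.lock Definition wfun (R : realType) (alpha b x : R) : R :=
  limn (pseries (wcoef alpha b) x).

Section wright_series.
Context {R : realType}.
Variable alpha : R.
Hypothesis (alpha0 : 0 < alpha) (alpha1 : alpha < 1).
Implicit Types (b c x y : R).

(** Let m be the integral part in the statement, about alpha j.  For m <= j the
    quotient m! / j! is at most 1 / (j - m)!, while j is at most a constant
    plus q (j - m) with q at least 1 / (1 - alpha); so the expression is bounded
    by a constant times Y^(q (j - m)) / (j - m)!, a term of an exponential
    series.  The case j < m concerns only finitely many j. *)
Lemma fact_quotient_bound b y : exists C : R, forall j : nat,
  (Num.truncn (1 - (b - alpha * j%:R)))`!%:R * `|y| ^+ j / j`!%:R <= C.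
Proof.
pose Y := Num.max 1 `|y|.
have Y1 : 1 <= Y by rewrite le_max lexx.
have yY : `|y| <= Y by rewrite le_max lexx orbT.
have Y0 : 0 <= Y by exact: le_trans Y1.
pose c := (Num.truncn (1 + `|b|)).+1.
have cb : 1 + `|b| <= c%:R by exact/ltW/truncnS_gt.
pose q := (Num.truncn ((1 - alpha)^-1)).+1.
have qa : (1 - alpha)^-1 <= q%:R by exact/ltW/truncnS_gt.
have a10 : 0 < 1 - alpha by rewrite subr_gt0.
have qa1 : 1 <= q%:R * (1 - alpha) by rewrite -ler_pdivrMr// mul1r.
exists (Y ^+ (q * c) * (expR (Y ^+ q) + ((q.+1 * c)`!)%:R)) => j.
set m := Num.truncn _.
have j0 : (0 : R) <= j%:R by [].
have mle : m%:R <= alpha * j%:R + c%:R.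
  have [h|h] := leP 0 (1 - (b - alpha * j%:R)).
    have := truncn_le (1 - (b - alpha * j%:R)); rewrite h => hm.
    apply: le_trans hm _; have := ler_norm (- b); rewrite normrN; lra.
  have -> : m = 0%N by apply/truncn0Pn; rewrite -ltNge; lra.
  by rewrite addr_ge0// mulr_ge0// ltW.
have yj : `|y| ^+ j <= Y ^+ j by rewrite lerXn2r ?nnegrE.
have YM (i k : nat) : (i <= k)%N -> Y ^+ i <= Y ^+ k by move=> ik; rewrite ler_weXn2l.
have jf : (0 : R) < j`!%:R by rewrite ltr0n fact_gt0.
rewrite mulrDr; have [mj|jm] := leqP m j.
  apply: ler_wpDr; first by rewrite mulr_ge0 ?exprn_ge0.
  pose r := (j - m)%N.
  have jE : (j = r + m)%N by rewrite subnK.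
  have jr : (j <= q * c + q * r)%N.
    rewrite -mulnDr -(ler_nat R) natrM natrD.
    have : j%:R * (1 - alpha) <= c%:R + r%:R.
      have E : j%:R = r%:R + m%:R :> R by rewrite -natrD -jE.
      by lra.
    move=> h; have cr0 : (0 : R) <= q%:R by [].
    have := ler_wpM2l cr0 h; have := ler_wpM2l j0 qa1.
    by rewrite mulr1; lra.
  have ff : (m`! * r`! <= j`!)%N.
    by rewrite -(bin_fact mj) leq_pmull// bin_gt0.
  apply: (@le_trans _ _ (Y ^+ j / r`!%:R)).
    rewrite ler_pdivrMr//; apply: (@le_trans _ _ (m`!%:R * Y ^+ j)).
      by rewrite ler_wpM2l.
    rewrite (_ : Y ^+ j / r`!%:R * j`!%:R = j`!%:R / r`!%:R * Y ^+ j); last by ring.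
    rewrite ler_wpM2r ?exprn_ge0// ler_pdivlMr ?ltr0n ?fact_gt0//.
    by rewrite -natrM ler_nat.
  apply: (@le_trans _ _ (Y ^+ (q * c) * ((Y ^+ q) ^+ r / r`!%:R))).
    by rewrite mulrA ler_wpM2r ?invr_ge0// -exprM -exprD YM.
  rewrite ler_wpM2l ?exprn_ge0//.
  case: r {jE jr ff} => [|r].
    by rewrite expr0 fact0 divr1 -expR0 ler_expR exprn_ge0.
  have := @expR_ge1Dxn R (Y ^+ q) r (exprn_ge0 _ Y0); apply: le_trans.
  by rewrite ler_wpDl.
apply: ler_wpDl; first by rewrite mulr_ge0 ?exprn_ge0 ?expR_ge0.
have jc : j%:R * (1 - alpha) <= c%:R.
  have E : j%:R <= m%:R :> R by rewrite ler_nat ltnW.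
  by lra.
have jqc : (j <= q * c)%N.
  rewrite -(ler_nat R) natrM.
  have q0 : (0 : R) <= q%:R by [].
  have := ler_wpM2l q0 jc; have := ler_wpM2l j0 qa1.
  by rewrite mulr1; lra.
have mqc : (m <= q.+1 * c)%N.
  rewrite mulSn -(ler_nat R) natrD (le_trans mle)// addrC lerD2l.
  apply: (@le_trans _ _ j%:R); last by rewrite ler_nat.
  by rewrite -[leRHS]mul1r ler_wpM2r// ltW.
rewrite ler_pdivrMr// mulrC.
apply: (@le_trans _ _ (Y ^+ (q * c) * ((q.+1 * c)`!)%:R)).
  apply: ler_pM; rewrite ?exprn_ge0 ?ler_nat ?leq_fact//.
  by apply: le_trans yj _; exact: YM.
by rewrite ler_peMr ?mulr_ge0 ?exprn_ge0// ler1n fact_gt0.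
Qed.

Local Notation cf := (wcoef alpha).
Local Notation w := (wfun alpha).

(** The bound on factorial quotients is used at 2 y to gain the geometric factor. *)
Lemma wcoef_bound b y : exists C : R, forall n, `|cf b n| * `|y| ^+ n <= C * 2^-1 ^+ n.
Proof.
have [C HC] := fact_quotient_bound b (2 * y).
exists (2 * C) => n.
have := HC n; rewrite normrM ger0_norm// exprMn => h.
rewrite /wcoef.
have := recipGamma_bound (b - alpha * n%:R).
move: (recipGamma _) => rg hrg.
rewrite !normrM normrX normrN1 expr1n mul1r normfV [ `|n`!%:R| ]ger0_norm//.
have h2 : (0 : R) < 2^-1 ^+ n by rewrite exprn_gt0.
apply: (@le_trans _ _ (2 * ((Num.truncn (1 - (b - alpha * n%:R)))`!%:R * (2 ^+ n * `|y| ^+ n) / n`!%:R) * 2^-1 ^+ n)).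
  have E : 2 ^+ n * 2^-1 ^+ n = 1 :> R by rewrite -exprMn mulfV// expr1n.
  rewrite [leRHS](_ : _ = n`!%:R^-1 * (2 * (Num.truncn (1 - (b - alpha * n%:R)))`!%:R) * `|y| ^+ n * (2 ^+ n * 2^-1 ^+ n)); last by ring.
  rewrite E mulr1 ler_wpM2r ?exprn_ge0// ler_wpM2l ?invr_ge0//.
by rewrite ler_wpM2r ?(ltW h2)// ler_wpM2l.
Qed.

Lemma is_cvg_wright_norm b x : cvgn (pseries (fun n => `|cf b n|) `|x|).
Proof.
have [C HC] := wcoef_bound b x.
rewrite /pseries; apply: (@series_le_cvg _ _ (geometric C 2^-1)).
- by move=> n; rewrite mulr_ge0 ?exprn_ge0.
- by move=> n; have := HC n; apply: le_trans; rewrite mulr_ge0 ?exprn_ge0.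
- by move=> n; exact: HC.
- by apply: is_cvg_geometric_series; rewrite ger0_norm// invf_lt1 ?ltr1n.
Qed.

Lemma is_cvg_wright b x : cvgn (pseries (cf b) x).
Proof.
apply: normed_cvg; have := @is_cvg_wright_norm b x.
rewrite /pseries /normed_series_of/=.
by under [X in _ -> cvgn (series X)]eq_fun do rewrite normrM normrX.
Qed.

Lemma cvg_wfun b x : pseries (cf b) x @ \oo --> w b x.
Proof. by rewrite wfun.unlock; exact: is_cvg_wright. Qed.

Lemma pseries_diffs_wcoef b : pseries_diffs (cf b) = (fun n => - cf (b - alpha) n).
Proof.
apply/funext => n; rewrite /pseries_diffs /wcoef exprS factS natrM.
rewrite (_ : b - alpha * n.+1%:R = b - alpha - alpha * n%:R); last first.
  by rewrite -natr1; ring.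
by field; rewrite pnatr_eq0 -lt0n fact_gt0/= nat1r pnatr_eq0.
Qed.

Lemma is_cvg_wrightN b x : cvgn (pseries (fun n => - cf b n) x).
Proof.
have -> : pseries (fun n => - cf b n) x = - pseries (cf b) x.
  rewrite /pseries; apply/funext => n; rewrite /series/= fctE -sumrN.
  by apply: eq_bigr => i _; rewrite mulNr.
by apply: is_cvgN; exact: is_cvg_wright.
Qed.

Lemma lim_wrightN b x : limn (pseries (fun n => - cf b n) x) = - w b x.
Proof.
have -> : pseries (fun n => - cf b n) x = - pseries (cf b) x.
  rewrite /pseries; apply/funext => n; rewrite /series/= fctE -sumrN.
  by apply: eq_bigr => i _; rewrite mulNr.
by rewrite limN ?wfun.unlock//; exact: is_cvg_wright.
Qed.

Lemma is_derive_wfun b x : is_derive x 1 (w b) (- w (b - alpha) x).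
Proof.
rewrite -lim_wrightN -pseries_diffs_wcoef.
rewrite (_ : w b = (fun x => limn (pseries (cf b) x))); last first.
  by apply/funext => y; rewrite wfun.unlock.
apply: (@pseries_snd_diffs _ _ (`|x| + 1)).
- exact: is_cvg_wright.
- by rewrite pseries_diffs_wcoef; exact: is_cvg_wrightN.
- rewrite pseries_diffs_wcoef [X in pseries_diffs X](_ : _ = - cf (b - alpha))//.
  rewrite pseries_diffsN pseries_diffs_wcoef.
  rewrite (_ : - _ = cf (b - alpha - alpha)); first exact: is_cvg_wright.
  by apply/funext => n; rewrite fctE opprK.
- by rewrite [ltRHS]ger0_norm ?addr_ge0// ltrDl.
Qed.

Lemma continuous_wfun b : continuous (w b).
Proof. by move=> x; exact: is_derive1_continuous (is_derive_wfun b x). Qed.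

Lemma wfun0 b : w b 0 = recipGamma b.
Proof.
rewrite wfun.unlock; apply/cvg_lim => //.
rewrite -cvg_shiftS; apply: (@cvg_trans _ (cst (recipGamma b) @ \oo)); last exact: cvg_cst.
apply: near_eq_cvg; near=> n.
rewrite /pseries/series/= big_nat_recl// expr0 mulr1 big1 ?addr0.
  by rewrite /wcoef expr0 fact0 divr1 mul1r mulr0 subr0.
by move=> i _; rewrite expr0n mulr0.
Unshelve. all: by end_near. Qed.

(** Termwise this is 1/Gamma(c) = c / Gamma(c + 1) at c = b - alpha n: the part
    b of the factor gives the first series, the part - alpha n cancels against n!
    and gives the second one, shifted by one index. *)
Lemma wfun_rec b x :
  w b x = b * w (b + 1) x + alpha * x * w (b + 1 - alpha) x.
Proof.
have c1 := @cvg_wfun (b + 1) x.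
have c2 := @cvg_wfun (b + 1 - alpha) x.
have c3 : b * pseries (cf (b + 1)) x n.+1 + alpha * x * pseries (cf (b + 1 - alpha)) x n
    @[n --> \oo] --> b * w (b + 1) x + alpha * x * w (b + 1 - alpha) x.
  apply: cvgD.
    apply: cvgM; first exact: cvg_cst.
    exact: (cvgn_shiftS c1).
  by apply: cvgM; first exact: cvg_cst.
rewrite -(cvg_lim _ c3)//.
rewrite -(cvg_lim _ (cvgn_shiftS (@cvg_wfun b x)))//.
congr (limn _); apply/funext => n.
rewrite /pseries/series/= big_nat_recl//= [X in _ = b * X + _]big_nat_recl//=.
rewrite mulrDr -addrA; congr (_ + _).
  rewrite /wcoef !mulr0 !subr0 fact0 expr0 divr1 !mul1r expr0 !mulr1.
  exact: recipGamma_rec.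
rewrite !mulr_sumr -big_split/=; apply: eq_bigr => i _.
rewrite /wcoef recipGamma_rec.
rewrite (_ : b - alpha * i.+1%:R + 1 = b + 1 - alpha - alpha * i%:R); last first.
  by rewrite -natr1; ring.
rewrite (_ : b + 1 - alpha * i.+1%:R = b + 1 - alpha - alpha * i%:R); last first.
  by rewrite -natr1; ring.
rewrite factS natrM !exprS -natr1.
by field; rewrite pnatr_eq0 -lt0n fact_gt0/= natr1 pnatr_eq0.
Qed.

End wright_series.

(** * Positivity of the Wright function *)

Section positivity.
Context {R : realType}.
Variable alpha : R.
Hypothesis (alpha0 : 0 < alpha) (alpha1 : alpha < 1).
Implicit Types (b c x y : R).

Local Notation idx x n := (Num.truncn (x * n%:R `^ alpha)).

Lemma cvg_powRn_oo c : 0 < c -> n%:R `^ c @[n --> \oo] --> (+oo : set_system R).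
Proof.
move=> c0; apply/cvgryPge => M.
near=> n.
have h : (Num.max 1 M) `^ c^-1 <= n%:R by near: n; exact: nbhs_infty_ger.
have m0 : 0 <= Num.max 1 M by rewrite le_max ler01.
apply: (@le_trans _ _ (Num.max 1 M)); first by rewrite le_max lexx orbT.
have -> : Num.max 1 M = (Num.max 1 M `^ c^-1) `^ c.
  by rewrite -powRrM mulVf ?gt_eqF// powRr1.
by apply: ge0_ler_powR => //; rewrite ?nnegrE ?powR_ge0// ltW.
Unshelve. all: by end_near. Qed.

Lemma cvg_idx x i : 0 <= x ->
  (idx x n - i)%N%:R / n%:R `^ alpha @[n --> \oo] --> x.
Proof.
move=> x0.
have cinv : (1 + i%:R) / n%:R `^ alpha @[n --> \oo] --> (0 : R).
  rewrite -(mulr0 (1 + i%:R)); apply: cvgM; first exact: cvg_cst.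
  apply/gtr0_cvgV0; last exact: cvg_powRn_oo.
  near=> n; rewrite powR_gt0//; near: n; exact: nbhs_infty_gtr.
have clow : x - (1 + i%:R) / n%:R `^ alpha @[n --> \oo] --> x.
  by rewrite -[X in _ --> X]subr0; apply: cvgB => //; exact: cvg_cst.
apply: (squeeze_cvgr _ clow (cvg_cst x)).
near=> n.
have n0 : (0 : R) < n%:R by near: n; exact: nbhs_infty_gtr.
have na0 : 0 < n%:R `^ alpha by rewrite powR_gt0.
have h0 : 0 <= x * n%:R `^ alpha by rewrite mulr_ge0// ltW.
have /andP[h1 h2] := truncn_itv h0; rewrite -natr1 in h2.
rewrite ler_pdivrMr// ler_pdivlMr// mulrBl divfK ?gt_eqF//.
have hi : (idx x n)%:R - i%:R <= (idx x n - i)%N%:R :> R.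
  have [le|lt] := leqP i (idx x n); first by rewrite natrB.
  by rewrite (eqP (ltnW lt : _ - _ == 0)%N) subr_le0 ler_nat ltnW.
have hj : (idx x n - i)%N%:R <= (idx x n)%:R :> R by rewrite ler_nat leq_subr.
apply/andP; split; first by lra.
exact: le_trans hj h1.
Unshelve. all: by end_near. Qed.

Lemma bin_idxE (k j n : nat) : (0 < n)%N ->
  'C(k, j)%:R * n%:R `^ (- (alpha * j%:R)) =
  (\prod_(i < j) ((k - i)%N%:R / n%:R `^ alpha)) / j`!%:R :> R.
Proof.
move=> n0.
have n0R : (0 : R) < n%:R by rewrite ltr0n.
rewrite big_split/= -natr_prod -ffact_prod -bin_ffact natrM.
rewrite prodr_const card_ord -powRN.
rewrite -powR_mulrn ?powR_ge0// -powRrM mulNr.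
by field; rewrite pnatr_eq0 -lt0n fact_gt0.
Qed.

Lemma cvg_bin_idx x j : 0 <= x ->
  'C(idx x n, j)%:R * n%:R `^ (- (alpha * j%:R)) @[n --> \oo] --> x ^+ j / j`!%:R.
Proof.
move=> x0.
have cp : \prod_(i < j) ((idx x n - i)%N%:R / n%:R `^ alpha) @[n --> \oo] --> x ^+ j.
  elim: j => [|j IH].
    by under eq_cvg do rewrite big_ord0; exact: cvg_cst.
  under eq_cvg do rewrite big_ord_recr/=.
  by rewrite exprSr; apply: cvgM => //; exact: cvg_idx.
have c2 : (\prod_(i < j) ((idx x n - i)%N%:R / n%:R `^ alpha)) / j`!%:R @[n --> \oo] -->
   x ^+ j / j`!%:R by apply: cvgM => //; exact: cvg_cst.
apply: (cvg_trans _ c2); apply: near_eq_cvg; near=> n.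
rewrite bin_idxE//; near: n; exact: nbhs_infty_gt.
Unshelve. all: by end_near. Qed.

(** Each of the j factors is at most x, for every n: this is the domination
    used below. *)
Lemma bin_idx_le x j n : 0 <= x -> (0 < n)%N ->
  0 <= 'C(idx x n, j)%:R * n%:R `^ (- (alpha * j%:R)) <= x ^+ j / j`!%:R.
Proof.
move=> x0 n0; rewrite mulr_ge0 ?powR_ge0//= bin_idxE//.
rewrite ler_wpM2r ?invr_ge0//.
have n0R : (0 : R) < n%:R by rewrite ltr0n.
have na0 : 0 < n%:R `^ alpha by rewrite powR_gt0.
have -> : x ^+ j = \prod_(i < j) x by rewrite prodr_const card_ord.
apply: ler_prod => i _; rewrite divr_ge0 ?(ltW na0)//= ler_pdivrMr//.
have h0 : 0 <= x * n%:R `^ alpha by rewrite mulr_ge0// ltW.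
have /andP[h1 h2] := truncn_itv h0.
by apply: le_trans h1; rewrite ler_nat leq_subr.
Qed.

Let term b x n j : R := (-1) ^+ j * 'C(idx x n, j)%:R *
  (n%:R `^ (1 - b) * gbin (b - alpha * j%:R) n).

Let termE b x n j : (0 < n)%N -> term b x n j =
  (-1) ^+ j * ('C(idx x n, j)%:R * n%:R `^ (- (alpha * j%:R))) *
  (n%:R `^ (1 - (b - alpha * j%:R)) * gbin (b - alpha * j%:R) n).
Proof.
move=> n0; have n0R : (n%:R : R) != 0 by rewrite pnatr_eq0 -lt0n.
rewrite /term (_ : 1 - b = - (alpha * j%:R) + (1 - (b - alpha * j%:R))); last by ring.
by rewrite powRD ?n0R ?implybT//; ring.
Qed.

(** The summands term b x n j of n^(1-b) cmcoef alpha b k n tend, for fixed j and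
    n -> oo, to the terms of the Wright series; from some rank J0 on they are
    dominated by a geometric series, uniformly in n.  Hence a partial sum of
    the Wright series up to J is at least minus the tail of that geometric
    series. *)
Lemma wfun_ge0 b x : 0 <= b -> 0 <= x -> 0 <= wfun alpha b x.
Proof.
move=> b0 x0.
have cterm j : term b x n j @[n --> \oo] --> wcoef alpha b j * x ^+ j.
  have c : (-1) ^+ j * ('C(idx x n, j)%:R * n%:R `^ (- (alpha * j%:R))) *
     (n%:R `^ (1 - (b - alpha * j%:R)) * gbin (b - alpha * j%:R) n) @[n --> \oo] -->
     (-1) ^+ j * (x ^+ j / j`!%:R) * recipGamma (b - alpha * j%:R).
    apply: cvgM; last exact: cvg_gauss.
    by apply: cvgM; [exact: cvg_cst|exact: cvg_bin_idx].
  rewrite (_ : wcoef _ _ _ * _ = (-1) ^+ j * (x ^+ j / j`!%:R) * recipGamma (b - alpha * j%:R)); last first.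
    by rewrite /wcoef; ring.
  apply: (cvg_trans _ c); apply: near_eq_cvg; near=> n.
  by rewrite termE//; near: n; exact: nbhs_infty_gt.
have [C HC] := wcoef_bound alpha0 alpha1 b (2 * x).
pose D := 2 `^ (1 - b) * `|C|.
have D0 : 0 <= D by rewrite mulr_ge0 ?powR_ge0.
(* beyond J0 the parameter b - alpha j is nonpositive, as gauss_bound requires *)
pose J0 := (Num.truncn (b / alpha)).+1.
have J0P j : (J0 <= j)%N -> b - alpha * j%:R <= 0.
  move=> jJ; rewrite subr_le0 mulrC -ler_pdivrMr//.
  by apply: (le_trans (ltW (truncnS_gt _))); rewrite ler_nat.
have tbound : \forall n \near \oo, forall j, (J0 <= j)%N -> `|term b x n j| <= D * 2^-1 ^+ j.
  have a1 : 0 < 1 - alpha by rewrite subr_gt0.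
  have big : \forall n \near \oo, 2 * alpha * x <= n%:R `^ (1 - alpha).
    by move/cvgryPge : (cvg_powRn_oo a1); apply.
  near=> n => j jJ.
  have n0 : (0 < n)%N by near: n; exact: nbhs_infty_gt.
  have n0R : (0 : R) < n%:R by rewrite ltr0n.
  have [jk|jk] := leqP j (idx x n); last first.
    rewrite /term bin_small// mulr0 mul0r normr0 mulr_ge0// exprn_ge0.
  (* only j <= x n^alpha matter, and n^alpha is small compared with n *)
  have nb : - (b - alpha * j%:R) * 2 <= n%:R.
    have h0 : 0 <= x * n%:R `^ alpha by rewrite mulr_ge0// powR_ge0.
    have /andP[h1 h2] := truncn_itv h0.
    have jx : j%:R <= x * n%:R `^ alpha by apply: le_trans h1; rewrite ler_nat.
    have bign : 2 * alpha * x <= n%:R `^ (1 - alpha) by near: n.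
    have -> : n%:R = n%:R `^ (1 - alpha) * n%:R `^ alpha :> R.
      by rewrite -powRD ?subrK ?powRr1 ?ler0n// (gt_eqF n0R) implybT.
    apply: (@le_trans _ _ (2 * alpha * x * n%:R `^ alpha)); last first.
      by rewrite ler_wpM2r ?powR_ge0.
    have := ler_wpM2l (ltW alpha0) jx; lra.
  have g := gauss_bound (J0P j jJ) n0 nb.
  have /andP[B0 B1] := bin_idx_le j x0 n0.
  rewrite termE// normrM normrM normrX normrN1 expr1n mul1r (ger0_norm B0).
  have xj0 : 0 <= x ^+ j / j`!%:R by rewrite divr_ge0// exprn_ge0.
  apply: (le_trans (ler_pM B0 (normr_ge0 _) B1 g)).
  have -> : 2 `^ (1 - (b - alpha * j%:R)) = 2 `^ (1 - b) * 2 `^ (alpha * j%:R) :> R.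
    rewrite -powRD; last by rewrite pnatr_eq0 implybT.
    by congr powR; ring.
  have a2 : 2 `^ (alpha * j%:R) <= 2 ^+ j :> R.
    rewrite -powR_mulrn//; apply: ler_powR; first by lra.
    by rewrite -[leRHS]mul1r ler_wpM2r// ltW.
  have x20 : 0 <= 2 * x by rewrite mulr_ge0.
  have := HC j; rewrite (ger0_norm x20) exprMn.
  rewrite /wcoef; move: (recipGamma _) => rg.
  rewrite !normrM normrX normrN1 expr1n mul1r normfV [ `|j`!%:R| ]ger0_norm// => h.
  have p0 : 0 <= (2:R) `^ (1 - b) by exact: powR_ge0.
  apply: (@le_trans _ _ (2 `^ (1 - b) * (j`!%:R^-1 * `|rg| * (2 ^+ j * x ^+ j)))).
    rewrite [leLHS](_ : _ = 2 `^ (1 - b) * (j`!%:R^-1 * `|rg| * x ^+ j * 2 `^ (alpha * j%:R))); last by ring.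
    rewrite [leRHS](_ : _ = 2 `^ (1 - b) * (j`!%:R^-1 * `|rg| * x ^+ j * 2 ^+ j)); last by ring.
    rewrite ler_wpM2l// ler_wpM2l// !mulr_ge0 ?exprn_ge0 ?invr_ge0//.
  rewrite /D -[leRHS]mulrA ler_wpM2l//; apply: le_trans h _.
  by rewrite ler_wpM2r ?exprn_ge0 ?invr_ge0// ler_norm.
have geo J L : \sum_(i < L) 2^-1 ^+ (J + i) <= 2 * 2^-1 ^+ J :> R.
  rewrite [leLHS](_ : _ = 2 * 2^-1 ^+ J * (1 - 2^-1 ^+ L)).
    by rewrite ler_piMr// ?mulr_ge0 ?exprn_ge0 ?invr_ge0// gerBl exprn_ge0 ?invr_ge0.
  elim: L => [|L IHL]; first by rewrite big_ord0 expr0 subrr mulr0.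
  by rewrite big_ord_recr/= IHL exprD exprS; field.
have cpartial J : \sum_(j < J) term b x n j @[n --> \oo] --> \sum_(j < J) wcoef alpha b j * x ^+ j.
  elim: J => [|J IH].
    rewrite big_ord0; under eq_cvg do rewrite big_ord0; exact: cvg_cst.
  rewrite big_ord_recr/=; under eq_cvg do rewrite big_ord_recr/=.
  by apply: cvgD => //; exact: cterm.
have partial J : (J0 <= J)%N ->
    - (D * (2 * 2^-1 ^+ J)) <= \sum_(j < J) wcoef alpha b j * x ^+ j.
  move=> JJ; apply: (cvgr_to_ge (cpartial J)).
  near=> n.
  have tb : forall j, (J0 <= j)%N -> `|term b x n j| <= D * 2^-1 ^+ j by near: n.
  pose k := idx x n.
  (* beyond k the binomial coefficients vanish, so that this is n^(1-b) cmcoef alpha b k n *)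
  have total : 0 <= \sum_(j < J + k.+1) term b x n j.
    rewrite addnC big_split_ord/= [X in _ + X]big1 ?addr0; last first.
      by move=> i _; rewrite /term bin_small ?mulr0 ?mul0r// addSn ltnS leq_addr.
    rewrite (_ : \sum_(i < k.+1) _ = n%:R `^ (1 - b) * cmcoef alpha b k n).
      by rewrite mulr_ge0 ?powR_ge0// cmcoef_ge0// ltW.
    by rewrite /cmcoef mulr_sumr; apply: eq_bigr => i _; rewrite /term; ring.
  rewrite big_split_ord/= in total.
  have tl : \sum_(i < k.+1) term b x n (J + i) <= D * (2 * 2^-1 ^+ J).
    apply: (@le_trans _ _ (\sum_(i < k.+1) D * 2^-1 ^+ (J + i))).
      apply: ler_sum => i _; apply: le_trans (ler_norm _) (tb _ _).
      exact: leq_trans JJ (leq_addr _ _).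
    by rewrite -mulr_sumr ler_wpM2l.
  by lra.
have c0 : pseries (wcoef alpha b) x J + D * (2 * 2^-1 ^+ J) @[J --> \oo] --> wfun alpha b x.
  rewrite -[X in _ --> X]addr0; apply: cvgD; first exact: (cvg_wfun alpha0 alpha1).
  rewrite -(mulr0 D); apply: cvgM; first exact: cvg_cst.
  rewrite -(mulr0 2); apply: cvgM; first exact: cvg_cst.
  by apply: cvg_expr; rewrite ger0_norm// invf_lt1 ?ltr1n.
apply: (cvgr_to_ge c0).
near=> J.
have JJ : (J0 <= J)%N by near: J; exact: nbhs_infty_ge.
have := partial J JJ.
by rewrite /pseries/series/= big_mkord; lra.
Unshelve. all: by end_near. Qed.

End positivity.

(** * Decay of the Wright function *)

Section decay.
Context {R : realType}.
Variable alpha : R.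
Hypothesis (alpha0 : 0 < alpha) (alpha1 : alpha < 1).
Implicit Types (b c x y s t : R).
Local Notation w := (wfun alpha).

Lemma wfun_mvt b x y : x <= y ->
  exists2 c, x <= c <= y & w b x - w b y = w (b - alpha) c * (y - x).
Proof.
move=> xy.
have [||c cxy E] := @MVT_segment R (w b) (fun c => - w (b - alpha) c) x y xy.
- by move=> z _; exact: is_derive_wfun.
- by apply: continuous_subspaceT; exact: continuous_wfun.
by exists c; [move: cxy; rewrite in_itv|rewrite -[LHS]opprB E mulNr opprK].
Qed.

Lemma wfun_noninc b x y : alpha <= b -> 0 <= x -> x <= y -> w b y <= w b x.
Proof.
move=> ab x0 xy; have [c /andP[xc _] E] := wfun_mvt b xy.
rewrite -subr_ge0 E mulr_ge0 ?subr_ge0//; apply: wfun_ge0 => //.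
  by rewrite subr_ge0.
exact: le_trans xc.
Qed.

(** By the mean value theorem w_{b+alpha}(x) - w_{b+alpha}(2x) is x w_b(c) for
    some c <= 2x, and w_b is nonincreasing. *)
Lemma wfun_halving b x : alpha <= b -> 0 < x -> x * w b (2 * x) <= w (b + alpha) x.
Proof.
move=> ab x0; have xx : x <= 2 * x by lra.
have [c /andP[xc c2x] E] := wfun_mvt (b + alpha) xx.
rewrite addrK in E.
have h0 : 0 <= w (b + alpha) (2 * x).
  by apply: wfun_ge0 => //; [have := alpha0; lra|lra].
have h1 : w b (2 * x) <= w b c by apply: wfun_noninc => //; lra.
have := ler_wpM2r (ltW x0) h1; lra.
Qed.

(** Each halving of the argument gains one power of x at the expense of raising b
    by alpha. *)
Lemma wfun_decay_big b (N : nat) : alpha <= b ->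
  exists C : R, forall x, 0 < x -> x ^+ N * w b x <= C.
Proof.
elim: N b => [|N IH] b ab.
  exists (w b 0) => x x0; rewrite expr0 mul1r; apply: wfun_noninc => //; exact: ltW.
have [|C HC] := IH (b + alpha); first by have := alpha0; lra.
exists (2 ^+ N.+1 * C) => x x0.
have x20 : 0 < x / 2 by rewrite divr_gt0.
have h := wfun_halving ab x20; rewrite mulrCA divff ?mulr1// in h.
have p0 : 0 <= 2 ^+ N.+1 * (x / 2) ^+ N by rewrite mulr_ge0 ?exprn_ge0// ltW.
have -> : x ^+ N.+1 * w b x = (2 ^+ N.+1 * (x / 2) ^+ N) * (x / 2 * w b x).
  have -> : (x / 2) ^+ N = x ^+ N * 2 ^- N by rewrite exprMn exprVn.
  rewrite !exprS; field; exact: expf_neq0.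
apply: (le_trans (ler_wpM2l p0 h)).
by rewrite -mulrA ler_wpM2l ?exprn_ge0// HC.
Qed.

(** The recursion formula reduces small b to larger ones. *)
Lemma wfun_decay b (N : nat) : 0 <= b ->
  exists C : R, forall x, 0 < x -> x ^+ N * w b x <= C.
Proof.
move=> b0.
have a10 : 0 < 1 - alpha by rewrite subr_gt0.
have [k bk] : exists k : nat, alpha <= b + k%:R * (1 - alpha).
  exists (Num.truncn (alpha / (1 - alpha))).+1.
  apply: ler_wpDl => //; rewrite -ler_pdivrMr//; exact/ltW/truncnS_gt.
elim: k b b0 N bk => [|k IH] b b0 N bk.
  by apply: wfun_decay_big; rewrite mul0r addr0 in bk.
have [|C1 H1] := @wfun_decay_big (b + 1) N; first by lra.
have [||C2 H2] := IH (b + 1 - alpha) _ N.+1; first by lra.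
  by move: bk; rewrite -natr1; lra.
exists (b * C1 + alpha * C2) => x x0.
rewrite (wfun_rec alpha0 alpha1).
have -> : x ^+ N * (b * w (b + 1) x + alpha * x * w (b + 1 - alpha) x) =
  b * (x ^+ N * w (b + 1) x) + alpha * (x ^+ N.+1 * w (b + 1 - alpha) x).
  by rewrite exprS; ring.
by apply: lerD; [rewrite ler_wpM2l ?H1|rewrite ler_wpM2l ?H2// ltW].
Qed.

End decay.

(** * The scaled Wright function *)

Section scaled_wright.
Context {R : realType}.
Variable alpha : R.
Hypothesis (alpha0 : 0 < alpha) (alpha1 : alpha < 1).
Implicit Types (b s t : R).
Local Notation w := (wfun alpha).

Definition rpsi b t s : R := t `^ (b - 1) * w b (s * t `^ (- alpha)).

Lemma rpsi_ge0 b t s : 0 <= b -> 0 <= s -> 0 <= rpsi b t s.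
Proof.
by move=> b0 s0; rewrite mulr_ge0 ?powR_ge0// wfun_ge0// mulr_ge0 ?powR_ge0.
Qed.

Lemma rpsi_s0 b t : rpsi b t 0 = t `^ (b - 1) * recipGamma b.
Proof. by rewrite /rpsi mul0r wfun0. Qed.

Lemma measurable_wfun b : measurable_fun [set: R] (w b).
Proof. by apply: continuous_measurable_fun; exact: continuous_wfun. Qed.

Lemma measurable_rpsi2 b : measurable_fun [set: R * R] (fun z => rpsi b z.1 z.2).
Proof.
apply: measurable_funM.
  by apply: (measurableT_comp (measurable_powR _)).
apply: (measurableT_comp (measurable_wfun b)); apply: measurable_funM => //.
by apply: (measurableT_comp (measurable_powR _)).
Qed.

Lemma measurable_rpsi_t b s : measurable_fun [set: R] (fun t => rpsi b t s).
Proof.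
apply: measurable_funM; first exact: measurable_powR.
by apply: (measurableT_comp (measurable_wfun b)); apply: measurable_funM.
Qed.

Lemma measurable_rpsi_s b t : measurable_fun [set: R] (rpsi b t).
Proof.
apply: measurable_funM => //.
by apply: (measurableT_comp (measurable_wfun b)); apply: measurable_funM.
Qed.

(** The two terms of the derivative are those of the recursion formula for
    w_b. *)
Lemma is_derive_rpsi_t b t s : 0 < t ->
  is_derive t 1 (fun r => rpsi (b + 1) r s) (rpsi b t s).
Proof.
move=> t0; rewrite /rpsi.
have D1 := is_derive1_powR b t0.
have D2 := is_derive1Z s (is_derive1_powR (- alpha) t0).
have D3 := @is_derive1_comp _ (w (b + 1)) (fun y => s * y `^ (- alpha)) t _ _
  (is_derive_wfun alpha0 alpha1 (b + 1) (s * t `^ (- alpha))) D2.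
rewrite addrK; apply: (is_derive_eq (is_derive1M D1 D3)).
rewrite (wfun_rec alpha0 alpha1 b) /=.
have -> : t `^ (- alpha - 1) = t `^ (- alpha) * t^-1.
  by rewrite powRD ?powR_inv1 ?ltW// (gt_eqF t0) implybT.
have -> : t `^ b = t `^ (b - 1) * t by exact: powR_mulB1.
by field; exact: lt0r_neq0.
Qed.

Lemma is_derive_rpsi_s b t s : 0 < t ->
  is_derive s 1 (rpsi b t) (- rpsi (b - alpha) t s).
Proof.
move=> t0; rewrite /rpsi.
have D2 : is_derive s 1 (fun y => y * t `^ (- alpha)) (t `^ (- alpha)).
  have := is_derive1Z (t `^ (- alpha)) (is_derive_id s (1 : R)); rewrite mulr1.
  by under eq_fun do rewrite mulrC.
have D3 := @is_derive1_comp _ (w b) (fun y => y * t `^ (- alpha)) s _ _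
  (is_derive_wfun alpha0 alpha1 b (s * t `^ (- alpha))) D2.
apply: (is_derive_eq (is_derive1Z (t `^ (b - 1)) D3)).
have -> : t `^ (b - alpha - 1) = t `^ (b - 1) * t `^ (- alpha).
  rewrite -powRD; last by rewrite (gt_eqF t0) implybT.
  by congr powR; ring.
by ring.
Qed.

(** When t tends to 0 the argument s t^(-alpha) tends to +oo, and the fast decay of
    w_b there beats the factor t^(b-1). *)
Lemma rpsi_decay b s : 0 <= b -> 0 < s ->
  exists2 C : R, 0 <= C & forall t, 0 < t -> t <= 1 -> rpsi b t s <= C * t.
Proof.
move=> b0 s0.
(* with alpha N >= 2, the decay of order N gives t^(b - 1 + 2) <= t on ]0, 1] *)
pose N := (Num.truncn (2 / alpha)).+1.
have aN : 2 <= alpha * N%:R.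
  by rewrite mulrC -ler_pdivrMr//; exact/ltW/truncnS_gt.
have [C HC] := wfun_decay alpha0 alpha1 N b0.
exists (`|C| * s ^- N); first by rewrite mulr_ge0// invr_ge0 exprn_ge0// ltW.
move=> t t0 t1.
have ta0 : 0 < t `^ (- alpha) by rewrite powR_gt0.
have x0 : 0 < s * t `^ (- alpha) by rewrite mulr_gt0.
have h : w b (s * t `^ (- alpha)) <= `|C| * s ^- N * t `^ (alpha * N%:R).
  have := HC _ x0; rewrite mulrC -ler_pdivlMr ?exprn_gt0// => h.
  apply: (le_trans h); rewrite exprMn invfM mulrA.
  have -> : (t `^ (- alpha) ^+ N)^-1 = t `^ (alpha * N%:R).
    by rewrite -powR_mulrn ?powR_ge0// -powRrM mulNr powRN invrK.
  rewrite ler_wpM2r ?powR_ge0// ler_wpM2r ?invr_ge0 ?exprn_ge0 ?(ltW s0)//.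
  exact: ler_norm.
apply: (le_trans (ler_wpM2l (powR_ge0 t (b - 1)) h)).
rewrite mulrCA ler_wpM2l//; first by rewrite mulr_ge0// invr_ge0 exprn_ge0// ltW.
rewrite -powRD; last by rewrite (gt_eqF t0) implybT.
rewrite -[leRHS]powRr1 ?(ltW t0)//; apply: ger_powR; first by rewrite t0.
by lra.
Qed.

Lemma rpsi_cvg0 b s : 0 <= b -> 0 < s -> rpsi b t s @[t --> 0^'+] --> (0 : R).
Proof.
move=> b0 s0; have [C C0 HC] := rpsi_decay b0 s0.
have cC : C * t @[t --> (0:R)^'+] --> (0 : R).
  apply: cvg_at_right_filter; rewrite -[X in _ --> X](mulr0 C).
  by apply: cvgM; [exact: cvg_cst|exact: cvg_id].
apply: (squeeze_cvgr _ (cvg_cst (0 : R)) cC).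
near=> t.
have t0 : 0 < t by near: t; exact: nbhs_right_gt.
have t1 : t <= 1 by near: t; exact: nbhs_right_le.
by rewrite rpsi_ge0 ?(ltW s0)//= HC.
Unshelve. all: by end_near. Qed.

Lemma continuous_rpsi_t b t s : 0 < t -> {for t, continuous (fun r => rpsi b r s)}.
Proof.
move=> t0; have := is_derive_rpsi_t (b - 1) s t0; rewrite subrK.
exact: is_derive1_continuous.
Qed.

End scaled_wright.

(** * Laplace transform in t *)

Section picard.
Context {R : realType}.
Local Notation mu := (@lebesgue_measure R).

Lemma integral_pow_halfopen (s : R) (n : nat) : 0 < s ->
  (\int[mu]_(x in `]0%R, s[) (x ^+ n)%:E = (s ^+ n.+1 / n.+1%:R)%:E)%E.
Proof.
move=> s0.
have dF (x : R) : is_derive x 1 (fun y => n.+1%:R^-1 * y ^+ n.+1 : R) (x ^+ n).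
  apply: is_derive_eq; first exact/is_derive1Z/is_derive1X.
  by rewrite mulrA mulVf// mul1r.
rewrite (@ge0_improper_FTC2 _ _ (fun y => n.+1%:R^-1 * y ^+ n.+1) 0)//.
- by rewrite subr0 mulrC.
- by move=> x _; apply: exprn_continuous.
- by move=> x x0; rewrite exprn_ge0// ltW.
- apply: cvg_at_right_filter.
  have E : n.+1%:R^-1 * 0 ^+ n.+1 = 0 :> R by rewrite expr0n mulr0.
  by rewrite -[X in _ --> X]E; exact: is_derive1_continuous (dF 0).
Qed.

Lemma integral_exp_halfopen (s c : R) : 0 < s -> 0 < c ->
  (\int[mu]_(x in `]0%R, s[) (c * expR (- (c * x)))%:E = (1 - expR (- (c * s)))%:E)%E.
Proof.
move=> s0 c0.
have dF (x : R) : is_derive x 1 (fun x => - expR (- (c * x)) : R) (c * expR (- (c * x))).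
  have := is_derive1N (is_derive1_expZ (- c) x).
  rewrite mulNr opprK mulNr.
  by under eq_fun do rewrite mulNr.
rewrite (@ge0_improper_FTC2 _ _ (fun x => - expR (- (c * x))) (-1))//.
- by congr EFin; ring.
- move=> x _; apply: continuousM; first exact: cst_continuous.
  apply: continuous_comp; last exact: continuous_expR.
  apply: continuousN; apply: continuousM; [exact: cst_continuous|exact: cvg_id].
- by move=> x x0; rewrite mulr_ge0 ?expR_ge0// ltW.
- apply: cvg_at_right_filter.
  have E : - expR (- (c * 0)) = -1 by rewrite mulr0 oppr0 expR0.
  by rewrite -[X in _ --> X]E; exact: is_derive1_continuous (dF 0).
Qed.

(** The function exp(-c s) solves the same recursion.  All u_n lie in [0, 1], so
    that the difference is at most 1; inserting a bound for all n into the
    recursion k times improves it to (c s)^k / k!, which tends to 0 with k. *)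
Lemma picard_exp (u : nat -> R -> \bar R) (c : R) : 0 < c ->
  (forall n (s : R), 0 < s -> (0 <= u n s)%E) ->
  (forall n, measurable_fun (`]0%R, +oo[%classic : set R) (u n)) ->
  (forall n (s : R), 0 < s ->
     (u n s + c%:E * \int[mu]_(x in `]0%R, s[) u n.+1 x = 1)%E) ->
  forall n (s : R), 0 < s -> u n s = (expR (- (c * s)))%:E.
Proof.
move=> c0 u0 mu_ uE.
have sub (s : R) : `]0%R, s[ `<=` (`]0%R, +oo[%classic : set R).
  by move=> x /=; rewrite !in_itv/= => /andP[->].
have int0 n (s : R) : (0 <= \int[mu]_(x in `]0%R, s[) u n x)%E.
  by apply: integral_ge0 => x /sub /=; rewrite in_itv/= andbT; exact: u0.
have ule1 n (s : R) : 0 < s -> (u n s <= 1)%E.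
  by move=> s0; rewrite -(uE n s s0) leeDl// mule_ge0// lee_fin ltW.
have ufin n (s : R) : 0 < s -> u n s = (fine (u n s))%:E.
  move=> s0; rewrite fineK// ge0_fin_numE ?u0//.
  by rewrite (le_lt_trans (ule1 _ _ s0))// ltry.
pose v n (s : R) := fine (u n s).
have v01 n (s : R) : 0 < s -> 0 <= v n s <= 1.
  by move=> s0; rewrite -!lee_fin -ufin// u0//= ule1.
have mv n (s : R) : measurable_fun `]0%R, s[ (v n).
  apply: measurableT_comp => //; apply: measurable_funS (mu_ n) => //.
have bnd (k : nat) : forall n (s : R), 0 < s ->
    `|v n s - expR (- (c * s))| <= (c * s) ^+ k / k`!%:R.
  elim: k => [|k IH] n s s0.
    rewrite expr0 divr1 ler_norml.
    have /andP[a b] := v01 n s s0.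
    have e0 := expR_ge0 (- (c * s)).
    have e1 : expR (- (c * s)) <= 1 by rewrite expR_le1 oppr_le0 mulr_ge0 ?ltW.
    by apply/andP; split; lra.
  pose d x := v n.+1 x - expR (- (c * x)).
  have mexp : measurable_fun [set: R] (fun x => expR (- (c * x))).
    by apply: measurableT_comp => //; apply: measurableT_comp.
  have md : measurable_fun `]0%R, s[ d.
    by apply: measurable_funB => //; apply: measurable_funS mexp.
  have bd x : x \in `]0%R, s[ -> `|d x| <= (c * x) ^+ k / k`!%:R.
    by rewrite in_itv/= => /andP[x0 _]; exact: IH.
  have Iexp : mu.-integrable `]0%R, s[ (fun x => (expR (- (c * x)))%:E).
    apply: (@measurable_bounded_integrable _ _ _ mu (fun x : R => expR (- (c * x)))) => //.
    - by rewrite /= lebesgue_measure_itv/= lte_fin s0 -EFinB ltry.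
    - exact: measurable_funS mexp.
    - exists 1; split => // M M1 x /= /[!in_itv]/= /andP[x0 _].
      rewrite ger0_norm ?expR_ge0// (le_trans _ (ltW M1))//.
      by rewrite expR_le1 oppr_le0 mulr_ge0 ?ltW.
  have Iv : mu.-integrable `]0%R, s[ (fun x => (v n.+1 x)%:E).
    apply: (@measurable_bounded_integrable _ _ _ mu (v n.+1)) => //.
    - by rewrite /= lebesgue_measure_itv/= lte_fin s0 -EFinB ltry.
    - exact: mv.
    - exists 1; split => // M M1 x /= /[!in_itv]/= /andP[x0 _].
      have /andP[a b] := v01 n.+1 x x0.
      by rewrite ger0_norm// (le_trans _ (ltW M1)).
  have vE : v n s = 1 - c * \int[mu]_(x in `]0%R, s[) v n.+1 x.
    have := uE n s s0.
    rewrite (ufin n s s0) (_ : \int[mu]_(x in `]0%R, s[) u n.+1 x =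
      (\int[mu]_(x in `]0%R, s[) v n.+1 x)%:E)%E; last first.
      rewrite /Rintegral fineK; last exact: integrable_fin_num Iv.
      apply: eq_integral => x; rewrite inE/= in_itv/= => /andP[x0 _].
      exact: ufin.
    rewrite -EFinM -EFinD => -[<-]; rewrite /v; ring.
  have eE : expR (- (c * s)) = 1 - c * \int[mu]_(x in `]0%R, s[) expR (- (c * x)).
    have := integral_exp_halfopen s0 c0.
    under eq_integral do rewrite EFinM.
    rewrite integralZl// (_ : \int[mu]_(x in `]0%R, s[) (expR (- (c * x)))%:E =
      (\int[mu]_(x in `]0%R, s[) expR (- (c * x)))%:E)%E; last first.
      by rewrite /Rintegral fineK//; exact: integrable_fin_num Iexp.
    by rewrite -EFinM => -[->]; ring.
  have -> : v n s - expR (- (c * s)) = - (c * \int[mu]_(x in `]0%R, s[) d x).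
    rewrite {1}vE eE RintegralB//; ring.
  rewrite normrN normrM gtr0_norm//.
  have Id : mu.-integrable `]0%R, s[ (EFin \o d).
    have := integrableB _ Iv Iexp; apply => //.
  have Ip : (\int[mu]_(x in `]0%R, s[) ((c ^+ k / k`!%:R) * x ^+ k)%:E =
     ((c ^+ k / k`!%:R) * (s ^+ k.+1 / k.+1%:R))%:E)%E.
    under eq_integral do rewrite EFinM.
    rewrite ge0_integralZl_EFin//; last 3 first.
    - by move=> x; rewrite /= in_itv/= => /andP[x0 _]; rewrite lee_fin exprn_ge0// ltW.
    - apply/measurable_EFinP; apply: measurable_funX => //.
    - by rewrite divr_ge0// exprn_ge0// ltW.
    by rewrite integral_pow_halfopen.
  have : `|\int[mu]_(x in `]0%R, s[) d x| <= (c ^+ k / k`!%:R) * (s ^+ k.+1 / k.+1%:R).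
    rewrite -lee_fin -Ip EFin_normr_Rintegral//.
    apply: le_trans (le_abse_integral _ _ _) _ => //; first by apply/measurable_EFinP.
    apply: ge0_le_integral => //.
    - by do 2 apply: measurableT_comp => //.
    - apply/measurable_EFinP; apply: measurable_funM => //; apply: measurable_funX => //.
    - move=> x xs; rewrite /= lee_fin; apply: le_trans (bd x xs) _.
      by rewrite exprMn mulrAC.
  move=> /(ler_wpM2l (ltW c0)) /le_trans; apply.
  rewrite exprMn factS natrM invfM [c ^+ k.+1]exprS.
  by rewrite le_eqVlt; apply/orP; left; apply/eqP; ring.
move=> n s s0; rewrite (ufin n s s0); congr EFin; apply/eqP.
rewrite -subr_eq0 -normr_le0; apply/ler_addgt0Pl => e e0; rewrite addr0.
have cv := @cvg_exp_coeff R (c * s).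
have : \forall k \near \oo, exp_coeff (c * s) k < e.
  by move/cvgr_lt : cv; apply.
case=> k _ /(_ k (leqnn k)) => H.
exact: le_trans (bnd k n s s0) (ltW H).
Qed.

End picard.

Section laplace_psi.
Context {R : realType}.
Local Notation mu := (@lebesgue_measure R).
Local Notation halfline := (`]0%R, +oo[%classic : set R).
Variable alpha : R.
Hypothesis (alpha0 : 0 < alpha) (alpha1 : alpha < 1).
Implicit Types (b c m x y s t : R).
Local Notation psi := (rpsi alpha).

Lemma integral_psi_t b t s : 0 <= b -> 0 < s -> 0 < t ->
  (\int[mu]_(r in `]0%R, t[) (psi b r s)%:E = (psi (b + 1) t s)%:E)%E.
Proof.
move=> b0 s0 t0.
have dF x : 0 < x -> is_derive x 1 (fun r => psi (b + 1) r s) (psi b x s).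
  by move=> x0; exact: is_derive_rpsi_t.
rewrite (@ge0_improper_FTC2 _ _ _ 0 _ t0 dF)//.
- by rewrite subr0.
- by move=> x x0; exact: continuous_rpsi_t.
- by move=> x x0; apply: rpsi_ge0 => //; exact: ltW.
- by apply: rpsi_cvg0 => //; rewrite addr_ge0.
Qed.

Lemma integral_psi_s b t s : alpha <= b -> 0 < t -> 0 < s ->
  (\int[mu]_(x in `]0%R, s[) (psi (b - alpha) t x)%:E =
   (t `^ (b - 1) * recipGamma b - psi b t s)%:E)%E.
Proof.
move=> ab t0 s0.
have dF x : 0 < x -> is_derive x 1 (fun x => - psi b t x) (psi (b - alpha) t x).
  move=> x0; have := is_derive1N (is_derive_rpsi_s alpha0 alpha1 b x t0).
  by rewrite opprK.
rewrite (@ge0_improper_FTC2 _ _ _ (- (t `^ (b - 1) * recipGamma b)) _ s0 dF)//.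
- by rewrite opprK addrC.
- move=> x x0; exact: is_derive1_continuous (is_derive_rpsi_s alpha0 alpha1 (b - alpha) x t0).
- by move=> x x0; apply: rpsi_ge0 => //; [rewrite subr_ge0|exact: ltW].
- apply: cvgN; apply: cvg_at_right_filter; rewrite -(rpsi_s0 alpha).
  exact: is_derive1_continuous (is_derive_rpsi_s alpha0 alpha1 b 0 t0).
Qed.

Definition laplace_psi b m s := (\int[mu]_(t in halfline) (expR (- (m * t)) * psi b t s)%:E)%E.

Let mdamp b m s : measurable_fun halfline (fun t => (expR (- (m * t)) * psi b t s)%:E).
Proof.
apply: measurable_funS (_ : measurable_fun [set: R] _) => //.
apply/measurable_EFinP; apply: measurable_funM; last exact: measurable_rpsi_t.
by apply: measurableT_comp => //; apply: measurableT_comp.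
Qed.

Let mdamp2 b m : measurable_fun [set: R * R] (fun z => (expR (- (m * z.1)) * psi b z.1 z.2)%:E).
Proof.
apply/measurable_EFinP; apply: measurable_funM; last exact: measurable_rpsi2.
by apply: measurableT_comp => //; apply: measurableT_comp => //; apply: measurable_funM.
Qed.

Lemma laplace_psi_ge0 b m s : 0 <= b -> 0 <= s -> (0 <= laplace_psi b m s)%E.
Proof.
by move=> b0 s0; apply: integral_ge0 => t _; rewrite lee_fin mulr_ge0 ?expR_ge0 ?rpsi_ge0.
Qed.

Lemma measurable_laplace_psi b m : 0 <= b -> measurable_fun halfline (laplace_psi b m).
Proof.
move=> b0.
apply: (@measurable_integral_on _ _ _ (fun z => (expR (- (m * z.2)) * psi b z.2 z.1)%:E)) => //.
  have := measurableT_comp (mdamp2 b m) (@measurable_swap _ _ R R).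
  exact: measurable_funS.
move=> x y /=; rewrite !in_itv/= !andbT => x0 y0.
by rewrite lee_fin mulr_ge0 ?expR_ge0// rpsi_ge0// ltW.
Qed.

(** psi_{b+1} is the convolution of psi_b with the constant 1, whose transform
    is 1 / m. *)
Lemma laplace_psi_succ b m s : 0 <= b -> 0 < m -> 0 < s ->
  laplace_psi b m s = (m%:E * laplace_psi (b + 1) m s)%E.
Proof.
move=> b0 m0 s0.
have := @ge0_laplace_convolution R (fun=> 1) (psi b ^~ s) m (measurable_cst _)
  (measurable_rpsi_t alpha0 alpha1 b s) (fun _ _ => ler01).
move=> /(_ (fun t _ => rpsi_ge0 alpha0 alpha1 t b0 (ltW s0))).
have -> : (\int[mu]_(t in halfline) (expR (- (m * t)) * 1)%:E = (m^-1)%:E)%E.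
  have := laplace_powR ltr01 m0.
  rewrite powR_inv1 ?(ltW m0)// (rGamma_nat 0) fact0 mulr1 => <-.
  by apply: eq_integral => t _; rewrite subrr powRr0.
have -> : (\int[mu]_(t in halfline) ((expR (- (m * t)))%:E *
   \int[mu]_(r in `]0%R, t[) (1 * psi b r s)%:E))%E = laplace_psi (b + 1) m s.
  apply: eq_integral => t; rewrite inE/= in_itv/= andbT => t0.
  under eq_integral do rewrite mul1r.
  by rewrite integral_psi_t.
by move=> ->; rewrite muleA -EFinM mulfV ?gt_eqF// mul1e.
Qed.

(** The transform in t of the identity between psi_b(t, s) plus the primitive of
    psi_{b-alpha} in s and the value t^(b-1) / Gamma(b) of psi_b at s = 0. *)
Lemma laplace_psi_s b m s : alpha <= b -> 0 < m -> 0 < s ->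
  (laplace_psi b m s + \int[mu]_(x in `]0%R, s[) laplace_psi (b - alpha) m x
   = (m `^ (- b))%:E)%E.
Proof.
move=> ab m0 s0.
have b0 : 0 < b by exact: lt_le_trans ab.
have bal : 0 <= b - alpha by rewrite subr_ge0.
have sub : `]0%R, s[ `<=` halfline.
  by move=> x /=; rewrite !in_itv/= => /andP[->].
rewrite /laplace_psi.
rewrite -(@ge0_tonelli_on _ halfline `]0%R, s[
   (fun z => (expR (- (m * z.1)) * psi (b - alpha) z.1 z.2)%:E))//=; last 2 first.
- exact: measurable_funS (mdamp2 (b - alpha) m).
- move=> x y _ /=; rewrite in_itv/= => /andP[y0 _].
  by rewrite lee_fin mulr_ge0 ?expR_ge0// rpsi_ge0// ltW.
rewrite -ge0_integralD//; last 4 first.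
- by move=> t _; rewrite lee_fin mulr_ge0 ?expR_ge0// rpsi_ge0 ?ltW.
- exact: mdamp.
- move=> t _; apply: integral_ge0 => x /=; rewrite in_itv/= => /andP[x0 _].
  by rewrite lee_fin mulr_ge0 ?expR_ge0// rpsi_ge0// ltW.
- apply: (@eq_measurable_fun _ _ _ _ _ (fun t => (expR (- (m * t)) *
     (t `^ (b - 1) * recipGamma b - psi b t s))%:E)).
    move=> t; rewrite inE/= in_itv/= andbT => t0.
    under eq_integral do rewrite EFinM.
    rewrite ge0_integralZl_EFin ?expR_ge0//; last 2 first.
    + move=> x /=; rewrite in_itv/= => /andP[x0 _].
      by rewrite lee_fin rpsi_ge0// ltW.
    + by apply/measurable_EFinP; apply: measurable_funS (measurable_rpsi_s alpha0 alpha1 _ _).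
    by rewrite integral_psi_s.
  apply: measurable_funS (_ : measurable_fun [set: R] _) => //.
  apply/measurable_EFinP; apply: measurable_funM.
    by apply: measurableT_comp => //; apply: measurableT_comp.
  apply: measurable_funB; last exact: measurable_rpsi_t.
  by apply: measurable_funM => //; exact: measurable_powR.
transitivity (\int[mu]_(t in halfline) ((recipGamma b)%:E * (expR (- (m * t)) * t `^ (b - 1))%:E))%E.
  apply: eq_integral => t; rewrite inE/= in_itv/= andbT => t0.
  under eq_integral do rewrite EFinM.
  rewrite ge0_integralZl_EFin ?expR_ge0//; last 2 first.
  - move=> x /=; rewrite in_itv/= => /andP[x0 _].
    by rewrite lee_fin rpsi_ge0// ltW.
  - by apply/measurable_EFinP; apply: measurable_funS (measurable_rpsi_s alpha0 alpha1 _ _).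
  rewrite integral_psi_s// -!EFinM -EFinD; congr EFin; ring.
rewrite recipGamma_gt0E// ge0_integralZl_EFin//; last 3 first.
- by move=> t _; rewrite lee_fin mulr_ge0 ?powR_ge0 ?expR_ge0.
- apply: measurable_funS (_ : measurable_fun [set: R] _) => //.
  by apply/measurable_EFinP; exact: measurable_powR_exp.
- by rewrite invr_ge0 rGamma_ge0.
rewrite laplace_powR// -EFinM; congr EFin.
by rewrite mulrCA mulVf ?mulr1// gt_eqF// rGamma_gt0.
Qed.

(** The step 1 - alpha between consecutive parameters arises because one relation
    raises b by 1 and the other one lowers it by alpha. *)
Lemma laplace_psiE b m s : 0 <= b -> 0 < m -> 0 < s ->
  laplace_psi b m s = (m `^ (- b) * expR (- (m `^ alpha * s)))%:E.
Proof.
move=> b0 m0 s0.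
pose bn n := b + n%:R * (1 - alpha).
have bn0 n : 0 <= bn n by rewrite addr_ge0// mulr_ge0// subr_ge0 ltW.
have bnS n : bn n.+1 = bn n + 1 - alpha by rewrite /bn -natr1; ring.
pose u n x := ((m `^ bn n)%:E * laplace_psi (bn n) m x)%E.
have u0 n x : 0 < x -> (0 <= u n x)%E.
  move=> x0; rewrite mule_ge0 ?lee_fin ?powR_ge0//.
  by rewrite laplace_psi_ge0// ltW.
have mu_ n : measurable_fun halfline (u n).
  by apply: emeasurable_funM => //; exact: measurable_laplace_psi.
have powM c d : m `^ (c + d) = m `^ c * m `^ d.
  by rewrite powRD// (gt_eqF m0) implybT.
have uE n x : 0 < x -> (u n x + (m `^ alpha)%:E * \int[mu]_(y in `]0%R, x[) u n.+1 y = 1)%E.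
  move=> x0.
  have ab : alpha <= bn n + 1 by apply: ler_wpDl => //; exact: ltW.
  have L := laplace_psi_s ab m0 x0.
  rewrite ge0_integralZl_EFin ?powR_ge0//; last 2 first.
  - move=> y /=; rewrite in_itv/= => /andP[y0 _].
    by rewrite laplace_psi_ge0// ltW.
  - apply: measurable_funS (measurable_laplace_psi m (bn0 n.+1)) => //.
    by move=> y /=; rewrite !in_itv/= => /andP[->].
  rewrite /u laplace_psi_succ// !muleA -!EFinM -powM bnS.
  rewrite (_ : alpha + (bn n + 1 - alpha) = bn n + 1); last by ring.
  rewrite powM powRr1 ?(ltW m0)// -muleDr ?L//.
  - rewrite -EFinM; have -> : m `^ bn n * m = m `^ (bn n + 1) by rewrite powM powRr1// ltW.
    by rewrite -powM subrr powRr0.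
  - apply: ge0_adde_def; rewrite inE.
      by apply: laplace_psi_ge0; [rewrite addr_ge0 ?bn0|exact: ltW].
    apply: integral_ge0 => y /=; rewrite in_itv/= => /andP[y0 _].
    by rewrite -bnS laplace_psi_ge0// ltW.
have ma0 : 0 < m `^ alpha by rewrite powR_gt0.
have := @picard_exp R u _ ma0 u0 mu_ uE 0%N s s0.
rewrite /u (_ : bn 0%N = b); last by rewrite /bn mul0r addr0.
move=> /(congr1 (fun z => (m `^ (- b))%:E * z)%E).
by rewrite muleA -!EFinM -powM addNr powRr0 mul1e.
Qed.

Lemma integrable_laplace_psi b m s : 0 <= b -> 0 < m -> 0 < s ->
  mu.-integrable halfline (fun t => (expR (- (m * t)) * psi b t s)%:E) /\
  \int[mu]_(t in halfline) (expR (- (m * t)) * psi b t s) =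
    m `^ (- b) * expR (- (m `^ alpha * s)).
Proof.
move=> b0 m0 s0; apply: ge0_integrable_value.
- exact: mdamp.
- by move=> t _; rewrite mulr_ge0 ?expR_ge0// rpsi_ge0// ltW.
- exact: laplace_psiE.
Qed.

End laplace_psi.

(** * Power moments in s and the double Laplace transform *)

Section mellin_psi.
Context {R : realType}.
Local Notation mu := (@lebesgue_measure R).
Local Notation halfline := (`]0%R, +oo[%classic : set R).
Variable alpha : R.
Hypothesis (alpha0 : 0 < alpha) (alpha1 : alpha < 1).
Implicit Types (b c m x y s t eta rho : R).
Local Notation psi := (rpsi alpha).
Local Notation w := (wfun alpha).

(** The substitution x = s t^(-alpha) leaves an unknown constant K, the Mellin
    transform of w_b; it is computed from the double integral of
    exp(-r) s^(eta-1) psi(r, s) in the two orders. *)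
Lemma mellin_psi b eta t : 0 <= b -> 0 < eta -> 0 < t ->
  (\int[mu]_(s in halfline) (s `^ (eta - 1) * psi b t s)%:E =
   (rGamma eta * recipGamma (alpha * eta + b) * t `^ (alpha * eta + b - 1))%:E)%E.
Proof.
move=> b0 e0.
pose f x := (x `^ (eta - 1) * w b x)%:E.
pose K := (\int[mu]_(x in halfline) f x)%E.
have mf : measurable_fun halfline f.
  apply: measurable_funS (_ : measurable_fun [set: R] _) => //.
  apply/measurable_EFinP; apply: measurable_funM; first exact: measurable_powR.
  exact: measurable_wfun.
have f0 x : 0 < x -> (0 <= f x)%E.
  by move=> x0; rewrite lee_fin mulr_ge0 ?powR_ge0// wfun_ge0// ltW.
have inner r : 0 < r -> (\int[mu]_(s in halfline) (s `^ (eta - 1) * psi b r s)%:E =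
    (r `^ (alpha * eta + b - 1))%:E * K)%E.
  move=> r0; have c0 : 0 < r `^ (- alpha) by rewrite powR_gt0.
  have rr c d : r `^ (c + d) = r `^ c * r `^ d by rewrite powRD// (gt_eqF r0) implybT.
  transitivity (\int[mu]_(s in halfline) ((r `^ (b - 1) * (r `^ (- alpha)) `^ (1 - eta))%:E *
      f (r `^ (- alpha) * s)%R))%E.
    apply: eq_integral => s; rewrite inE/= in_itv/= andbT => s0.
    rewrite /f -EFinM; congr EFin; rewrite powRM ?(ltW s0) ?(ltW c0)//.
    have E : (r `^ (- alpha)) `^ (1 - eta) * (r `^ (- alpha)) `^ (eta - 1) = 1.
      rewrite -powRD; last by rewrite (gt_eqF c0) implybT.
      by rewrite addrA subrK subrr powRr0.
    rewrite /rpsi [s * _]mulrC -[LHS]mul1r -[X in X * _ = _]E; ring.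
  rewrite ge0_integralZl_EFin//; last 3 first.
  - by move=> s /=; rewrite in_itv/= andbT => s0; apply: f0; rewrite mulr_gt0.
  - apply: measurable_funS (_ : measurable_fun [set: R] _) => //.
    apply/measurable_EFinP; apply: measurable_funM.
      by apply: (measurableT_comp (measurable_powR _)); exact: measurable_funM.
    by apply: (measurableT_comp (measurable_wfun alpha0 alpha1 b)); exact: measurable_funM.
  - by rewrite mulr_ge0 ?powR_ge0.
  rewrite ge0_integral_scale// muleA -EFinM -/K; congr (_ %:E * _)%E.
  rewrite -[(r `^ (- alpha))^-1]powR_inv1 ?(ltW c0)// -!powRrM -!rr.
  by congr powR; ring.
have ag : 0 < alpha * eta + b by rewrite ltr_wpDr// mulr_gt0.
have KE : K = (rGamma eta / rGamma (alpha * eta + b))%:E.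
  have K0 : (0 <= K)%E.
    by apply: integral_ge0 => x /=; rewrite in_itv/= andbT; exact: f0.
  have L : (\int[mu]_(r in halfline) \int[mu]_(s in halfline)
      (expR (- r) * (s `^ (eta - 1) * psi b r s))%:E = (rGamma (alpha * eta + b))%:E * K)%E.
    rewrite -rGammaE// -ge0_integralZr//; last 2 first.
    - apply: measurable_funS (_ : measurable_fun [set: R] _) => //.
      apply/measurable_EFinP; apply: measurable_funM; first exact: measurable_powR.
      exact: measurableT_comp.
    - by move=> r _; rewrite lee_fin mulr_ge0 ?powR_ge0 ?expR_ge0.
    apply: eq_integral => r; rewrite inE/= in_itv/= andbT => r0.
    under eq_integral do rewrite EFinM.
    rewrite ge0_integralZl_EFin ?expR_ge0//; last 2 first.
    - move=> s /=; rewrite in_itv/= andbT => s0.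
      by rewrite lee_fin mulr_ge0 ?powR_ge0// rpsi_ge0// ltW.
    - apply: measurable_funS (_ : measurable_fun [set: R] _) => //.
      apply/measurable_EFinP; apply: measurable_funM; first exact: measurable_powR.
      exact: measurable_rpsi_s.
    by rewrite inner// muleA -EFinM mulrC.
  have M : (\int[mu]_(r in halfline) \int[mu]_(s in halfline)
      (expR (- r) * (s `^ (eta - 1) * psi b r s))%:E = (rGamma eta)%:E)%E.
    rewrite (@ge0_tonelli_on _ halfline halfline
      (fun z => (expR (- z.1) * (z.2 `^ (eta - 1) * psi b z.1 z.2))%:E))//=; last 2 first.
    - apply: measurable_funS (_ : measurable_fun [set: R * R] _) => //.
      apply/measurable_EFinP; apply: measurable_funM.
        by apply: measurableT_comp => //; apply: measurableT_comp.
      apply: measurable_funM; last exact: measurable_rpsi2.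
      by apply: (measurableT_comp (measurable_powR _)).
    - move=> r s /=; rewrite !in_itv/= !andbT => r0 s0.
      by rewrite lee_fin mulr_ge0 ?expR_ge0// mulr_ge0 ?powR_ge0// rpsi_ge0// ltW.
    rewrite -rGammaE//; apply: eq_integral => s; rewrite inE/= in_itv/= andbT => s0.
    transitivity (\int[mu]_(r in halfline) ((s `^ (eta - 1))%:E *
       (expR (- (1 * r)) * psi b r s)%:E))%E.
      by apply: eq_integral => r _; rewrite -EFinM mul1r mulrCA.
    rewrite ge0_integralZl_EFin ?powR_ge0//; last 2 first.
    - by move=> r _; rewrite lee_fin mulr_ge0 ?expR_ge0// rpsi_ge0// ltW.
    - apply: measurable_funS (_ : measurable_fun [set: R] _) => //.
      apply/measurable_EFinP; apply: measurable_funM; last exact: measurable_rpsi_t.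
      by apply: measurableT_comp => //; apply: measurableT_comp.
    have := laplace_psiE alpha0 alpha1 b0 ltr01 s0; rewrite /laplace_psi => ->.
    by rewrite !powR1 !mul1r -EFinM.
  have G0 : 0 < rGamma (alpha * eta + b) by exact: rGamma_gt0.
  rewrite mulrC EFinM -M L muleA -EFinM mulVf ?mul1e// gt_eqF//.
move=> t0; rewrite inner// KE -EFinM recipGamma_gt0E//; congr EFin.
by rewrite mulrC.
Qed.

Lemma integrable_mellin_psi b eta t : 0 <= b -> 0 < eta -> 0 < t ->
  mu.-integrable halfline (fun s => (s `^ (eta - 1) * psi b t s)%:E).
Proof.
move=> b0 e0 t0.
have mf : measurable_fun halfline (fun s => (s `^ (eta - 1) * psi b t s)%:E).
  apply: measurable_funS (_ : measurable_fun [set: R] _) => //.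
  apply/measurable_EFinP; apply: measurable_funM; first exact: measurable_powR.
  exact: measurable_rpsi_s.
have f0 s : halfline s -> 0 <= s `^ (eta - 1) * psi b t s.
  by rewrite /= in_itv/= andbT => s0; rewrite mulr_ge0 ?powR_ge0// rpsi_ge0// ltW.
by have [] := ge0_integrable_value mf f0 (mellin_psi b0 e0 t0).
Qed.

Lemma integrable_psi b t : 0 <= b -> 0 < t ->
  mu.-integrable halfline (fun s => (psi b t s)%:E).
Proof.
move=> b0 t0; have := integrable_mellin_psi b0 ltr01 t0.
by apply: eq_integrable => // s _; rewrite subrr powRr0 mul1r.
Qed.

Lemma integrable_exp_psi_neg b t m : 0 <= b -> 0 < t -> 0 < m ->
  mu.-integrable halfline (fun s => (expR (- (m * s)) * psi b t s)%:E).
Proof.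
move=> b0 t0 m0; apply: le_integrable (integrable_psi b0 t0) => //.
  apply: measurable_funS (_ : measurable_fun [set: R] _) => //.
  apply/measurable_EFinP; apply: measurable_funM; last exact: measurable_rpsi_s.
  by apply: measurableT_comp => //; apply: measurableT_comp.
move=> s /=; rewrite in_itv/= andbT => s0; rewrite lee_fin normrM ler_piMl//.
by rewrite ger0_norm ?expR_ge0// expR_le1 oppr_le0 mulr_ge0// ltW.
Qed.

Lemma double_laplace_psi b l m : 0 <= b -> 0 < l -> 0 < m ->
  (\int[mu]_(t in halfline) \int[mu]_(s in halfline)
     (expR (- (l * s)) * expR (- (m * t)) * psi b t s)%:E =
   (1 / (m `^ b * (m `^ alpha + l)))%:E)%E.
Proof.
move=> b0 l0 m0.
rewrite (@ge0_tonelli_on _ halfline halfline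
   (fun z => (expR (- (l * z.2)) * expR (- (m * z.1)) * psi b z.1 z.2)%:E))//=; last 2 first.
- apply: measurable_funS (_ : measurable_fun [set: R * R] _) => //.
  apply/measurable_EFinP; apply: measurable_funM; last exact: measurable_rpsi2.
  by apply: measurable_funM; apply: measurableT_comp => //; apply: measurableT_comp => //;
    apply: measurable_funM.
- move=> r s /=; rewrite !in_itv/= !andbT => r0 s0.
  by rewrite lee_fin mulr_ge0 ?(mulr_ge0 (expR_ge0 _) (expR_ge0 _))// rpsi_ge0// ltW.
have ml0 : 0 < m `^ alpha + l by rewrite addr_gt0 ?powR_gt0.
transitivity (\int[mu]_(s in halfline)
   ((m `^ (- b))%:E * (expR (- ((m `^ alpha + l) * s)) * s `^ (1 - 1))%:E))%E.
  apply: eq_integral => s; rewrite inE/= in_itv/= andbT => s0.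
  transitivity (\int[mu]_(r in halfline) ((expR (- (l * s)))%:E *
       (expR (- (m * r)) * psi b r s)%:E))%E.
    by apply: eq_integral => r _; rewrite -EFinM; congr EFin; ring.
  rewrite ge0_integralZl_EFin ?expR_ge0//; last 2 first.
  - by move=> r _; rewrite lee_fin mulr_ge0 ?expR_ge0// rpsi_ge0// ltW.
  - apply: measurable_funS (_ : measurable_fun [set: R] _) => //.
    apply/measurable_EFinP; apply: measurable_funM; last exact: measurable_rpsi_t.
    by apply: measurableT_comp => //; apply: measurableT_comp.
  have := laplace_psiE alpha0 alpha1 b0 m0 s0; rewrite /laplace_psi => ->.
  rewrite -!EFinM; congr EFin; rewrite subrr powRr0 mulr1 mulrCA -expRD.
  by congr (_ * expR _); ring.
rewrite ge0_integralZl_EFin ?powR_ge0//; last 2 first.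
- by move=> r _; rewrite lee_fin mulr_ge0 ?expR_ge0 ?powR_ge0.
- apply: measurable_funS (_ : measurable_fun [set: R] _) => //.
  by apply/measurable_EFinP; exact: measurable_powR_exp.
rewrite laplace_powR// (rGamma_nat 0) -EFinM; congr EFin.
by rewrite mulr1 powR_inv1 ?(ltW ml0)// powRN mul1r invfM.
Qed.

End mellin_psi.

Section double_laplace.
Context {R : realType}.
Local Notation mu := (@lebesgue_measure R).
Local Notation halfline := (`]0%R, +oo[%classic : set R).
Variable alpha : R.
Hypothesis (alpha0 : 0 < alpha) (alpha1 : alpha < 1).
Implicit Types (b l m t s : R).

(** The inner integrals are finite, so that the extended-real iterated integral is
    one of real numbers. *)
Lemma integrable_double_laplace_psi b l m : 0 <= b -> 0 < l -> 0 < m ->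
  let h := fun t s => expR (- (l * s)) * expR (- (m * t)) * rpsi alpha b t s in
  [/\ forall t, 0 < t -> mu.-integrable halfline (fun s => (h t s)%:E),
      mu.-integrable halfline (fun t => (\int[mu]_(s in halfline) h t s)%:E) &
      \int[mu]_(t in halfline) \int[mu]_(s in halfline) h t s =
        1 / (m `^ b * (m `^ alpha + l))].
Proof.
move=> b0 l0 m0 h.
have Ih t : 0 < t -> mu.-integrable halfline (fun s => (h t s)%:E).
  move=> t0.
  have := integrable_EFinZ (measurable_itv _) (expR (- (m * t)))
    (integrable_exp_psi_neg alpha0 alpha1 b0 t0 l0).
  by apply: eq_integrable => // s _; rewrite /h; congr EFin; ring.
have h0 t s : 0 < s -> 0 <= h t s.
  by move=> s0; rewrite mulr_ge0 ?rpsi_ge0 ?(ltW s0)// mulr_ge0 ?expR_ge0.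
have JE t : 0 < t -> (\int[mu]_(s in halfline) h t s)%:E = (\int[mu]_(s in halfline) (h t s)%:E)%E.
  by move=> t0; rewrite /Rintegral fineK//; exact: integrable_fin_num (Ih t t0).
have mJ : measurable_fun halfline (fun t => (\int[mu]_(s in halfline) h t s)%:E).
  apply: (@eq_measurable_fun _ _ _ _ _ (fun t => \int[mu]_(s in halfline) (h t s)%:E)%E).
    by move=> t; rewrite inE/= in_itv/= andbT => /JE.
  apply: (@measurable_integral_on _ _ _ (fun z => (h z.1 z.2)%:E)) => //=; last first.
    by move=> t s _; rewrite /= in_itv/= andbT => /h0; rewrite lee_fin.
  apply: measurable_funS (_ : measurable_fun [set: R * R] _) => //.
  apply/measurable_EFinP; apply: measurable_funM; last exact: measurable_rpsi2.
  by apply: measurable_funM; apply: measurableT_comp => //; apply: measurableT_comp => //;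
    apply: measurable_funM.
have JI : (\int[mu]_(t in halfline) (\int[mu]_(s in halfline) h t s)%:E =
    (1 / (m `^ b * (m `^ alpha + l)))%:E)%E.
  rewrite -double_laplace_psi//; apply: eq_integral => t.
  by rewrite inE/= in_itv/= andbT => /JE.
have J0 t : halfline t -> 0 <= \int[mu]_(s in halfline) h t s.
  by move=> _; apply: Rintegral_ge0 => s /=; rewrite in_itv/= andbT => /h0.
by have [IJ ->] := ge0_integrable_value mJ J0 JI.
Qed.
End double_laplace.

(** * Exponential moments in s *)

Section entire_psi.
Context {R : realType}.
Local Notation mu := (@lebesgue_measure R).
Local Notation halfline := (`]0%R, +oo[%classic : set R).
Implicit Types (b p m x y s t rho : R).

(** Convexity settles y <= 0 and y >= 1.  For y in between one passes through
    Gamma(p + 1), which costs the factor ((p + 1) / p)^(y-1) >= 1/2. *)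
Lemma rGamma_lower p y : 1 <= p -> 0 < p + y -> p `^ y * rGamma p / 2 <= rGamma (p + y).
Proof.
move=> p1 py0.
have p0 : 0 < p by lra.
have Gp := rGamma_gt0 p0.
have hp : p `^ y * rGamma p / 2 <= p `^ y * rGamma p.
  have : 0 <= p `^ y * rGamma p by rewrite mulr_ge0 ?powR_ge0 ?rGamma_ge0.
  by move: (p `^ y * rGamma p) => z; lra.
have [y0|y0] := leP y 0; first by apply: (le_trans hp); apply: rGamma_shift => //; right.
have [y1|y1] := leP 1 y; first by apply: (le_trans hp); apply: rGamma_shift => //; left.
have : (p + 1) `^ (y - 1) * rGamma (p + 1) <= rGamma (p + 1 + (y - 1)).
  by apply: rGamma_shift; [lra|lra|right; lra].
rewrite (_ : p + 1 + (y - 1) = p + y); last by ring.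
apply: le_trans; rewrite rGammaD1// (powR_mulB1 y p0).
have -> : p `^ (y - 1) * p * rGamma p / 2 = (p `^ (y - 1) / 2) * (p * rGamma p) by ring.
rewrite ler_wpM2r ?mulr_ge0 ?rGamma_ge0//; first by lra.
have q0 : 0 < p `^ (y - 1) by rewrite powR_gt0.
have -> : p + 1 = p * ((p + 1) / p) by field; exact: lt0r_neq0.
have r2 : (p + 1) / p <= 2 by rewrite ler_pdivrMr//; lra.
have r0 : 0 < (p + 1) / p by rewrite divr_gt0//; lra.
rewrite powRM ?(ltW p0) ?(ltW r0)// ler_wpM2l ?(ltW q0)//.
have -> : y - 1 = - (1 - y) by ring.
rewrite powRN lef_pV2 ?posrE ?powR_gt0//.
apply: (@le_trans _ _ (2 `^ (1 - y))).
  by apply: ge0_ler_powR; rewrite ?nnegrE ?(ltW r0)//; lra.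
rewrite -[leRHS]powRr1//; apply: ler_powR; lra.
Qed.

Variable alpha : R.
Hypothesis (alpha0 : 0 < alpha) (alpha1 : alpha < 1).
Local Notation psi := (rpsi alpha).

(** The integral of s^k / k! against psi(t, s) ds: t^(alpha+b-1) times the k-th term of
    the Mittag-Leffler series at t^alpha. *)
Definition mlcoef b t (k : nat) : R :=
  t `^ (alpha * k.+1%:R + b - 1) * recipGamma (alpha * k.+1%:R + b).

Lemma mlcoef_ge0 b t k : 0 <= b -> 0 <= mlcoef b t k.
Proof.
move=> b0; have a0 : 0 < alpha * k.+1%:R + b by rewrite ltr_wpDr// mulr_gt0.
by rewrite /mlcoef mulr_ge0 ?powR_ge0// recipGamma_gt0E// invr_ge0 rGamma_ge0.
Qed.

(** Gamma(x) grows faster than p^x for every p; p is chosen to make the terms decay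
    like 2^(-k). *)
Lemma is_cvg_mlcoef b t rho : 0 <= b -> 0 < t -> 0 <= rho ->
  cvgn (series (fun k => rho ^+ k * mlcoef b t k)).
Proof.
move=> b0 t0 r0.
pose z := rho * t `^ alpha.
have z0 : 0 <= z by rewrite mulr_ge0 ?powR_ge0.
(* then p^alpha is at least 2 z, and p is at least 1 as rGamma_lower requires *)
pose p := (2 * z + 1) `^ alpha^-1.
have z1 : 1 <= 2 * z + 1 by lra.
have p1 : 1 <= p.
  rewrite -[leLHS](powRr0 (2 * z + 1)); apply: ler_powR => //.
  by rewrite invr_ge0 ltW.
have p0 : 0 < p by lra.
have pa : p `^ alpha = 2 * z + 1.
  by rewrite /p -powRrM mulVf ?powRr1 ?gt_eqF//; lra.
pose C := t `^ (alpha + b - 1) * (2 / rGamma p) * p `^ (p - alpha - b).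
have C0 : 0 <= C by rewrite /C !mulr_ge0 ?powR_ge0 ?invr_ge0 ?rGamma_ge0.
have pp c d : p `^ (c + d) = p `^ c * p `^ d by rewrite powRD// (gt_eqF p0) implybT.
have tt c d : t `^ (c + d) = t `^ c * t `^ d by rewrite powRD// (gt_eqF t0) implybT.
apply: (@series_le_cvg _ _ (geometric C 2^-1)).
- by move=> k; rewrite mulr_ge0 ?exprn_ge0 ?mlcoef_ge0.
- by move=> k; rewrite /= mulr_ge0 ?exprn_ge0.
- move=> k /=.
  have a0 : 0 < alpha * k.+1%:R + b by rewrite ltr_wpDr// mulr_gt0.
  have L : recipGamma (alpha * k.+1%:R + b) <=
     2 / rGamma p * (p `^ (p - alpha - b) * (p `^ alpha ^+ k)^-1).
    have E : p + (alpha * k.+1%:R + b - p) = alpha * k.+1%:R + b by ring.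
    have := @rGamma_lower p (alpha * k.+1%:R + b - p) p1; rewrite E => /(_ a0) h.
    have q0 : 0 < p `^ (alpha * k.+1%:R + b - p) by rewrite powR_gt0.
    have G0 := rGamma_gt0 p0.
    rewrite recipGamma_gt0E// (_ : _ * _ = (p `^ (alpha * k.+1%:R + b - p) * rGamma p / 2)^-1).
      by rewrite lef_pV2// posrE ?rGamma_gt0// divr_gt0// mulr_gt0.
    rewrite -powR_mulrn ?powR_ge0// -powRrM -powRN -pp.
    rewrite (_ : p - alpha - b + _ = - (alpha * k.+1%:R + b - p)); last first.
      by rewrite -natr1; ring.
    rewrite powRN; field.
    by rewrite !lt0r_neq0.
  apply: (@le_trans _ _ (rho ^+ k * (t `^ (alpha * k.+1%:R + b - 1) *
     (2 / rGamma p * (p `^ (p - alpha - b) * (p `^ alpha ^+ k)^-1))))).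
    by rewrite ler_wpM2l ?exprn_ge0// ler_wpM2l ?powR_ge0.
  have -> : t `^ (alpha * k.+1%:R + b - 1) = t `^ (alpha + b - 1) * (t `^ alpha) ^+ k.
    rewrite -powR_mulrn ?powR_ge0// -powRrM -tt; congr powR.
    by rewrite -natr1; ring.
  rewrite [leLHS](_ : _ = C * (z ^+ k * (p `^ alpha ^+ k)^-1)); last first.
    by rewrite /C /z exprMn; ring.
  rewrite ler_wpM2l// -exprVn -exprMn lerXn2r ?nnegrE ?mulr_ge0 ?invr_ge0 ?powR_ge0//.
  by rewrite pa ler_pdivrMr; lra.
- by apply: is_cvg_geometric_series; rewrite ger0_norm// invf_lt1 ?ltr1n.
Qed.

Lemma integrable_pow_psi b t (k : nat) : 0 <= b -> 0 < t ->
  mu.-integrable halfline (fun s => (s ^+ k / k`!%:R * psi b t s)%:E) /\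
  \int[mu]_(s in halfline) (s ^+ k / k`!%:R * psi b t s) = mlcoef b t k.
Proof.
move=> b0 t0.
have I := integrable_mellin_psi alpha0 alpha1 b0 (ltr0Sn R k) t0.
have M := mellin_psi alpha0 alpha1 b0 (ltr0Sn R k) t0.
have E s : 0 < s -> s ^+ k / k`!%:R * psi b t s =
    k`!%:R^-1 * (s `^ (k.+1%:R - 1) * psi b t s).
  by move=> s0; rewrite -natr1 addrK powR_mulrn ?ltW//; ring.
split.
  apply: eq_integrable (integrable_EFinZ _ k`!%:R^-1 I) => // s.
  by rewrite inE/= in_itv/= andbT => s0; rewrite E.
rewrite (@eq_Rintegral _ _ _ mu _ (fun s => k`!%:R^-1 * (s `^ (k.+1%:R - 1) * psi b t s))); last first.
  by move=> s; rewrite inE/= in_itv/= andbT; exact: E.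
rewrite RintegralZl// /Rintegral M/= rGamma_nat /mlcoef -!mulrA mulKf.
  by rewrite [RHS]mulrC.
by rewrite pnatr_eq0 -lt0n fact_gt0.
Qed.

Lemma integral_partial_psi (c : nat -> R) b t n : 0 <= b -> 0 < t ->
  mu.-integrable halfline (fun s => (\sum_(0 <= k < n) c k * (s ^+ k / k`!%:R) * psi b t s)%:E) /\
  \int[mu]_(s in halfline) (\sum_(0 <= k < n) c k * (s ^+ k / k`!%:R) * psi b t s) =
  \sum_(0 <= k < n) c k * mlcoef b t k.
Proof.
move=> b0 t0; elim: n => [|n [IH1 IH2]].
  rewrite big_nil; split.
    apply: eq_integrable (integrable0 mu halfline) => // s _.
    by rewrite big_nil.
  rewrite (@eq_Rintegral _ _ _ mu _ (fun=> 0)) ?Rintegral_cst ?mul0r// => s _.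
  by rewrite big_nil.
have [I J] := integrable_pow_psi n b0 t0.
have E s : \sum_(0 <= k < n.+1) c k * (s ^+ k / k`!%:R) * psi b t s =
   \sum_(0 <= k < n) c k * (s ^+ k / k`!%:R) * psi b t s + c n * (s ^+ n / n`!%:R * psi b t s).
  by rewrite big_nat_recr//=; ring.
have Ic := integrable_EFinZ (measurable_itv _) (c n) I.
split.
  by apply: eq_integrable (integrable_EFinD _ IH1 Ic) => // s _; rewrite E.
rewrite (@eq_Rintegral _ _ _ mu _ _ _ (fun s _ => E s)).
by rewrite RintegralD// IH2 RintegralZl// J big_nat_recr.
Qed.

(** Monotone convergence: the partial sums of the exponential series have integrals
    bounded by the sum of a Mittag-Leffler series. *)
Lemma integrable_exp_psi b t rho : 0 <= b -> 0 < t -> 0 <= rho ->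
  mu.-integrable halfline (fun s => (expR (rho * s) * psi b t s)%:E).
Proof.
move=> b0 t0 r0.
pose f n s := (\sum_(0 <= k < n) rho ^+ k * (s ^+ k / k`!%:R) * psi b t s)%:E.
have If n := (integral_partial_psi (fun k => rho ^+ k) n b0 t0).1.
have Jf n := (integral_partial_psi (fun k => rho ^+ k) n b0 t0).2.
have term0 k s : 0 < s -> 0 <= rho ^+ k * (s ^+ k / k`!%:R) * psi b t s.
  move=> s0; rewrite mulr_ge0 ?rpsi_ge0 ?(ltW s0)//.
  by rewrite mulr_ge0 ?exprn_ge0// divr_ge0// exprn_ge0// ltW.
have mexp : measurable_fun halfline (fun s => (expR (rho * s) * psi b t s)%:E).
  apply: measurable_funS (_ : measurable_fun [set: R] _) => //.
  apply/measurable_EFinP; apply: measurable_funM; last exact: measurable_rpsi_s.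
  by apply: measurableT_comp => //; apply: measurable_funM.
have lf s : (expR (rho * s) * psi b t s)%:E = limn (f ^~ s).
  apply/esym/cvg_lim => //; apply: cvg_EFin; first exact: nearW.
  rewrite (_ : fine \o _ = (fun n => series (exp_coeff (rho * s)) n * psi b t s)).
    by apply: cvgM; [exact: is_cvg_series_exp_coeff|exact: cvg_cst].
  apply/funext => n; rewrite /f/= /series/= -mulr_suml; congr (_ * _).
  by apply: eq_bigr => k _; rewrite /exp_coeff/= exprMn mulrA.
apply/integrableP; split => //.
apply: (@le_lt_trans _ _ (\int[mu]_(s in halfline) limn (f ^~ s))%E).
  rewrite le_eqVlt; apply/orP; left; apply/eqP; apply: eq_integral => s.
  rewrite inE/= in_itv/= andbT => s0.
  by rewrite -lf ger0_norm// mulr_ge0 ?expR_ge0// rpsi_ge0// ltW.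
rewrite monotone_convergence//; last 3 first.
- by move=> n; exact: measurable_int (If n).
- move=> n s /=; rewrite in_itv/= andbT => s0.
  by rewrite lee_fin sumr_ge0// => k _; exact: term0.
- move=> s /=; rewrite in_itv/= andbT => s0; apply/nondecreasing_seqP => n.
  by rewrite lee_fin big_nat_recr//= lerDl term0.
have -> : (fun n => \int[mu]_(s in halfline) f n s)%E =
    (fun n => (series (fun k => rho ^+ k * mlcoef b t k) n)%:E).
  apply/funext => n; rewrite -[RHS]/((\sum_(0 <= k < n) rho ^+ k * mlcoef b t k)%:E) -Jf.
  by rewrite /Rintegral fineK//; exact: integrable_fin_num (If n).
by rewrite EFin_lim ?ltry//; exact: is_cvg_mlcoef.
Qed.

(** Applied to the real and the imaginary part of exp(lambda s), both of which are
    such series with rho = |Re lambda| + |Im lambda|.  The partial sums are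
    dominated by exp(rho s) psi(t, s). *)
Lemma integral_series_psi (c : nat -> R) (F : R -> R) b t rho : 0 <= b -> 0 < t -> 0 <= rho ->
  (forall k, `|c k| <= rho ^+ k) ->
  (forall s, \sum_(0 <= k < n) c k * (s ^+ k / k`!%:R) @[n --> \oo] --> F s) ->
  mu.-integrable halfline (fun s => (F s * psi b t s)%:E) /\
  series (fun k => c k * mlcoef b t k) @ \oo --> \int[mu]_(s in halfline) (F s * psi b t s).
Proof.
move=> b0 t0 r0 cr cF.
pose f n s := (\sum_(0 <= k < n) c k * (s ^+ k / k`!%:R) * psi b t s)%:E.
have If n := (integral_partial_psi c n b0 t0).1.
have Jf n := (integral_partial_psi c n b0 t0).2.
have cf s : f n s @[n --> \oo] --> (F s * psi b t s)%:E.
  apply: cvg_EFin; first exact: nearW.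
  rewrite (_ : fine \o _ = (fun n => (\sum_(0 <= k < n) c k * (s ^+ k / k`!%:R)) * psi b t s)).
    by apply: cvgM; [exact: cF|exact: cvg_cst].
  by apply/funext => n; rewrite /f/= -mulr_suml.
have mf n : measurable_fun halfline (f n) by exact: measurable_int (If n).
have mF : measurable_fun halfline (fun s => (F s * psi b t s)%:E).
  by apply: (emeasurable_fun_cvg f) => // s _; exact: cf.
have dom n s : halfline s -> (`|f n s| <= (expR (rho * s) * psi b t s)%:E)%E.
  rewrite /= in_itv/= andbT => s0.
  rewrite lee_fin /f -mulr_suml normrM.
  rewrite (ger0_norm (rpsi_ge0 alpha0 alpha1 t b0 (ltW s0))).
  rewrite ler_wpM2r ?rpsi_ge0 ?(ltW s0)//.
  apply: (le_trans (ler_norm_sum _ _ _)).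
  apply: (@le_trans _ _ (series (exp_coeff (rho * s)) n)).
    rewrite /series/=; apply: ler_sum => k _; rewrite normrM.
    have q0 : 0 <= s ^+ k / k`!%:R by rewrite divr_ge0// exprn_ge0// ltW.
    by rewrite (ger0_norm q0) /exp_coeff/= exprMn -mulrA ler_wpM2r.
  apply: nondecreasing_cvgn_le; last exact: is_cvg_series_exp_coeff.
  apply/nondecreasing_seqP => k; rewrite /series/= big_nat_recr//= lerDl.
  by rewrite /exp_coeff/= divr_ge0// exprn_ge0// mulr_ge0// ltW.
have [I _ J] : [/\ mu.-integrable halfline (fun s => (F s * psi b t s)%:E),
    [sequence \int[mu]_(s in halfline) `|f n s - (F s * psi b t s)%:E|]_n%E @ \oo --> 0%E &
    [sequence \int[mu]_(s in halfline) f n s]_n%E @ \oo -->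
      (\int[mu]_(s in halfline) (F s * psi b t s)%:E)%E].
  apply: (@dominated_convergence _ _ _ mu halfline _ f _ (fun s => (expR (rho * s) * psi b t s)%:E)) => //.
  - by apply: aeW => s _; exact: cf.
  - exact: integrable_exp_psi.
  - by apply: aeW => s n; exact: dom.
split => //.
have fin : (\int[mu]_(s in halfline) (F s * psi b t s)%:E)%E \is a fin_num.
  exact: integrable_fin_num I.
have := J; rewrite -(fineK fin) => /fine_cvg; apply: cvg_trans.
apply: near_eq_cvg; apply: nearW => n.
by rewrite /series/= -Jf.
Qed.

End entire_psi.

(** * Uniqueness of the Laplace transform *)

Section laplace_unique.
Context {R : realType}.
Local Notation mu := (@lebesgue_measure R).
Local Notation halfline := (`]0%R, +oo[%classic : set R).

Section moments.
Variables (d : R -> R).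
Hypothesis Id : mu.-integrable halfline (fun t => (expR (- t) * d t)%:E).
Hypothesis d0 : forall n : nat,
  \int[mu]_(t in halfline) (expR (- (n.+1%:R * t)) * d t) = 0.

(** The functions exp(-(n+1) t) span the products of exp(-t) with the polynomials
    in exp(-t).  The spare power makes the induction along the Horner scheme
    go through. *)
Lemma laplace_poly (q : {poly R}) (k : nat) :
  mu.-integrable halfline
    (fun t => (q.[expR (- t)] * expR (- t) ^+ k * (expR (- t) * d t))%:E) /\
  \int[mu]_(t in halfline) (q.[expR (- t)] * expR (- t) ^+ k * (expR (- t) * d t)) = 0.
Proof.
have mexp : measurable_fun [set: R] (fun x : R => expR (- x)) by apply: measurableT_comp.
have md : measurable_fun halfline (fun t => expR (- t) * d t).
  by apply/measurable_EFinP; exact: measurable_int Id.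
have Ik j : mu.-integrable halfline (fun t => (expR (- t) ^+ j * (expR (- t) * d t))%:E).
  apply: le_integrable Id => //.
    apply/measurable_EFinP; apply: measurable_funM => //.
    by apply: measurable_funX; apply: measurable_funS mexp.
  move=> t /=; rewrite in_itv/= andbT => t0.
  rewrite lee_fin normrM ler_piMl// ger0_norm ?exprn_ge0 ?expR_ge0//.
  by rewrite exprn_ile1 ?expR_ge0// expR_le1 oppr_le0 ltW.
elim/poly_ind: q k => [|q c IH] k.
  split.
    rewrite (_ : (fun t => _) = (fun=> 0%E)); first exact: integrable0.
    by apply/funext => t; rewrite horner0 !mul0r.
  rewrite (@eq_Rintegral _ _ _ mu _ (fun=> 0)) ?Rintegral_cst ?mul0r// => t _.
  by rewrite horner0 !mul0r.
have [I1 E1] := IH k.+1.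
have E t : (q * 'X + c%:P).[expR (- t)] * expR (- t) ^+ k * (expR (- t) * d t) =
    q.[expR (- t)] * expR (- t) ^+ k.+1 * (expR (- t) * d t) +
    c * (expR (- t) ^+ k * (expR (- t) * d t)).
  by rewrite hornerMXaddC exprS; ring.
have Ic : mu.-integrable halfline (fun t => (c * (expR (- t) ^+ k * (expR (- t) * d t)))%:E).
  exact: integrable_EFinZ.
split.
  rewrite (_ : (fun t => _) = (fun t =>
    (q.[expR (- t)] * expR (- t) ^+ k.+1 * (expR (- t) * d t))%:E +
    (c * (expR (- t) ^+ k * (expR (- t) * d t)))%:E)%E); first exact: integrableD.
  by apply/funext => t; rewrite E EFinD.
rewrite (@eq_Rintegral _ _ _ mu _ _ _ (fun t _ => E t)).
rewrite RintegralD// E1 add0r RintegralZl//; last exact: Ik.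
have F t : expR (- t) ^+ k * (expR (- t) * d t) = expR (- (k.+1%:R * t)) * d t.
  by rewrite mulrA -exprSr -expRM_natl mulrN.
by rewrite (@eq_Rintegral _ _ _ mu _ _ _ (fun t _ => F t)) d0 mulr0.
Qed.

End moments.

(** Test d against exp(-t) q(exp(-t))^n, where the polynomial
    q(x) = 1 - (x - exp(-t0))^2 peaks at exp(-t0).  If d were positive at t0, the
    part of the integral near t0 would be at least a constant times rho'^n, with
    rho' > rho, whereas the rest is at most a constant times rho^n; their sum
    could not be 0 for every n. *)
Lemma laplace_unique_gt0 (d : R -> R) (t0 : R) : 0 < t0 -> {for t0, continuous d} ->
  mu.-integrable halfline (fun t => (expR (- t) * d t)%:E) ->
  (forall n : nat, \int[mu]_(t in halfline) (expR (- (n.+1%:R * t)) * d t) = 0) ->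
  ~ 0 < d t0.
Proof.
move=> t00 cd Id d0 dt0.
have minl (a b : R) : Num.min a b <= a by rewrite ge_min lexx.
have minr (a b : R) : Num.min a b <= b by rewrite ge_min lexx orbT.
pose x0 := expR (- t0).
pose q : {poly R} := 1 - ('X - x0%:P) ^+ 2.
have qE t : q.[expR (- t)] = 1 - (expR (- t) - x0) ^+ 2 by rewrite /q !hornerE.
have x01 : 0 < x0 < 1 by rewrite /x0 expR_gt0 expR_lt1 oppr_lt0.
have q0 t : 0 < t -> 0 <= q.[expR (- t)].
  move=> tp; rewrite qE subr_ge0.
  have e0 := expR_gt0 (- t).
  have e1 : expR (- t) < 1 by rewrite expR_lt1 oppr_lt0.
  nra.

have [e e0 He] : exists2 e : R, 0 < e & forall t, `|t - t0| < e -> d t0 / 2 <= d t.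
  move/cvgrPdist_lt : cd => /(_ (d t0 / 2)); rewrite divr_gt0// => /(_ isT).
  case=> e /= e0 H; exists e => // t te.
  have := H t; rewrite /ball/= distrC => /(_ te).
  by rewrite ltr_norml => /andP[_ ]; lra.
pose r := Num.min e t0 / 2.
have r0 : 0 < r by rewrite divr_gt0// lt_min e0.
have re : r < e by rewrite /r ltr_pdivrMr// (le_lt_trans (minl _ _))// ltr_pMr// ltr1n.
have rt0 : r < t0 by rewrite /r ltr_pdivrMr// (le_lt_trans (minr _ _))// ltr_pMr// ltr1n.

(* off the ball of radius r around t0 the distance of exp(-t) to x0 is at least eta *)
pose eta := Num.min (x0 - expR (- (t0 + r))) (expR (- (t0 - r)) - x0).
have eta0 : 0 < eta.
  by rewrite lt_min !subr_gt0 /x0 !ltr_expR; apply/andP; split; lra.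
pose rho := 1 - eta ^+ 2.
have q_out t : 0 < t -> r <= `|t - t0| -> q.[expR (- t)] <= rho.
  move=> tp; rewrite ler_normr => /orP tr.
  rewrite qE /rho lerD2l lerN2.
  have [a b] : eta <= x0 - expR (- (t0 + r)) /\ eta <= expR (- (t0 - r)) - x0.
    by split; rewrite /eta ?minl ?minr.
  case: tr => tr.
    have : expR (- t) <= expR (- (t0 + r)) by rewrite ler_expR; lra.
    by move=> h; nra.
  have : expR (- (t0 - r)) <= expR (- t) by rewrite ler_expR; lra.
  by move=> h; nra.
have rho1 : rho < 1 by rewrite /rho ltrBlDr ltrDl exprn_gt0.
have rho0 : 0 <= rho.
  apply: le_trans (q_out (t0 + r) _ _); first by apply: q0; lra.
    by lra.
  by rewrite addrAC subrr add0r ger0_norm// ltW.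
(* rho bounds q(exp(-t)) off that ball, rho' lies strictly between rho and the maximum 1 of q *)
pose rho' := (1 + rho) / 2.
have rr' : rho < rho' by rewrite /rho'; lra.
have rho'0 : 0 < rho' by lra.
have [r1 [r10 r1r q_in]] : exists r1 : R, [/\ 0 < r1, r1 <= r &
   forall t, `|t - t0| < r1 -> rho' <= q.[expR (- t)]].
  have cq : {for t0, continuous (fun t => q.[expR (- t)])}.
    apply: continuous_comp; last exact: continuous_horner.
    apply: continuous_comp; last exact: continuous_expR.
    exact: continuousN.
  move/cvgrPdist_lt : cq => /(_ (1 - rho')).
  rewrite subr_gt0 => /(_ _)[|e' /= e'0 H]; first by rewrite /rho'; lra.
  exists (Num.min e' r); split; first by rewrite lt_min e'0.
    exact: minr.
  move=> t; rewrite lt_min => /andP[te _].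
  have := H t; rewrite /ball/= distrC => /(_ te).
  have -> : q.[expR (- t0)] = 1 by rewrite qE subrr expr0n subr0.
  by rewrite ltr_norml => /andP[_ ]; lra.
pose kappa := d t0 / 2 * expR (- (t0 + r)).
have kappa0 : 0 < kappa by rewrite mulr_gt0 ?expR_gt0// divr_gt0.
pose B := `](t0 - r1), (t0 + r1)[%classic : set R.
have BE t : B t -> `|t - t0| < r1.
  by rewrite /B/= in_itv/= ltr_norml => /andP[a b]; apply/andP; split; lra.
have Bh : B `<=` halfline.
  by move=> t; rewrite /B/= !in_itv/= => /andP[a b]; rewrite andbT; lra.
pose M := \int[mu]_(t in halfline) `|expR (- t) * d t|.
(* near t0 the integrand is nonnegative, and the ball B alone contributes
   at least the left-hand side *)
have key n : rho' ^+ n * (kappa * (2 * r1)) <= rho ^+ n * M.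
  have [I1 E1] := laplace_poly Id d0 (q ^+ n) 0.
  have IM := integrable_norm Id.
  have IB : mu.-integrable halfline (fun t => (\1_B t)%:E).
    by apply: integrableS (integrable_indic_itv (t0 - r1) (t0 + r1) false true).
  have L : \int[mu]_(t in halfline) (rho' ^+ n * kappa * \1_B t) <=
     \int[mu]_(t in halfline) ((q ^+ n).[expR (- t)] * expR (- t) ^+ 0 * (expR (- t) * d t)
        + rho ^+ n * `|expR (- t) * d t|).
    apply: le_Rintegral => //.
    - exact: integrable_EFinZ.
    - by apply: integrable_EFinD => //; exact: integrable_EFinZ.
    - move=> t /=; rewrite in_itv/= andbT => tp.
      rewrite expr0 mulr1 horner_exp indicE.
      have [tr|tr] := leP r `|t - t0|.
        rewrite memNset ?mulr0; last by move=> /BE; lra.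
        rewrite -lerBlDr sub0r; apply: lerNnormlW.
        rewrite normrM ler_wpM2r// ger0_norm ?exprn_ge0 ?q0//.
        by rewrite lerXn2r ?nnegrE ?q0 ?q_out.
      have dtp : d t0 / 2 <= d t by apply: He; lra.
      have dtp0 : 0 < d t by apply: lt_le_trans dtp; rewrite divr_gt0.
      have rM : 0 <= rho ^+ n * `|expR (- t) * d t| by rewrite mulr_ge0 ?exprn_ge0.
      case: (boolP (t \in B)) => tB; last first.
        rewrite mulr0 addr_ge0// mulr_ge0 ?exprn_ge0 ?q0// mulr_ge0 ?expR_ge0// ltW//.
      have [kq kd] : rho' <= q.[expR (- t)] /\ kappa <= expR (- t) * d t.
        split; first by apply: q_in; apply: BE; rewrite inE in tB.
        rewrite /kappa mulrC; apply: ler_pM => //.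
        - by rewrite divr_ge0// ltW.
        by rewrite ler_expR; move: tr; rewrite ltr_norml => /andP[a b]; lra.
      rewrite mulr1 -[leLHS]addr0; apply: lerD => //; apply: ler_pM => //.
      - by rewrite exprn_ge0// ltW.
      - exact: ltW.
      - by rewrite lerXn2r ?nnegrE// ?q0// ltW.
  move: L; rewrite RintegralD// ?E1 ?add0r; last first.
    exact: integrable_EFinZ.
  rewrite !RintegralZl//.
  rewrite (_ : \int[mu]_(t in halfline) \1_B t = 2 * r1) ?mulrA//.
  rewrite /Rintegral integral_indic//; last exact: measurable_itv.
  rewrite setIidl// /B /= lebesgue_measure_itv/= lte_fin.
  by rewrite ifT /=; lra.
have M0 : 0 <= M by apply: Rintegral_ge0 => t _.
have K0 : 0 < kappa * (2 * r1) by rewrite mulr_gt0// mulr_gt0.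
have cv0 : (fun n => M * (rho / rho') ^+ n) @ \oo --> 0.
  rewrite -(mulr0 M); apply: cvgM; first exact: cvg_cst.
  have quo0 : 0 <= rho / rho' by apply: divr_ge0 => //; exact: ltW.
  apply: cvg_expr; rewrite ger0_norm//.
  by rewrite ltr_pdivrMr// mul1r.
move/cvgr_lt : cv0 => /(_ _ K0)[n _ /(_ n (leqnn n))] /=.
rewrite ltNge => /negP; apply.
have := key n.
rewrite (expr_div_n rho rho' n) [M * _]mulrA ler_pdivlMr ?exprn_gt0//.
by rewrite [_ * rho' ^+ n]mulrC [M * _]mulrC.
Qed.

Lemma laplace_unique (d : R -> R) (t0 : R) : 0 < t0 -> {for t0, continuous d} ->
  mu.-integrable halfline (fun t => (expR (- t) * d t)%:E) ->
  (forall n : nat, \int[mu]_(t in halfline) (expR (- (n.+1%:R * t)) * d t) = 0) ->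
  d t0 = 0.
Proof.
move=> t00 cd Id d0; apply/eqP; rewrite eq_le; apply/andP; split.
  by rewrite leNgt; apply/negP; exact: laplace_unique_gt0 Id d0.
rewrite leNgt; apply/negP => dt0.
have Ind : mu.-integrable halfline (fun t => (expR (- t) * - d t)%:E).
  by apply: eq_integrable (integrable_EFinN _ Id) => // t _; rewrite mulrN.
apply: (@laplace_unique_gt0 (fun t => - d t) t0 t00 _ Ind).
- exact: continuousN.
- move=> n; have [I1 _] := laplace_poly Id d0 1 n.
  under eq_Rintegral do rewrite mulrN -mulN1r.
  rewrite RintegralZl ?d0 ?mulr0//.
  rewrite (_ : _ \o _ = (fun t => (1.[expR (- t)] * expR (- t) ^+ n * (expR (- t) * d t))%:E))//.
  apply/funext => t; congr EFin.
  by rewrite -[1 : {poly R}]/(1%:P) hornerC mul1r mulrA -exprSr -expRM_natl mulrN.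
- by rewrite oppr_gt0.
Qed.

End laplace_unique.

(** * Convolution with a power *)

Section convolution_psi.
Context {R : realType}.
Local Notation mu := (@lebesgue_measure R).
Local Notation halfline := (`]0%R, +oo[%classic : set R).
Variable alpha : R.
Hypothesis (alpha0 : 0 < alpha) (alpha1 : alpha < 1).
Local Notation psi := (rpsi alpha).
Variables (b s gamma : R).
Hypotheses (b0 : 0 <= b) (s0 : 0 < s) (g0 : 0 < gamma).
Implicit Types (m x y t r T : R).

(** The function t |-> psi(t, s) extended by 0; it is continuous on the whole line
    because of the decay at 0. *)
Let ext x : R := if 0 < x then psi b x s else 0.

Let ext_ge0 x : 0 <= ext x.
Proof. by rewrite /ext; case: ifP => // _; exact: rpsi_ge0 (ltW s0). Qed.

Let ext_gt0E x : 0 < x -> ext x = psi b x s. Proof. by rewrite /ext => ->. Qed.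

Let ext_le0E x : x <= 0 -> ext x = 0. Proof. by rewrite /ext ltNge => ->. Qed.

Let continuous_ext : continuous ext.
Proof.
move=> x; have [xlt0|xgt0|->] := ltgtP x 0.
- have c : cst (0:R) y @[y --> x] --> ext x by rewrite ext_le0E ?ltW//; exact: cvg_cst.
  apply: (cvg_trans _ c); apply: near_eq_cvg; near=> y.
  by rewrite ext_le0E// ltW//; near: y; exact: lt_nbhsl.
- have c : psi b y s @[y --> x] --> ext x.
    by rewrite ext_gt0E//; exact: continuous_rpsi_t.
  apply: (cvg_trans _ c); apply: near_eq_cvg; near=> y.
  by rewrite ext_gt0E//; near: y; exact: lt_nbhsr.
rewrite /continuous_at ext_le0E//.
have [C C0 HC] := rpsi_decay alpha0 alpha1 b0 s0.
have cC : C * `|y| @[y --> (0:R)] --> (0 : R).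
  rewrite -[X in _ --> X](mulr0 C); apply: cvgM; first exact: cvg_cst.
  by rewrite -[X in _ --> X](@normr0 R R); apply: norm_continuous.
apply: (squeeze_cvgr _ (cvg_cst (0:R)) cC); near=> y.
rewrite ext_ge0/=; have [y0|y0] := leP y 0.
  by rewrite ext_le0E// mulr_ge0.
rewrite ext_gt0E// gtr0_norm// HC// ltW//.
by near: y; apply: lt_nbhsl.
Unshelve. all: by end_near. Qed.

Let ext_bounded T : 0 < T -> exists2 M : R, 0 <= M & forall x, x <= T -> ext x <= M.
Proof.
move=> T0.
have [c cT Hc] : exists2 c, c \in `[0, T]%R & forall y, y \in `[0, T]%R -> ext y <= ext c.
  apply: EVT_max; first exact: ltW.
  by apply: continuous_subspaceT; exact: continuous_ext.
exists (ext c) => // x xT; have [x0|x0] := leP x 0; first by rewrite ext_le0E.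
by apply: Hc; rewrite in_itv/= xT ltW.
Qed.

Let mext : measurable_fun [set: R] ext.
Proof. by apply: continuous_measurable_fun; exact: continuous_ext. Qed.

(** Reflection and extension by 0 give an interval of integration that does not
    depend on t, as required to see that the convolution is continuous in t. *)
Let convE t T : 0 < t -> t < T ->
  (\int[mu]_(r in `]0%R, t[) ((t - r) `^ (gamma - 1) * psi b r s)%:E =
   \int[mu]_(r in `]0%R, T[) (r `^ (gamma - 1) * ext (t - r))%:E)%E.
Proof.
move=> t0 tT.
pose h r := (r `^ (gamma - 1) * ext (t - r))%:E.
have mh : measurable_fun [set: R] h.
  apply/measurable_EFinP; apply: measurable_funM; first exact: measurable_powR.
  by apply: (measurableT_comp mext); exact: measurable_funB.
rewrite [RHS]integral_mkcond -/h.
rewrite -(@ge0_integral_reflect _ (h \_ `]0%R, T[) t); last 2 first.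
- by apply/(measurable_restrictT h) => //; exact: measurable_funS mh.
- move=> x; rewrite patchE; case: ifPn => // _.
  by rewrite lee_fin mulr_ge0 ?powR_ge0.
rewrite [LHS]integral_mkcond; apply: eq_integral => x _; rewrite !patchE.
case: ifPn; rewrite ?inE ?notin_setE/= in_itv/=.
  move=> /andP[x0 xt]; rewrite ifT; last first.
    by rewrite inE/= in_itv/=; apply/andP; split; lra.
  by rewrite /h subKr ext_gt0E.
move=> /negP; rewrite negb_and -!leNgt => xt.
case: ifPn => //; rewrite inE/= in_itv/= => /andP[h1 h2].
rewrite /h subKr; case/orP: xt => xt; last by exfalso; lra.
by rewrite ext_le0E// mulr0.
Qed.

Let integrable_pow T : 0 < T -> mu.-integrable `]0%R, T[ (fun r => (r `^ (gamma - 1))%:E).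
Proof.
move=> T0; apply/integrableP; split.
  apply: measurable_funS (_ : measurable_fun [set: R] _) => //.
  by apply/measurable_EFinP; exact: measurable_powR.
apply: (@le_lt_trans _ _ (\int[mu]_(r in `]0%R, T[) (r `^ (gamma - 1))%:E)%E).
  rewrite le_eqVlt; apply/orP; left; apply/eqP; apply: eq_integral => r _ /=.
  by rewrite ger0_norm// powR_ge0.
by rewrite integral_powR_itv// ltry.
Qed.

Let integrable_ext T t : 0 < T -> t <= T ->
  mu.-integrable `]0%R, T[ (fun r => (r `^ (gamma - 1) * ext (t - r))%:E).
Proof.
move=> T0 tT; have [M M0 HM] := ext_bounded T0.
apply: le_integrable (integrable_EFinZ (measurable_itv _) M (integrable_pow T0)) => //.
  apply: measurable_funS (_ : measurable_fun [set: R] _) => //.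
  apply/measurable_EFinP; apply: measurable_funM; first exact: measurable_powR.
  by apply: (measurableT_comp mext); exact: measurable_funB.
move=> r /=; rewrite in_itv/= => /andP[r0 rT]; rewrite lee_fin !normrM mulrC.
rewrite ler_wpM2r// !ger0_norm//; apply: HM; lra.
Qed.

Definition rconv t : R := \int[mu]_(r in `]0%R, t[) ((t - r) `^ (gamma - 1) * psi b r s).

Lemma integrable_conv_psi t : 0 < t ->
  mu.-integrable `]0%R, t[ (fun r => ((t - r) `^ (gamma - 1) * psi b r s)%:E).
Proof.
move=> t0; have T0 : 0 < t + 1 by lra.
have tT : t < t + 1 by lra.
apply/integrableP; split.
  apply: measurable_funS (_ : measurable_fun [set: R] _) => //.
  apply/measurable_EFinP; apply: measurable_funM; last exact: measurable_rpsi_t.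
  by apply: (measurableT_comp (measurable_powR _)); exact: measurable_funB.
apply: (@le_lt_trans _ _ (\int[mu]_(r in `]0%R, t[) ((t - r) `^ (gamma - 1) * psi b r s)%:E)%E).
  rewrite le_eqVlt; apply/orP; left; apply/eqP; apply: eq_integral => r _ /=.
  by rewrite ger0_norm// mulr_ge0 ?powR_ge0// rpsi_ge0// ltW.
rewrite (convE t0 tT); exact: integrable_lty (integrable_ext T0 (ltW tT)).
Qed.

Lemma rconvE t : 0 < t ->
  (\int[mu]_(r in `]0%R, t[) ((t - r) `^ (gamma - 1) * psi b r s)%:E = (rconv t)%:E)%E.
Proof.
by move=> t0; rewrite /rconv /Rintegral fineK//; exact: integrable_fin_num (integrable_conv_psi t0).
Qed.

Let continuous_rconv t : 0 < t -> {for t, continuous rconv}.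
Proof.
move=> t0; pose T := t + 1; have T0 : 0 < T by rewrite /T; lra.
have tT : t < T by rewrite /T; lra.
pose V x := \int[mu]_(r in `]0%R, T[) (r `^ (gamma - 1) * ext (x - r)).
have VE x : 0 < x -> x < T -> rconv x = V x.
  by move=> x0 xT; rewrite /rconv /V /Rintegral (convE x0 xT).
have [M M0 HM] := ext_bounded T0.
have cV : {for t, continuous V}.
  apply: (@continuity_under_integral _ _ _ mu
    (fun x r => r `^ (gamma - 1) * ext (x - r)) `]0%R, T[%classic _ 0 T _ _
    (fun r => M * r `^ (gamma - 1))) => //.
  - by move=> x /=; rewrite in_itv/= => /andP[_ xT]; apply: integrable_ext => //; exact: ltW.
  - apply: aeW => r _ x _; apply: cvgM; first exact: cvg_cst.
    apply: (@continuous_comp _ _ _ (fun x => x - r) ext); last exact: continuous_ext.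
    by apply: cvgB; [exact: cvg_id|exact: cvg_cst].
  - exact: (integrable_EFinZ (measurable_itv _) M (integrable_pow T0)).
  - move=> x /=; rewrite in_itv/= => /andP[_ xT]; apply: aeW => r /=.
    rewrite in_itv/= => /andP[r0 rT]; rewrite normrM mulrC ger0_norm//.
    by rewrite [X in _ * X]ger0_norm ?powR_ge0// ler_wpM2r ?powR_ge0// HM//; lra.
  - by rewrite inE/= in_itv/= t0.
rewrite /prop_for/continuous_at VE//.
apply: (cvg_trans _ cV); apply: near_eq_cvg; near=> x.
rewrite VE//.
  by near: x; exact: lt_nbhsr.
by near: x; exact: lt_nbhsl.
Unshelve. all: by end_near. Qed.

Let laplace_rconv m : 0 < m ->
  (\int[mu]_(t in halfline) (expR (- (m * t)) * rconv t)%:E =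
   (m `^ (- gamma) * rGamma gamma * (m `^ (- b) * expR (- (m `^ alpha * s))))%:E)%E.
Proof.
move=> m0.
have := @ge0_laplace_convolution R (fun r => r `^ (gamma - 1)) (psi b ^~ s) m
  (measurable_powR _) (measurable_rpsi_t alpha0 alpha1 b s) (fun _ _ => powR_ge0 _ _)
  (fun t _ => rpsi_ge0 alpha0 alpha1 t b0 (ltW s0)).
have := laplace_psiE alpha0 alpha1 b0 m0 s0; rewrite /laplace_psi => ->.
rewrite laplace_powR// -EFinM => <-.
by apply: eq_integral => t; rewrite inE/= in_itv/= andbT => t0; rewrite rconvE.
Qed.

Let rconv_ge0 t : 0 <= rconv t.
Proof. by apply: Rintegral_ge0 => r _; rewrite mulr_ge0 ?powR_ge0// rpsi_ge0// ltW. Qed.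

Let mrconv : measurable_fun halfline rconv.
Proof.
apply: open_continuous_measurable_fun => //.
by move=> t; rewrite inE/= in_itv/= andbT; exact: continuous_rconv.
Qed.

(** The two sides have the same Laplace transform
    Gamma(gamma) m^(-b-gamma) exp(-m^alpha s). *)
Lemma rconv_psi t : 0 < t -> rconv t = rGamma gamma * psi (b + gamma) t s.
Proof.
move=> t0.
have bg0 : 0 <= b + gamma by rewrite addr_ge0// ltW.
pose k := rGamma gamma.
have P m (m0 : 0 < m) := integrable_laplace_psi alpha0 alpha1 bg0 m0 s0.
have Q m : 0 < m -> mu.-integrable halfline (fun t => (expR (- (m * t)) * rconv t)%:E) /\
    \int[mu]_(t in halfline) (expR (- (m * t)) * rconv t) =
    m `^ (- gamma) * k * (m `^ (- b) * expR (- (m `^ alpha * s))).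
  move=> m0; apply: ge0_integrable_value; last exact: laplace_rconv.
    apply/measurable_EFinP; apply: measurable_funM => //.
    apply: measurable_funS (_ : measurable_fun [set: R] _) => //.
    by apply: measurableT_comp => //; apply: measurableT_comp.
  by move=> x _; rewrite mulr_ge0 ?expR_ge0.
pose d x := rconv x - k * psi (b + gamma) x s.
have dE m x : expR (- (m * x)) * d x =
    expR (- (m * x)) * rconv x - k * (expR (- (m * x)) * psi (b + gamma) x s).
  by rewrite /d; ring.
suff : d t = 0 by rewrite /d => /eqP; rewrite subr_eq0 => /eqP.
apply: laplace_unique => //.
- apply: cvgB; first exact: continuous_rconv.
  by apply: cvgM; [exact: cvg_cst|exact: continuous_rpsi_t].
- have [P1 _] := P 1 ltr01. have [Q1 _] := Q 1 ltr01.
  apply: eq_integrable (integrable_EFinB _ Q1 (integrable_EFinZ _ k P1)) => // x _.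
  by rewrite -dE mul1r.
move=> n; have n0 : (0 : R) < n.+1%:R by [].
have [P1 P2] := P _ n0. have [Q1 Q2] := Q _ n0.
have kP1 := integrable_EFinZ (measurable_itv _) k P1.
rewrite (@eq_Rintegral _ _ _ mu _ _ _ (fun x _ => dE _ x)) RintegralB// RintegralZl// P2 Q2.
rewrite opprD powRD; last by rewrite pnatr_eq0 implybT.
by ring.
Qed.

End convolution_psi.

(** * Complex-valued functions of a real variable *)

Local Open Scope complex_scope.

Section complex_real.
Context {R : realType}.
Local Notation mu := (@lebesgue_measure R).
Local Notation halfline := (`]0%R, +oo[%classic : set R).
Implicit Types (x y s t b : R).

(** The modulus of a complex number is at most the sum of those of its real and
    imaginary parts. *)
Lemma csum_ReIm (u : nat -> R[i]) (a b : R) :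
  series (@complex.Re R \o u) @ \oo --> a -> series (@complex.Im R \o u) @ \oo --> b ->
  csum u = a +i* b.
Proof.
move=> ca cb; rewrite /csum; apply: (@cvg_lim (R[i])^o); first exact: norm_hausdorff.
apply/cvgrPdist_lt => e e0.
have [d -> d0] : exists2 d, e = d%:C & 0 < d.
  by move: e e0 => [d f]; rewrite ltcE/= => /andP[/eqP -> d0]; exists d.
have d2 : 0 < d / 2 by rewrite divr_gt0.
move/cvgrPdist_lt : ca => /(_ _ d2) ca; move/cvgrPdist_lt : cb => /(_ _ d2) cb.
near=> n.
have /= ha : `|a - series (@complex.Re R \o u) n| < d / 2 by near: n.
have /= hb : `|b - series (@complex.Im R \o u) n| < d / 2 by near: n.
have sE : series (u : nat -> (R[i])^o) n =
    (series (@complex.Re R \o u) n) +i* (series (@complex.Im R \o u) n).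
  rewrite /series/=; elim: (n) => [|m IH]; first by rewrite !big_geq.
  by rewrite !big_nat_recr//= IH; case: (u m).
rewrite sE.
have -> : (a +i* b : (R[i])^o) - ((series (@complex.Re R \o u) n) +i* (series (@complex.Im R \o u) n)) =
  (a - series (@complex.Re R \o u) n)%:C + 'i%C * (b - series (@complex.Im R \o u) n)%:C :> R[i].
  by simpc.
apply: (le_lt_trans (ler_normD _ _)).
rewrite normrM.
have -> : `|'i%C| = 1 :> R[i] by rewrite normc_def/= expr0n/= add0r expr1n sqrtr1.
have nC x : `|x%:C| = `|x|%:C by rewrite normc_def/= expr0n/= addr0 sqrtr_sqr.
by rewrite mul1r !nC -rmorphD/= ltcR; lra.
Unshelve. all: by end_near.
Qed.

Lemma csum_real (u : nat -> R) (a : R) : series u @ \oo --> a ->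
  csum (fun n => (u n)%:C) = a%:C.
Proof.
move=> ua; rewrite (@csum_ReIm _ a 0)//.
rewrite (_ : series _ = cst 0); first exact: cvg_cst.
by apply/funext => n; rewrite /series/= big1.
Qed.

Lemma cexp_real x : cexp x%:C = (expR x)%:C.
Proof. by rewrite /cexp/= cos0 sin0 (_ : 1 +i* 0 = 1) ?mulr1. Qed.

Lemma Gamma_integral_real b : Gamma_integral b%:C = (rGamma b)%:C.
Proof.
have E t : 0 < t -> cexp ((b%:C - 1) * (ln t)%:C) * (expR (- t))%:C =
    (t `^ (b - 1) * expR (- t))%:C.
  move=> t0; have -> : (b%:C - 1) * (ln t)%:C = ((b - 1) * ln t)%:C.
    by rewrite rmorphM rmorphB.
  by rewrite cexp_real -rmorphM /powR gt_eqF.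
rewrite /Gamma_integral /cintegral /rGamma; congr (_ +i* _).
  by apply: eq_Rintegral => t; rewrite inE/= in_itv/= andbT => t0; exact: (congr1 (@complex.Re R) (E t t0)).
transitivity (\int[mu]_(t in halfline) (0 : R)).
  by apply: eq_Rintegral => t; rewrite inE/= in_itv/= andbT => t0; exact: (congr1 (@complex.Im R) (E t t0)).
by rewrite /Rintegral integral0.
Qed.

(** At the poles both sides are 0: on the left as the inverse of 0. *)
Lemma Gamma_realV b : (Gamma b%:C)^-1 = (recipGamma b)%:C.
Proof.
rewrite recipGamma.unlock /Gamma/=; cbv zeta.
rewrite -(rmorph_nat (real_complex R) (Num.truncn _)) -rmorphD Gamma_integral_real.
rewrite invfM invrK rmorphM fmorphV rmorph_prod mulrC; congr (_ * _).
by apply: eq_bigr => k _; rewrite rmorphD rmorph_nat.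
Qed.

Lemma g_real (gamma t : R) : g_ gamma t = (t `^ (gamma - 1) * recipGamma gamma)%:C.
Proof. by rewrite /g_ Gamma_realV rmorphM. Qed.

Lemma psi_real alpha b t s : 0 < alpha -> alpha < 1 ->
  psi alpha b t s%:C = (rpsi alpha b t s)%:C.
Proof.
move=> a0 a1; rewrite /psi /rpsi [RHS]rmorphM; congr (_ * _).
set x := s * _.
rewrite /wright; transitivity (csum (fun n => (wcoef alpha b n * x ^+ n)%:C)); last first.
  by apply: csum_real; exact: cvg_wfun.
congr csum; apply/funext => n.
have -> : - s%:C * (t `^ (- alpha))%:C = (- x)%:C by rewrite -rmorphN -rmorphM mulNr.
have -> : (- alpha * n%:R)%:C + b%:C = (b - alpha * n%:R)%:C.
  by rewrite -rmorphD; congr (_%:C); ring.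
rewrite invfM Gamma_realV -rmorphXn -(rmorph_nat (real_complex R)) -fmorphV -!rmorphM.
by congr (_%:C); rewrite /wcoef [(- x) ^+ n]exprNn; ring.
Qed.

Lemma cintegral_real (D : set R) (f : R -> R[i]) (h : R -> R) : measurable D ->
  (forall x, D x -> f x = (h x)%:C) -> mu.-integrable D (fun x => (h x)%:E) ->
  cintegrable D f /\ cintegral D f = (\int[mu]_(x in D) h x)%:C.
Proof.
move=> mD fh Ih; split; [split|].
- by apply: eq_integrable Ih => // x; rewrite inE => Dx; rewrite (fh _ Dx).
- by apply: eq_integrable (integrable0 mu D) => // x; rewrite inE => Dx; rewrite (fh _ Dx).
rewrite /cintegral; congr (_ +i* _).
  by apply: eq_Rintegral => x; rewrite inE => Dx; rewrite (fh _ Dx).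
transitivity (\int[mu]_(x in D) (0 : R)).
  by apply: eq_Rintegral => x; rewrite inE => Dx; rewrite (fh _ Dx).
by rewrite /Rintegral integral0.
Qed.
End complex_real.

(** * The complex exponential along a ray *)

Section complex_exponential.
Context {R : realType}.
Variable l : R[i].
Implicit Types (x s u v : R).
Local Notation a := (complex.Re l).
Local Notation b := (complex.Im l).

Lemma ReX_succ k : complex.Re (l ^+ k.+1) = a * complex.Re (l ^+ k) - b * complex.Im (l ^+ k).
Proof. by rewrite exprS; case: (l ^+ k) => c d; case: (l). Qed.

Lemma ImX_succ k : complex.Im (l ^+ k.+1) = b * complex.Re (l ^+ k) + a * complex.Im (l ^+ k).
Proof. by rewrite exprS addrC; case: (l ^+ k) => c d; case: (l). Qed.

Lemma ReImX_le k : `|complex.Re (l ^+ k)| + `|complex.Im (l ^+ k)| <= (`|a| + `|b|) ^+ k.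
Proof.
elim: k => [|k IH]; first by rewrite !expr0/= normr1 normr0 addr0.
rewrite ReX_succ ImX_succ exprS.
set c := complex.Re _ in IH *; set d := complex.Im _ in IH *.
apply: (@le_trans _ _ ((`|a| + `|b|) * (`|c| + `|d|))); last by rewrite ler_wpM2l ?addr_ge0.
have h1 := ler_normB (a * c) (b * d); have h2 := ler_normD (b * c) (a * d).
by apply: (le_trans (lerD h1 h2)); rewrite !normrM; lra.
Qed.

(** The Taylor coefficients of u Re exp(l x) + v Im exp(l x).  Two parameters are
    kept because differentiation acts linearly on (u, v). *)
Let ecoef u v k : R := (u * complex.Re (l ^+ k) + v * complex.Im (l ^+ k)) / k`!%:R.

Let diffs_ecoef u v : pseries_diffs (ecoef u v) = ecoef (u * a + v * b) (v * a - u * b).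
Proof.
apply/funext => k; rewrite /pseries_diffs /ecoef ReX_succ ImX_succ factS natrM.
by field; rewrite pnatr_eq0 -lt0n fact_gt0/= nat1r pnatr_eq0.
Qed.

Let is_cvg_ecoef u v x : cvgn (pseries (ecoef u v) x).
Proof.
pose rho := `|a| + `|b|; have rho0 : 0 <= rho by rewrite addr_ge0.
apply: normed_cvg; rewrite /pseries /normed_series_of/=.
apply: (@series_le_cvg _ _ (fun k => (`|u| + `|v|) * exp_coeff (rho * `|x|) k)).
- by move=> k.
- by move=> k; rewrite mulr_ge0 ?addr_ge0 ?exp_coeff_ge0 ?mulr_ge0.
- move=> k; rewrite /exp_coeff/= exprMn /ecoef !normrM normrX normfV (ger0_norm (ler0n _ _)).
  rewrite [leRHS](_ : _ = (`|u| + `|v|) * rho ^+ k / k`!%:R * `|x| ^+ k); last by ring.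
  rewrite ler_wpM2r ?exprn_ge0// ler_wpM2r ?invr_ge0//.
  apply: (le_trans (ler_normD _ _)); rewrite !normrM mulrDl.
  have := ReImX_le k; rewrite -/rho => h.
  have h1 : `|complex.Re (l ^+ k)| <= rho ^+ k by apply: le_trans h; rewrite lerDl.
  have h2 : `|complex.Im (l ^+ k)| <= rho ^+ k by apply: le_trans h; rewrite lerDr.
  by apply: lerD; exact: ler_wpM2l.
rewrite (_ : series _ = (fun n => (`|u| + `|v|) * series (exp_coeff (rho * `|x|)) n)).
  by apply: is_cvgMr; exact: is_cvg_series_exp_coeff.
by apply/funext => n; rewrite /series/= mulr_sumr.
Qed.

Let E u v x : R := limn (pseries (ecoef u v) x).

Let EE u v x : E u v x = u * E 1 0 x + v * E 0 1 x.
Proof.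
apply/cvg_lim => //.
rewrite (_ : pseries _ _ = (fun n => u * pseries (ecoef 1 0) x n + v * pseries (ecoef 0 1) x n)).
  by apply: cvgD; (apply: cvgM; first exact: cvg_cst); exact: is_cvg_ecoef.
apply/funext => n; rewrite /pseries /series/= !mulr_sumr -big_split/=.
by apply: eq_bigr => k _; rewrite /ecoef; ring.
Qed.

Let is_derive_E u v x : is_derive x 1 (E u v) (E (u * a + v * b) (v * a - u * b) x).
Proof.
rewrite /E -diffs_ecoef; apply: (@pseries_snd_diffs _ _ (`|x| + 1)).
- exact: is_cvg_ecoef.
- by rewrite diffs_ecoef; exact: is_cvg_ecoef.
- by rewrite !diffs_ecoef; exact: is_cvg_ecoef.
- by rewrite [ltRHS]ger0_norm ?addr_ge0// ltrDl.
Qed.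

Let E0 u v : E u v 0 = u.
Proof.
apply/cvg_lim => //; rewrite -cvg_shiftS; apply: (@cvg_trans _ (cst u @ \oo)); last exact: cvg_cst.
apply: near_eq_cvg; apply: nearW => n.
rewrite /pseries/series/= big_nat_recl// expr0 mulr1 big1 ?addr0.
  by rewrite /ecoef !expr0 fact0 divr1/= mulr1 mulr0 addr0.
by move=> i _; rewrite expr0n mulr0.
Qed.

Let is_derive_trig x : is_derive x 1 (fun y => cos (b * y)) (- (b * sin (b * x))) /\
  is_derive x 1 (fun y => sin (b * y)) (b * cos (b * x)).
Proof.
have D : is_derive x 1 (fun y => b * y) b.
  by have := is_derive1Z b (is_derive_id x (1 : R)); rewrite mulr1.
by split; have := is_derive1_comp (is_derive_cos _) D; have := is_derive1_comp (is_derive_sin _) D;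
  move=> h1 h2; [apply: is_derive_eq h2 _|apply: is_derive_eq h1 _]; rewrite ?mulNr mulrC.
Qed.

Let C := E 1 0.
Let D := E 0 1.

Let dC x : is_derive x 1 C (a * C x - b * D x).
Proof. by apply: is_derive_eq (is_derive_E 1 0 x) _; rewrite EE -/C -/D; ring. Qed.

Let dD x : is_derive x 1 D (b * C x + a * D x).
Proof. by apply: is_derive_eq (is_derive_E 0 1 x) _; rewrite EE -/C -/D; ring. Qed.

(** X and Y are the components of exp(-l y) (C y + i D y); by the differential
    equations for C and D they are constant. *)
Let CDE x : C x = expR (a * x) * cos (b * x) /\ D x = expR (a * x) * sin (b * x).
Proof.
pose X (y : R) : R := expR (- a * y) * (C y * cos (b * y) + D y * sin (b * y)).
pose Y (y : R) : R := expR (- a * y) * (D y * cos (b * y) - C y * sin (b * y)).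
have dX (y : R) : is_derive y 1 X 0.
  have [dc ds] := is_derive_trig y.
  apply: is_derive_eq (is_derive1M (is_derive1_expZ (- a) y)
    (is_derive1D (is_derive1M (dC y) dc) (is_derive1M (dD y) ds))) _.
  ring.
have dY (y : R) : is_derive y 1 Y 0.
  have [dc ds] := is_derive_trig y.
  apply: is_derive_eq (is_derive1M (is_derive1_expZ (- a) y)
    (is_derive1B (is_derive1M (dD y) dc) (is_derive1M (dC y) ds))) _.
  ring.
have X1 : X x = 1.
  have -> : X x = X 0 by exact: is_derive_0_is_cst.
  rewrite /X !mulr0 expR0 cos0 sin0 /C E0; ring.
have Y0 : Y x = 0.
  have -> : Y x = Y 0 by exact: is_derive_0_is_cst.
  rewrite /Y !mulr0 expR0 cos0 sin0 /D E0; ring.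
have e1 : expR (a * x) * expR (- a * x) = 1 by rewrite -expRD mulNr subrr expR0.
have cs := cos2Dsin2 (b * x).
split.
  rewrite -[RHS]mul1r -X1 -[RHS]subr0 -[X in _ - X](mulr0 (expR (a * x) * sin (b * x))) -Y0.
  transitivity (C x * (expR (a * x) * expR (- a * x)) * (cos (b * x) ^+ 2 + sin (b * x) ^+ 2)).
    by rewrite e1 cs !mulr1.
  by rewrite /X /Y; ring.
rewrite -[RHS]mul1r -X1 -[RHS]addr0 -[X in _ + X](mulr0 (expR (a * x) * cos (b * x))) -Y0.
transitivity (D x * (expR (a * x) * expR (- a * x)) * (cos (b * x) ^+ 2 + sin (b * x) ^+ 2)).
  by rewrite e1 cs !mulr1.
by rewrite /X /Y; ring.
Qed.

Lemma cvg_ReIm_exp s :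
  \sum_(0 <= k < n) complex.Re (l ^+ k) * (s ^+ k / k`!%:R) @[n --> \oo]
    --> expR (a * s) * cos (b * s) /\
  \sum_(0 <= k < n) complex.Im (l ^+ k) * (s ^+ k / k`!%:R) @[n --> \oo]
    --> expR (a * s) * sin (b * s).
Proof.
have [<- <-] := CDE s; split.
  rewrite (_ : (fun n => _) = pseries (ecoef 1 0) s); first exact: is_cvg_ecoef.
  by apply/funext => n; apply: eq_bigr => k _; rewrite /ecoef/=; ring.
rewrite (_ : (fun n => _) = pseries (ecoef 0 1) s); first exact: is_cvg_ecoef.
by apply/funext => n; apply: eq_bigr => k _; rewrite /ecoef/=; ring.
Qed.

Lemma cexp_line s : cexp (l * s%:C) =
  (expR (a * s) * cos (b * s)) +i* (expR (a * s) * sin (b * s)).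
Proof.
have -> : l * s%:C = (a * s) +i* (b * s) by case: (l) => c d; simpc.
by rewrite /cexp/=; simpc.
Qed.

End complex_exponential.

(** * The Mittag-Leffler function *)

Section exp_moment.
Context {R : realType}.
Local Notation mu := (@lebesgue_measure R).
Local Notation halfline := (`]0%R, +oo[%classic : set R).
Variable alpha : R.
Hypothesis (alpha0 : 0 < alpha) (alpha1 : alpha < 1).

Lemma mittag_leffler_ReIm b t (l : R[i]) (x y : R) : 0 < t ->
  series (fun k => complex.Re (l ^+ k) * mlcoef alpha b t k) @ \oo --> x ->
  series (fun k => complex.Im (l ^+ k) * mlcoef alpha b t k) @ \oo --> y ->
  (t `^ (alpha + b - 1))%:C * mittag_leffler alpha (alpha + b) (l * (t `^ alpha)%:C) =
  x +i* y.
Proof.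
move=> t0 cx cy; set p := t `^ (alpha + b - 1).
have p0 : p != 0 by rewrite gt_eqF ?powR_gt0.
have mlE k : mlcoef alpha b t k = p * ((t `^ alpha) ^+ k * recipGamma (alpha * k%:R + (alpha + b))).
  rewrite /mlcoef /p mulrA -powR_mulrn ?powR_ge0// -powRrM -powRD; last first.
    by rewrite (gt_eqF t0) implybT.
  by congr (_ `^ _ * recipGamma _); rewrite -natr1; ring.
have dE k : (t `^ alpha) ^+ k * recipGamma (alpha * k%:R + (alpha + b)) = mlcoef alpha b t k / p.
  by rewrite mlE mulrAC mulfV// mul1r.
have -> : mittag_leffler alpha (alpha + b) (l * (t `^ alpha)%:C) = (x / p) +i* (y / p).
  rewrite /mittag_leffler.
  have -> : (fun n => (l * (t `^ alpha)%:C) ^+ n / Gamma (alpha * n%:R + (alpha + b))%:C) =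
      (fun n => l ^+ n * (mlcoef alpha b t n / p)%:C).
    by apply/funext => n; rewrite Gamma_realV exprMn -rmorphXn -mulrA -rmorphM dE.
  have termE (f : R[i] -> R) : (forall z c, f (z * c%:C) = f z * c) ->
      series (f \o (fun n => l ^+ n * (mlcoef alpha b t n / p)%:C)) =
      (fun n => series (fun k => f (l ^+ k) * mlcoef alpha b t k) n * p^-1).
    move=> fM; apply/funext => n; rewrite /series/= mulr_suml.
    by apply: eq_bigr => k _; rewrite fM mulrA.
  apply: csum_ReIm.
    rewrite termE; last by move=> [u v] c /=; rewrite mulr0 subr0.
    by apply: cvgM => //; exact: cvg_cst.
  rewrite termE; last by move=> [u v] c /=; rewrite mulr0 add0r.
  by apply: cvgM => //; exact: cvg_cst.
by apply/eqP; rewrite eq_complex/= !mul0r subr0 addr0 !(mulrCA p) !mulfV// !mulr1 !eqxx.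
Qed.

Lemma exp_moment_psi b t (l : R[i]) : 0 <= b -> 0 < t ->
  let f := fun s : R => cexp (l * s%:C) * psi alpha b t s%:C in
  cintegrable halfline f /\
  cintegral halfline f =
    (t `^ (alpha + b - 1))%:C * mittag_leffler alpha (alpha + b) (l * (t `^ alpha)%:C).
Proof.
move=> b0 t0 f.
pose rho := `|complex.Re l| + `|complex.Im l|.
have rho0 : 0 <= rho by rewrite addr_ge0.
have bRe k : `|complex.Re (l ^+ k)| <= rho ^+ k.
  by apply: le_trans (ReImX_le l k); rewrite lerDl.
have bIm k : `|complex.Im (l ^+ k)| <= rho ^+ k.
  by apply: le_trans (ReImX_le l k); rewrite lerDr.
have [I1 c1] := integral_series_psi alpha0 alpha1 b0 t0 rho0 bRe (fun s => (cvg_ReIm_exp l s).1).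
have [I2 c2] := integral_series_psi alpha0 alpha1 b0 t0 rho0 bIm (fun s => (cvg_ReIm_exp l s).2).
rewrite (mittag_leffler_ReIm t0 c1 c2).
have fRe s : complex.Re (f s) = expR (complex.Re l * s) * cos (complex.Im l * s) * rpsi alpha b t s.
  by rewrite /f cexp_line psi_real//= mulr0 subr0.
have fIm s : complex.Im (f s) = expR (complex.Re l * s) * sin (complex.Im l * s) * rpsi alpha b t s.
  by rewrite /f cexp_line psi_real//= mulr0 add0r.
split; [split|].
- by apply: eq_integrable I1 => // s _; rewrite fRe.
- by apply: eq_integrable I2 => // s _; rewrite fIm.
by rewrite /cintegral; congr (_ +i* _); apply: eq_Rintegral => s _; rewrite ?fRe ?fIm.
Qed.
End exp_moment.

(** * The six properties *)

Theorem theorem2 (R : realType) (alpha beta : R)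
    (alpha_gt0 : 0 < alpha) (alpha_lt1 : alpha < 1) (beta_ge0 : 0 <= beta) :
  (* (i) *)
  (forall t s : R, 0 < t -> 0 < s -> 0 <= psi alpha beta t s%:C) /\
  (* (ii) *)
  (forall s lambda : R, 0 < s -> 0 < lambda ->
     let f := fun t : R => (expR (- (lambda * t)))%:C * psi alpha beta t s%:C in
     cintegrable `]0, +oo[ f /\
     cintegral `]0, +oo[ f =
       (lambda `^ (- beta) * expR (- (lambda `^ alpha * s)))%:C) /\
  (* (iii) *)
  (forall (t : R) (lambda : R[i]), 0 < t ->
     let f := fun s : R => cexp (lambda * s%:C) * psi alpha beta t s%:C in
     cintegrable `]0, +oo[ f /\
     cintegral `]0, +oo[ f =
       (t `^ (alpha + beta - 1))%:C *
       mittag_leffler alpha (alpha + beta) (lambda * (t `^ alpha)%:C)) /\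
  (* (iv) *)
  (forall lambda mu : R, 0 < lambda -> 0 < mu ->
     let f := fun t s : R =>
       (expR (- (lambda * s)))%:C * (expR (- (mu * t)))%:C *
       psi alpha beta t s%:C in
     (forall t : R, 0 < t -> cintegrable `]0, +oo[ (f t)) /\
     cintegrable `]0, +oo[ (fun t => cintegral `]0, +oo[ (f t)) /\
     cintegral `]0, +oo[ (fun t => cintegral `]0, +oo[ (f t)) =
       (1 / (mu `^ beta * (mu `^ alpha + lambda)))%:C) /\
  (* (v) *)
  (forall t s gamma : R, 0 < t -> 0 < s -> 0 < gamma ->
     let h := fun r : R => psi alpha beta r s%:C in
     cintegrable `]0, t[ (conv_integrand (g_ gamma) h t) /\
     psi alpha (beta + gamma) t s%:C = convolution (g_ gamma) h t) /\
  (* (vi) *)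
  (forall t eta : R, 0 < t -> 0 < eta ->
     let f := fun s : R => g_ eta s * psi alpha beta t s%:C in
     cintegrable `]0, +oo[ f /\
     cintegral `]0, +oo[ f = g_ (alpha * eta + beta) t).
Proof.
split; [|split; [|split; [|split; [|split]]]].
- by move=> t s _ s0; rewrite psi_real// ler0c rpsi_ge0// ltW.
- move=> s l s0 l0 f.
  have fE t : `]0, +oo[%classic t -> f t = (expR (- (l * t)) * rpsi alpha beta t s)%:C.
    by rewrite /f psi_real// -rmorphM.
  have [I E] := integrable_laplace_psi alpha_gt0 alpha_lt1 beta_ge0 l0 s0.
  have [If Ef] := cintegral_real (measurable_itv _) fE I.
  by split => //; rewrite Ef E.
- by move=> t l t0; exact: exp_moment_psi.
- move=> l m l0 m0 f.
  have [I J E] := integrable_double_laplace_psi alpha_gt0 alpha_lt1 beta_ge0 l0 m0.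
  pose h (t s : R) := expR (- (l * s)) * expR (- (m * t)) * rpsi alpha beta t s.
  have fE t s : `]0, +oo[%classic s -> f t s = (h t s)%:C.
    by rewrite /f psi_real// -!rmorphM.
  have inner t (t0 : 0 < t) := cintegral_real (measurable_itv _) (fE t) (I t t0).
  have outer t : `]0, +oo[%classic t -> cintegral `]0, +oo[ (f t) =
      (\int[lebesgue_measure]_(s in `]0, +oo[) h t s)%:C.
    by rewrite /= in_itv/= andbT => /inner[].
  have [Jf Ef] := cintegral_real (measurable_itv _) outer J.
  by split; [move=> t /inner[]|split => //; rewrite Ef E].
- move=> t s gamma t0 s0 g0 h.
  have hE r : `]0, t[%classic r -> conv_integrand (g_ gamma) h t r =
      (recipGamma gamma * ((t - r) `^ (gamma - 1) * rpsi alpha beta r s))%:C.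
    by move=> _; rewrite /conv_integrand /h g_real psi_real// -rmorphM; congr (_%:C); ring.
  have I := integrable_conv_psi alpha_gt0 alpha_lt1 beta_ge0 s0 g0 t0.
  have [Ih E] := cintegral_real (measurable_itv _) hE
    (integrable_EFinZ (measurable_itv _) (recipGamma gamma) I).
  split => //; rewrite /convolution E psi_real// RintegralZl//; congr (_%:C).
  rewrite -[X in _ * X]/(rconv alpha beta s gamma t).
  by rewrite rconv_psi// recipGamma_gt0E// mulKf// gt_eqF// rGamma_gt0.
- move=> t eta t0 e0 f.
  have fE s : `]0, +oo[%classic s ->
      f s = (recipGamma eta * (s `^ (eta - 1) * rpsi alpha beta t s))%:C.
    by move=> _; rewrite /f g_real psi_real// -rmorphM; congr (_%:C); ring.
  have I := integrable_mellin_psi alpha_gt0 alpha_lt1 beta_ge0 e0 t0.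
  have [If E] := cintegral_real (measurable_itv _) fE
    (integrable_EFinZ (measurable_itv _) (recipGamma eta) I).
  split => //; rewrite E g_real RintegralZl//; congr (_%:C).
  rewrite /Rintegral mellin_psi//= recipGamma_gt0E// -mulrA mulKf ?gt_eqF ?rGamma_gt0//.
  exact: mulrC.
Qed.
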